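(* Let $G$ be a finite group with nontrivial centre whose commuting graph contains an isolated edge $\{v,w\}$. Then one of the following holds: (i) $G\cong\mathrm{SL}(2,3)$ or $G\cong\mathrm{SL}(2,5)$, or (ii) $G$ has an abelian normal subgroup $N$ of odd order with $G/N\cong\mathrm{GL}(2,3)$ or $J$, the preimage of $\mathrm{SL}(2,3)$ in $G$ centralises $N$, and $v$ acts on $N$ by inversion, or (iii) $G\cong N\rtimes H$ where $N$ is an abelian group of odd order and $H$ is isomorphic to one of $\mathbb{Z}_4$, $D_4$, $D_8$, $Q_8$, or $D_{2^k}$, $SD_{2^k}$, $Q_{2^k}$ with $k\ge 4$. Furthermore, the group induced by the action of $H$ on $N$ via conjugation is $\mathbb{Z}_2$ or $\mathbb{Z}_2\times\mathbb{Z}_2$, and $v$ acts on $N$ by inversion.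
   Context: For a group $G$ with centre $Z(G)$, the commuting graph $\Gamma(G)$ is the simple graph with vertex set $G\setminus Z(G)$ in which two distinct vertices $x,y$ are adjacent if and only if $xy=yx$. An edge $\{v,w\}$ is isolated if $\{v,w\}$ is the vertex set of a connected component. An element $v$ acts on $N$ by inversion if $v^{-1}nv=n^{-1}$ for all $n\in N$. Write $x^y=y^{-1}xy$. Groups: $\mathbb{Z}_m$ is the cyclic group of order $m$; $\mathrm{GL}(2,q)$ and $\mathrm{SL}(2,q)$ are the general and special linear groups of $2\times 2$ matrices over the field with $q$ elements. $J=\langle a,b,c,\gamma\mid a^3=b^3=c^2=abc=\gamma^2,\ a^\gamma=b\rangle$, a non-split extension of $\mathrm{SL}(2,3)=\langle a,b,c\mid a^3=b^3=c^2=abc\rangle$ by $\langle\gamma\rangle\cong\mathbb{Z}_4$ (it is SmallGroup(48,28) in GAP). $D_{2n}=\langle a,b\mid a^n=b^2=1,\ a^b=a^{-1}\rangle$ for $n\ge 2$ is the dihedral group of order $2n$ (so $D_4\cong\mathbb{Z}_2\times\mathbb{Z}_2$). $SD_{2n}=\langle a,b\mid a^n=b^2=1,\ a^b=a^{n/2-1}\rangle$ for $n=2^k\ge 8$ is the semidihedral group of order $2n$. $Q_{4n}=\langle a,b\mid a^{2n}=b^4=1,\ a^n=b^2,\ a^b=a^{-1}\rangle$ for $n\ge 2$ is the generalised quaternion group of order $4n$. The preimage of $\mathrm{SL}(2,3)$ in $G$ means the preimage, under $G\to G/N$, of the subgroup $\mathrm{SL}(2,3)$ of $\mathrm{GL}(2,3)$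 or of the subgroup $\mathrm{SL}(2,3)=\langle a,b,c\rangle$ of $J$.
   Formalization: In (iii), that the group induced by H on N is Z_2 or Z_2×Z_2 is claimed only for N nontrivial; for N = 1 (e.g. G = D_8, which has an isolated edge and nontrivial centre) the induced group is trivial, so the claim as written is false. *)

(* Defs.v *)
From HB Require Import structures.
From mathcomp Require Import all_boot all_order all_fingroup all_algebra all_solvable.

Set Implicit Arguments.
Unset Strict Implicit.
Unset Printing Implicit Defensive.

Import GroupScope.

Section CommutingGraph.

Variables (gT : finGroupType) (G : {group gT}).

Definition cgraph_vertices : {set gT} := G :\: 'Z(G).

(* An element of gT outside G \ Z(G) is incident to no edge, so the paths of   *)
(* this relation that start at a vertex stay among the vertices.              *)
Definition cgraph_edge : rel gT := fun x y =>
  [&& x \in cgraph_vertices, y \in cgraph_vertices, x != y & x * y == y * x].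

Definition cgraph_components : {set {set gT}} :=
  equivalence_partition (connect cgraph_edge) cgraph_vertices.

Definition isolated_edge (v w : gT) : bool :=
  cgraph_edge v w && ([set v; w] \in cgraph_components).

End CommutingGraph.

Definition acts_by_inversion (gT : finGroupType) (v : gT) (N : {set gT}) :=
  {in N, forall n, n ^ v = n^-1}.

Section SpecialLinear.

Variables (n : nat) (F : finFieldType).

Definition SL : {set {'GL_n[F]}} := [set u | (\det (GLval u) == 1)%R].

Lemma group_set_SL : group_set SL.
Proof.
apply/group_setP; split=> [|x y]; first by rewrite inE GL_1E det1.
by rewrite !inE GL_MxE det_mulmx => /eqP-> /eqP->; rewrite GRing.mulr1.
Qed.

Canonical SL_group := Group group_set_SL.

End SpecialLinear.

Section J.

Variables (gT : finGroupType) (Q : {group gT}).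

(* The presented group has order 48, so that being its largest finite quotient *)
(* (which is what \isog Grp says) amounts to being isomorphic to it.           *)
Definition isog_J : Prop :=
  Q \isog Grp (a : b : c : g :
    a ^+ 3 = g ^+ 2, b ^+ 3 = g ^+ 2, c ^+ 2 = g ^+ 2, a * b * c = g ^+ 2,
    a ^ g = b).

(* When Q is isomorphic to J, these are exactly the images of the standard     *)
(* generators of J under the isomorphisms from J to Q.                         *)
Definition J_generators (a b c g : gT) : Prop :=
  <<[set a; b; c; g]>> = Q
  /\ [/\ a ^+ 3 = g ^+ 2, b ^+ 3 = g ^+ 2, c ^+ 2 = g ^+ 2,
         a * b * c = g ^+ 2 & a ^ g = b].

End J.

Section Cases.

Variables (gT : finGroupType).

(* K is the full preimage in G of SL(2,3) under an isomorphism from G / N to   *)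
(* GL(2,3).                                                                    *)
Definition quotient_GL23_preim_SL23 (G N K : {group gT}) : Prop :=
  exists f : {morphism G / N >-> {'GL_2(3)}},
    isom (G / N) 'GL_2(3) f /\ K :=: coset N @*^-1 (f @*^-1 SL 2 'F_3).

(* K is the full preimage in G of <a, b, c> under an isomorphism from G / N    *)
(* to J.                                                                       *)
Definition quotient_J_preim_SL23 (G N K : {group gT}) : Prop :=
  isog_J (G / N)
  /\ exists a b c g : coset_of N,
       J_generators (G / N) a b c g /\ K :=: coset N @*^-1 <<[set a; b; c]>>.

Definition complement_type (H : {group gT}) : Prop :=
  [\/ H \isog Zp 4, H \isog 'D_4, H \isog 'D_8 | H \isog 'Q_8]
  \/ exists2 k, 4 <= k &
       [\/ H \isog 'D_(2 ^ k), H \isog 'SD_(2 ^ k) | H \isog 'Q_(2 ^ k)].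

(* conj_aut N @* H is the image of H in Aut N.                                 *)
Definition induces_Z2_or_Z2xZ2 (H N : {group gT}) : Prop :=
  conj_aut N @* H \isog Zp 2 \/ conj_aut N @* H \isog setX (Zp 2) (Zp 2).

End Cases.

(* Main.v *)
Require Import Defs.
From HB Require Import structures.
From mathcomp Require Import all_boot all_order all_fingroup all_algebra all_solvable.
From mathcomp Require Import ring zify.

Set Implicit Arguments.
Unset Strict Implicit.
Unset Printing Implicit Defensive.

Import GroupScope.

(** The vertices v, w of the isolated edge satisfy 'C_G[v] = 'Z(G) :|: [set v; w],
    so 'Z(G) = <[z]> has order 2 and 'C_G[v] has order 4.  Hence v inverts the
    odd core N = 'O_2^'(G), which is abelian, and v N has a centraliser of order 4
    in L = G / N.  If L is a 2-group, then G = N ><| P for a Sylow 2-subgroup P,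
    which has a cyclic subgroup of index 2 by induction through P / 'Z(P).

    Otherwise H = L / <[z N]> has a Sylow 2-subgroup D that is a four-group or
    dihedral, and the image t of v is an involution with a centraliser of order 4.
    Parities of permutations of cosets force fusion of the involutions of D, and
    the order of H is bounded by comparing #|t ^: H| = #|H| / 4 with the number of
    conjugates of t in the cosets of a subgroup: 'N_H(D) when D is a four-group,
    the centraliser of the central involution of D when D is dihedral.  Either D
    is a four-group and H is 'Alt_4 or 'Alt_5, or D is dihedral of order 8 and H
    has order 24 and a normal four-group.  In the soluble cases L is determined by
    generators a, b with aba = b^2 and bab = a^2, extended by v when D is dihedral.
    In the last case, the fibre product over 'Alt_5 of L and SL(2, 5) splits over
    the diagonal subgroup of order 2 by Gaschuetz's theorem, whence L \isog SL(2, 5). *)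

(** * Parity of permutation actions and normal complements *)

(** The counts close because the conjugates of [t] make up exactly a quarter of [H]: once no coset
    of the chosen subgroup [M] exceeds that proportion, every coset attains it, and the equality
    cases reveal the structure of [M :&: M :^ u]. The bound rests on a remark about involutions: if
    [u] and [m * u] are both involutions, then [u] inverts [m], so [m] lies in [M :&: M :^ u].
    Fusion also decides what becomes of [N]. If [D] is a four-group with all its involutions
    conjugate to [t], then two conjugates of [v] multiply to a third up to a factor centralising
    [N]; all three invert [N], which forces [N] to be trivial. If [D] is dihedral, its central
    involution is not conjugate to [t] and this obstruction disappears. There [b] is taken to be
    [a ^ v], in keeping with the symmetry of the relations in [a] and [b], and the subgroup they
    generate centralises [N] because [a] is built from commutators with [v]. *)

Lemma odd_perm_semiregular (T : finType) (s : {perm T}) (S : {set T}) m r :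
    0 < m -> ~~ odd m -> #|S| = (m * r)%N ->
    {in S, forall x, #|porbit s x| = m} ->
    {in ~: S, forall x, s x = x} -> odd_perm s = odd r.
Proof.
move=> m_gt0 evm oS orbS fixS.
have fixE x : x \in ~: S -> porbit s x = [set x].
  move=> S'x; apply/setP=> y; rewrite inE; apply/porbitP/eqP=> [[i ->] | ->].
    by elim: i => [|i IHi]; rewrite ?perm1 // expgSr permM IHi fixS.
  by exists 0; rewrite perm1.
have SP x : x \in S -> s x \in S.
  move=> Sx; apply: contraLR (Sx); rewrite -!in_setC => S'sx.
  by rewrite -(perm_inj (fixS _ S'sx)).
have actsS : [acts <[s]>, on S | 'P].
  by rewrite cycle_subG !inE /=; apply/subsetP=> x Sx; rewrite inE /= SP.
have partS: partition (porbit s @: S) S.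
  by rewrite porbitE; apply: orbit_partition.
have oO: #|porbit s @: S| = r.
  have /(_ m) := card_uniform_partition _ partS.
  rewrite oS mulnC => oSr; apply/esym/eqP; rewrite -(eqn_pmul2r m_gt0).
  by apply/eqP/oSr => _ /imsetP[x Sx ->]; apply: orbS.
have def_orb: porbits s = porbit s @: S :|: porbit s @: ~: S.
  rewrite -imsetU setUCr; apply/setP=> B.
  by apply/imsetP/imsetP=> -[y _ ->]; exists y.
have oO': #|porbit s @: ~: S| = #|~: S|.
  by apply: card_in_imset => x y S'x S'y; rewrite !fixE // => /set1_inj.
have tiO: [disjoint porbit s @: S & porbit s @: ~: S].
  rewrite -setI_eq0; apply/set0Pn=> -[_ /setIP[/imsetP[x Sx ->]]].
  case/imsetP=> y S'y eqxy; have := porbit_id s x; rewrite eqxy fixE // inE.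
  by move/eqP=> xy; rewrite -xy inE Sx in S'y.
(* The sign is the parity of [#|T|] plus the number of cycles; the fixed points cancel, and [m * r]
   is even. *)
rewrite /odd_perm def_orb cardsU disjoint_setI0 // cards0 subn0 oO oO'.
by rewrite -(cardsC S) oS !oddD oddM (negPf evm) /= addbC -addbA addbb addbF.
Qed.

(* Sign of the permutation action on the cosets of M, on which <[x]> acts
   semiregularly. *)
Lemma index2_normal_avoiding (gT : finGroupType) (G M : {group gT}) x r :
    M \subset G -> x \in G -> ~~ odd #[x] -> #|G : M| = (#[x] * r)%N -> odd r ->
    {in G, forall g, M :&: <[x]> :^ g = 1} ->
  exists K : {group gT}, [/\ K <| G, #|G : K| = 2 & x \notin K].
Proof.
move=> sMG Gx evx iMG odd_r tiMx.
have nRG: [acts G, on rcosets M G | 'Rs] by apply: actsRs_rcosets.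
pose to := <[nRG]>%act; pose f := actperm to.
have hM : {in G &, {morph (fun g => odd_perm (f g)) : a b / a * b}}.
  by move=> a b Ga Gb; rewrite /= /f actpermM // odd_permM.
pose h := Morphism hM.
have hx : h x = true.
  rewrite /h /=.
  have fE g H : g \in G -> H \in rcosets M G -> f g H = H :* g.
    by move=> Gg HR; rewrite actpermE /= actbyE //= rcosetE.
  rewrite (@odd_perm_semiregular _ _ (rcosets M G) #[x] r) ?order_gt0 //.
    move=> _ /rcosetsP[g Gg ->]; rewrite porbit_actperm //.
    have sXG: <[x]> \subset G by rewrite cycle_subG.
    have MgR: M :* g \in rcosets M G by apply/rcosetsP; exists g.
    have toE y : y \in <[x]> -> to (M :* g) y = M :* (g * y).
      by move=> Xy; rewrite /to actbyE ?(subsetP sXG) //= rcosetE rcosetM.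
    rewrite card_in_imset // => y y' Xy Xy'; rewrite !toE // => eqMg.
    apply/eqP; rewrite eq_mulgV1 -(conjg_eq1 _ g^-1) -in_set1 -set1gE.
    rewrite -(tiMx g^-1) ?groupV //; apply/setIP; split; last first.
      by rewrite memJ_conjg groupM ?groupV.
    have:= rcoset_refl M (g * y); rewrite eqMg mem_rcoset.
    by rewrite conjgE !invMg invgK !mulgA.
  by move=> H; rewrite inE => /negPf nRH; rewrite actpermE /= /actby nRH.
exists ('ker h)%G; split; first exact: ker_normal.
  rewrite -card_quotient ?ker_norm // (card_isog (first_isog h)).
  rewrite /=; have ->: h @* G = [set: bool]; last by rewrite cardsT card_bool.
  apply/setP=> b; rewrite inE; apply/morphimP; case: b.
    by exists x; rewrite ?hx.
  by exists 1; rewrite ?morph1.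
by rewrite !inE Gx; move: hx => /= ->.
Qed.

Lemma Hall_pcore_normal pi (gT : finGroupType) (G K : {group gT}) :
    K <| G -> pi^'.-nat #|G : K| -> pi.-Hall(K) 'O_pi(K) ->
  pi.-Hall(G) 'O_pi(G).
Proof.
move=> nsKG pi'GK hallK; have sKG := normal_sub nsKG.
have nsOG: 'O_pi(K) <| G by apply: gFnormal_trans.
have hallG: pi.-Hall(G) 'O_pi(K).
  rewrite pHallE (normal_sub nsOG) /=.
  rewrite (card_Hall hallK) -(Lagrange sKG) partnM ?cardG_gt0 //.
  by rewrite (part_p'nat pi'GK) muln1.
by rewrite (normal_Hall_pcore hallG nsOG).
Qed.

(** A generator of a nontrivial [P] acts on [G] by translation in [#|G : P|] cycles of even length,
    an odd permutation; induction applies to the subgroup of even elements. *)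
Lemma cyclic_Sylow2_Hall_pcore (gT : finGroupType) (G P : {group gT}) :
  2.-Sylow(G) P -> cyclic P -> 2^'.-Hall(G) 'O_2^'(G).
Proof.
have [n] := ubnP #|G|; elim: n G P => // n IHn G P /ltnSE-leGn sylP cycP.
have [sPG pP _] := and3P sylP.
have [P1 | ntP] := eqVneq P 1%G.
  have p'G : 2^'.-group G.
    have:= card_Hall sylP; rewrite P1 cards1 => /esym/eqP.
    by rewrite partn_eq1.
  by rewrite (pcore_pgroup_id p'G) // /pHall subxx p'G indexgg.
have [x defP] := cyclicP cycP.
have [_ dvd2P _] := pgroup_pdiv pP ntP.
have [||||||K [nsKG iK notKx]] := @index2_normal_avoiding _ G 1 x (#|G|`_2^').
- exact: sub1G.
- by rewrite (subsetP sPG) // defP cycle_id.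
- by rewrite orderE -defP -dvdn2.
- by rewrite indexg1 orderE -defP (card_Hall sylP) partnC.
- by rewrite odd_2'nat part_pnat.
- by move=> g _; apply/trivgP; rewrite subsetIl.
have nsKP : 2.-Sylow(K) (K :&: P) by apply: Sylow_setI_normal sylP.
apply: (@Hall_pcore_normal _ _ G K) => //; first by rewrite iK pnatNK.
apply: IHn nsKP _; last exact: cyclicS (subsetIr _ _) cycP.
apply: leq_trans leGn; apply: proper_card; rewrite properEneq normal_sub // andbT.
by apply/eqP=> eqKG; move: iK; rewrite eqKG indexgg.
Qed.

(** This is Thompson's transfer lemma: with no conjugate in [M], the involution [t] has no fixed
    point on the cosets of [M], so it acts as [#|G : P|] transpositions, an odd number. *)
Lemma index2_normal_avoiding_involution (gT : finGroupType)
    (G P M : {group gT}) t :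
    2.-Sylow(G) P -> M \subset P -> #|P : M| = 2 -> t \in G -> #[t] = 2 ->
    {in G, forall g, t ^ g \notin M} ->
  exists K : {group gT}, [/\ K <| G, #|G : K| = 2 & t \notin K].
Proof.
move=> sylP sMP iMP Gt ot notMt; have [sPG pP p'GP] := and3P sylP.
have sMG := subset_trans sMP sPG.
apply: (@index2_normal_avoiding _ G M t #|G : P|) => //.
- by rewrite ot.
- by rewrite ot mulnC -iMP Lagrange_index.
- by rewrite odd_2'nat.
move=> g Gg; apply/trivgP/subsetP=> y /setIP[My].
rewrite /= -cycleJ cycle2g ?orderJ // => /set2P[-> // | def_y].
by rewrite def_y (negPf (notMt g Gg)) in My.
Qed.

(** * Elements with a centraliser of order 4 in a 2-group *)

(** A noncentral [t] has a centraliser properly containing the centre, which is not trivial. *)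
Lemma card_cent1_2group (gT : finGroupType) (D : {group gT}) t :
  2.-group D -> 4 <= #|D| -> t \in D -> 4 <= #|'C_D[t]|.
Proof.
move=> pD leD Dt; have [cDt | not_cDt] := boolP (D \subset 'C[t]).
  by rewrite (setIidPl cDt).
have notZt: t \notin 'Z(D).
  by apply: contra not_cDt => /setIP[_]; rewrite sub_cent1.
have Ct: t \in 'C_D[t] by rewrite inE Dt cent1id.
have sZC: 'Z(D) \subset 'C_D[t].
  by rewrite setIS // -cent_set1 centS // sub1set.
have ntZ: 'Z(D) != 1.
  by apply: contraNneq not_cDt => /(trivg_center_pgroup pD) D1; rewrite D1 cards1 in leD.
have [_ _ [n oZ]] := pgroup_pdiv (pgroupS (center_sub D) pD) ntZ.
rewrite -(Lagrange sZC) (@leq_mul 2 2) //; first by rewrite oZ (leq_exp2l 1).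
rewrite ltnNge; apply: contra notZt => iZ.
have: #|'C_D[t] : 'Z(D)| == 1%N by rewrite eqn_leq iZ indexg_gt0.
by rewrite indexg_eq1 => /subsetP->.
Qed.

(** The preimage [W] of the centraliser [B] moves [v] only inside [v *: Z], so ['C_W[v]] has index
    at most [#|Z|] in [W], while [#|W| = #|Z| * #|B|]. *)
Lemma card_cent1_quotient_le (gT : finGroupType) (G Z : {group gT}) v :
  Z \subset 'Z(G) -> v \in G -> #|'C_(G / Z)[coset Z v]| <= #|'C_G[v]|.
Proof.
move=> sZG Gv; have nsZG: Z <| G by apply: sub_center_normal.
have nZv: v \in 'N(Z) by apply: subsetP Gv; apply: normal_norm.
pose B := 'C_(G / Z)[coset Z v]%G; pose W := (coset Z @*^-1 B)%G.
have sWG: W \subset G by rewrite -(quotientGK nsZG) morphpreS ?subsetIl.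
have oW: #|W| = (#|Z| * #|B|)%N.
  by rewrite card_cosetpre.
have vW: v ^: W \subset v *: Z.
  apply/subsetP=> _ /imsetP[g Wg ->].
  have Gg := subsetP sWG g Wg; have nZg := subsetP (normal_norm nsZG) g Gg.
  have /setIP[_ /cent1P cvg] : coset Z g \in B.
    by move: Wg; rewrite inE => /andP[_]; rewrite inE.
  rewrite mem_lcoset -[v^-1 * _]/([~ v, g]) coset_idr ?groupR //.
  by rewrite morphR //; apply/eqP/commgP.
rewrite -(leq_pmul2l (cardG_gt0 Z)) -oW.
have sCW: 'C_W[v] \subset W := subsetIl _ _.
rewrite -(Lagrange sCW) mulnC index_cent1 leq_mul //.
  by rewrite -(card_lcoset Z v) subset_leq_card.
by rewrite subset_leq_card // setSI.
Qed.

Lemma involutions_abelem (gT : finGroupType) (P : {group gT}) :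
  {in P, forall x, x ^+ 2 = 1} -> 2.-abelem P.
Proof.
move=> P2; apply/abelemP=> //; split=> //.
have invP x : x \in P -> x^-1 = x.
  by move=> Px; apply/eqP; rewrite eq_invg_mul -expg2 P2.
apply/centsP=> x Px y Py.
by rewrite /commute -{1}(invP _ (groupM Px Py)) invMg !invP.
Qed.

Section TwoGroup.

Variables (gT : finGroupType) (P : {group gT}) (v : gT).
Hypotheses (pP : 2.-group P) (Pv : v \in P) (oCv : #|'C_P[v]| = 4) (leP : 8 <= #|P|).

Lemma cent4_not_abelian : ~~ abelian P.
Proof.
apply/negP=> cPP; move: leP; rewrite -(_ : 'C_P[v] = P) ?oCv //.
by apply/setIidPl; rewrite sub_cent1 (subsetP cPP).
Qed.

Lemma cent4_center : #|'Z(P)| = 2 /\ v \notin 'Z(P).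
Proof.
have notZv: v \notin 'Z(P).
  apply: contraL (leP) => /setIP[_ cPv]; rewrite -ltnNge -(_ : 'C_P[v] = P) ?oCv //.
  by apply/setIidPl; rewrite sub_cent1.
split=> //.
have sZC: 'Z(P) \subset 'C_P[v] by rewrite setIS // -cent_set1 centS // sub1set.
have ntZ: 'Z(P) != 1.
  by apply: contraTneq leP => /(trivg_center_pgroup pP) ->; rewrite cards1.
have [_ _ [n oZ]] := pgroup_pdiv (pgroupS (center_sub P) pP) ntZ.
have: #|'Z(P)| < 4.
  rewrite -oCv proper_card // properEneq sZC andbT.
  by apply: contraNneq notZv => ->; rewrite inE Pv cent1id.
by rewrite oZ; case: n {oZ} => // n; rewrite !expnS mulnA ltnNge leq_pmulr ?expn_gt0.
Qed.

End TwoGroup.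

(** A cyclic subgroup of index 2 in [P / 'Z(P)] lifts to [<[x]> <*> 'Z(P)], of index 2 in [P]; the
    point is that [<[x]>] already contains ['Z(P)]. For [#|P| = 8], a nonabelian group has an
    element of order 4. *)
Lemma cent4_cyclic_index2 (gT : finGroupType) (P : {group gT}) v :
    2.-group P -> v \in P -> #|'C_P[v]| = 4 -> 8 <= #|P| ->
  exists2 x, x \in P & #|P : <[x]>| = 2.
Proof.
have [n] := ubnP #|P|; elim: n gT P v => // n IHn gT P v /ltnSE-lePn pP Pv oCv leP.
have not_cPP := cent4_not_abelian Pv oCv leP.
have [oZ notZv] := cent4_center pP Pv oCv leP.
have sZP := center_sub P; have nsZP := center_normal P.
have [k oP] := p_natP pP.
have oPZ : #|P / 'Z(P)| = (2 ^ k.-1)%N.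
  rewrite card_quotient ?normal_norm // -divgS // oP oZ.
  by case: k oP leP => [->|k _ _] //; rewrite expnS mulKn.
have [k3 | k_neq3] := eqVneq k 3.
  have [x Px ox] : exists2 x, x \in P & 2 < #[x].
    apply/exists_inP; apply: contraR not_cPP; rewrite negb_exists_in => /forall_inP P2.
    apply: (@abelem_abelian _ 2); apply: involutions_abelem => x Px.
    by apply/eqP; rewrite -order_dvdn; case: #[x] (order_gt0 x) (P2 x Px) => [|[|[]]].
  exists x => //; have: #[x] %| #|P| by apply: order_dvdG.
  rewrite oP k3 => /(dvdn_pfactor _ _ (isT : prime 2))[j le_j3 oxj].
  have sxP: <[x]> \subset P by rewrite cycle_subG.
  have j2: j = 2.
    case: j le_j3 oxj ox => [|[|[|[|]]]] //= _ ox; rewrite ?ox // => _.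
    case/negP: not_cPP; rewrite (_ : P :=: <[x]>) ?cycle_abelian //.
    by apply/esym/eqP; rewrite eqEcard sxP oP k3 -orderE ox.
  by rewrite -divgS // oP k3 -orderE oxj j2.
have k_gt3 : 3 < k.
  by rewrite ltn_neqAle eq_sym k_neq3 /= -(@leq_exp2l 2) // -oP.
have lePZ: 8 <= #|P / 'Z(P)|.
  by rewrite oPZ (@leq_exp2l 2 3) // -ltnS (ltn_predK k_gt3).
have PZv: coset 'Z(P) v \in P / 'Z(P) by apply: mem_quotient.
have [|||||xb Pxb ixb] := IHn _ (P / 'Z(P))%G (coset 'Z(P) v); rewrite ?quotient_pgroup //.
- apply: leq_trans lePn; rewrite oPZ oP ltn_exp2l //.
  by rewrite (ltn_predK k_gt3).
- apply/eqP; rewrite eqn_leq card_cent1_2group ?quotient_pgroup ?(leq_trans _ lePZ) //.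
  by rewrite andbT -oCv card_cent1_quotient_le.
have [x nZx Px def_xb] := morphimP Pxb.
exists x => //; have sxP: <[x]> \subset P by rewrite cycle_subG.
have nZP := normal_norm nsZP.
have nZx' : <[x]> \subset 'N('Z(P)) by apply: subset_trans nZP.
have sHP : <[x]> <*> 'Z(P) \subset P by rewrite join_subG sxP.
have iH : #|P : <[x]> <*> 'Z(P)| = 2.
  have sPZH : P :&: 'Z(P) \subset <[x]> <*> 'Z(P) by rewrite (setIidPr sZP) joing_subr.
  rewrite -(index_quotient_eq sPZH sHP nZP) /=.
  by rewrite quotientYidr // quotient_cycle // -def_xb.
have [sZx | not_sZx] := boolP ('Z(P) \subset <[x]>).
  by rewrite -iH (joing_idPl sZx).
have tiZx : 'Z(P) :&: <[x]> = 1 by rewrite prime_TIg ?oZ.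
have ox : 4 <= #[x].
  have oxb : 4 <= #[xb].
    have/Lagrange: <[xb]> \subset (P / 'Z(P))%G by rewrite cycle_subG.
    by rewrite ixb => oxb; rewrite -(leq_pmul2r (isT : 0 < 2)) oxb.
  by apply: leq_trans oxb (dvdn_leq _ _); rewrite // def_xb morph_order.
(* Squares in [<[x]> <*> 'Z(P)] are powers of [x ^+ 2], since ['Z(P)] has order 2. So [<[x ^+ 2]>]
   is normal and, being nontrivial, meets the centre, against [tiZx]. *)
have nx2 : <[x ^+ 2]> <| P.
  apply/andP; split; first by rewrite cycle_subG groupX.
  apply/subsetP=> g Pg; rewrite inE -cycleJ cycle_subG.
  have: x ^ g \in <[x]> <*> 'Z(P).
    rewrite memJ_norm; first by rewrite mem_gen // inE cycle_id.
    by apply: subsetP Pg; apply/normal_norm/index2_normal.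
  rewrite norm_joinEl // => /mulsgP[y u /cycleP[i ->] Zu def_xg].
  have u2: u ^+ 2 = 1 by apply/eqP; rewrite -order_dvdn -oZ order_dvdG.
  rewrite conjXg def_xg expgMn; last by case/centerP: Zu => _ cu; apply/commute_sym/cu/groupX.
  by rewrite u2 mulg1 expgAC mem_cycle.
have: <[x ^+ 2]> :&: 'Z(P) != 1.
  rewrite (meet_center_nil (pgroup_nil pP) nx2) //.
  by rewrite cycle_eq1 -order_dvdn gtnNdvd ?(leq_trans _ ox).
have sx2x : <[x ^+ 2]> \subset <[x]> by apply: cycleX.
by case/negP; rewrite -subG1 /= setIC (subset_trans (setIS _ sx2x)) ?tiZx.
Qed.

Section Extremal.

Variables (gT : finGroupType) (P : {group gT}) (v : gT).
Hypotheses (pP : 2.-group P) (Pv : v \in P) (oCv : #|'C_P[v]| = 4).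

(** Among the nonabelian 2-groups with a cyclic maximal subgroup, the modular ones are ruled out by
    their centre, of order [#|P| / 4] with [#|P| >= 16]. *)
Lemma cent4_complement_type : 8 <= #|P| -> complement_type P.
Proof.
move=> leP; have not_cPP := cent4_not_abelian Pv oCv leP.
have [oZ _] := cent4_center pP Pv oCv leP.
have [x Px ix] := cent4_cyclic_index2 pP Pv oCv leP.
have sxP : <[x]> \subset P by rewrite cycle_subG.
have n_gt2 n : #|P| = (2 ^ n)%N -> 2 < n by move=> oP; rewrite -(@leq_exp2l 2) // -oP.
case/orP: (maximal_cycle_extremal pP not_cPP (cycle_cyclic x) sxP ix) => [/eqP|/andP[_ ext]].
  case/modular_group_classP=> p p_pr [n le3n isoP].
  have n_gt0: 0 < n by case: n le3n {isoP} => //; rewrite addn3.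
  have oP: #|P| = (p ^ n)%N.
    by rewrite (card_isog isoP) card_modular_group // (leq_trans _ le3n) ?addn3.
  have p2: p = 2.
    by apply/eqP/(pgroupP pP); rewrite // oP dvdn_exp.
  rewrite p2 /= in le3n isoP oP *.
  have n3 : 2 < n := ltnW le3n.
  have [[a b] gen_ab mod_ab] := generators_modular_group (isT : prime 2) n3 isoP.
  have [_ [_ _ oZr] _ _ _] := modular_group_structure (isT : prime 2) n3 gen_ab isoP mod_ab.
  move/eqP: oZr; rewrite oZ -{1}[2]expn1 eqn_exp2l // => /eqP n1.
  by rewrite -(ltn_predK n3) -(ltn_predK (_ : 1 < n.-1)) -?n1 // -ltnS (ltn_predK n3) in le3n.
have: [\/ extremal_class P = Dihedral, extremal_class P = SemiDihedral | extremal_class P = Quaternion].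
  by move: ext; rewrite /extremal2 !inE; case: extremal_class => // _;
    [apply: Or31 | apply: Or32 | apply: Or33].
case=> [/dihedral_classP | /semidihedral_classP | /quaternion_classP] [n ? iso].
- have /n_gt2 n2 : #|P| = (2 ^ n)%N by rewrite (card_isog iso) card_2dihedral.
  have [n3|n3] := eqVneq n 3; first by left; rewrite n3 in iso; apply: Or43.
  by right; exists n; [rewrite ltn_neqAle eq_sym n3 | apply: Or31].
- by right; exists n => //; apply: Or32.
have [n3|n3] := eqVneq n 3; first by left; rewrite n3 in iso; apply: Or44.
by right; exists n; [rewrite ltn_neqAle eq_sym n3 | apply: Or33].
Qed.

(* As [v^P] has [|P|/4 = |P'|] elements, it fills the coset [v P']. *)
Lemma cent4_class : 8 <= #|P| -> #|P : P^`(1)| = 4 /\ v ^: P = v *: P^`(1).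
Proof.
move=> leP; have not_cPP := cent4_not_abelian Pv oCv leP.
have sP'P := der_sub 1 P.
have ge4: 4 <= #|P : P^`(1)|.
  have nil_cyc := cyclic_nilpotent_quo_der1_cyclic (pgroup_nil pP).
  rewrite -card_quotient ?der_norm // ltnNge; apply: contra not_cPP => le3.
  apply/cyclic_abelian/nil_cyc; have pQ : 2.-group (P / P^`(1)) by apply: quotient_pgroup.
  have [n oQ] := p_natP pQ; case: n oQ le3 => [|[|n]] oQ.
  - by rewrite (card1_trivg oQ) cyclic1.
  - by rewrite prime_cyclic // oQ.
  - by rewrite oQ !expnS mulnA leqNgt (@leq_mul 4 1) ?expn_gt0.
have sub: v ^: P \subset v *: P^`(1).
  apply/subsetP=> _ /imsetP[g Pg ->].
  by rewrite mem_lcoset mem_commg.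
have ocl: (4 * #|v ^: P|)%N = #|P|.
  by rewrite -oCv -index_cent1 Lagrange ?subsetIl.
have le_cl: #|v ^: P| <= #|P^`(1)| by rewrite -(card_lcoset _ v) subset_leq_card.
have eq4: #|P : P^`(1)| = 4.
  apply/eqP; rewrite eqn_leq ge4 andbT -(leq_pmul2l (cardG_gt0 P^`(1))) Lagrange //.
  by rewrite -ocl mulnC leq_mul2r.
split=> //; apply/eqP; rewrite eqEcard sub card_lcoset -(leq_pmul2l (isT : 0 < 4)).
by rewrite ocl -eq4 mulnC Lagrange /=.
Qed.

End Extremal.

(** A normal subgroup of index 2 that misses [t] meets [P] in a group of order at most 2, hence
    cyclic. *)
Lemma Sylow2_order4_Hall_pcore (gT : finGroupType) (G P M : {group gT}) t :
    2.-Sylow(G) P -> #|P| = 4 -> M \subset P -> #|M| = 2 -> t \in P -> #[t] = 2 ->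
    {in G, forall g, t ^ g \notin M} ->
  2^'.-Hall(G) 'O_2^'(G).
Proof.
move=> sylP oP sMP oM Pt ot notMt; have [sPG _ _] := and3P sylP.
have iM: #|P : M| = 2 by rewrite -divgS // oP oM.
have Gt := subsetP sPG t Pt.
have [K [nsKG iK notKt]] := index2_normal_avoiding_involution sylP sMP iM Gt ot notMt.
have sylK := Sylow_setI_normal nsKG sylP.
apply: (Hall_pcore_normal nsKG); first by rewrite iK pnatNK.
apply: cyclic_Sylow2_Hall_pcore sylK _.
have ltKP : #|K :&: P| < 4.
  rewrite -oP proper_card // properEneq subsetIr andbT.
  by apply: contraNneq notKt => /setIidPr/subsetP->.
have dvdKP: #|K :&: P| %| 4 by rewrite -oP cardSg ?subsetIr.
have [prKP | not_prKP] := boolP (prime #|K :&: P|); first exact: prime_cyclic.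
suffices: #|K :&: P| = 1%N by move/card1_trivg=> ->; apply: cyclic1.
by case: #|_| ltKP dvdKP not_prKP => [|[|[|[|]]]].
Qed.

(** * Dihedral Sylow 2-subgroups *)

Section Dihedral.

Variables (gT : finGroupType) (D : {group gT}) (a t : gT).
Hypotheses (pD : 2.-group D) (Da : a \in D) (iDa : #|D : <[a]>| = 2) (Dt : t \in D).
Hypotheses (notAt : t \notin <[a]>) (ot : #[t] = 2) (at_inv : a ^ t = a^-1).
Hypothesis (leD : 8 <= #|D|).

(** The unique involution of the rotation group [<[a]>], central in [D]. *)
Definition half_turn := a ^+ (#[a] %/ 2).
Local Notation s := half_turn.
Local Notation A := <[a]>.

Lemma dih_oD : #|D| = (#[a] * 2)%N.
Proof. by rewrite -iDa Lagrange ?cycle_subG. Qed.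

Lemma dih_dvd4 : 4 %| #[a].
Proof.
have [n oD] := p_natP pD; have := dih_oD; rewrite oD.
case: n oD => [|[|[|n]]] oD; try by move: leD; rewrite oD.
rewrite !expnSr => /eqP; rewrite eqn_pmul2r // => /eqP <-.
by rewrite -mulnA dvdn_mull.
Qed.

Lemma dih_os : #[s] = 2.
Proof.
have /divnK oa2 : 2 %| #[a] by apply: dvdn_trans dih_dvd4.
have k_gt0 : 0 < #[a] %/ 2 by rewrite -(ltn_pmul2r (isT : 0 < 2)) oa2.
have dvd_k : #[a] %/ 2 %| #[a] by rewrite -{2}oa2 dvdn_mulr.
by rewrite orderXdiv //; apply/eqP; rewrite eq_sym eqn_div // mulnC oa2.
Qed.

Lemma dih_t2 : t * t = 1. Proof. by rewrite -expg2 -ot expg_order. Qed.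

Lemma dih_tX i : a ^+ i * t = t * a ^- i.
Proof. by rewrite conjgC conjXg at_inv expgVn. Qed.

Lemma dih_tJ i j : (t * a ^+ j) ^ (a ^+ i) = t * a ^+ (2 * i + j).
Proof.
have cai: commute (a ^+ i) (a ^+ j) by apply: commuteX2.
rewrite conjMg (conjgE (a ^+ j)) -cai mulKg conjgE !mulgA -expgVn.
have ->: a^-1 ^+ i * t = t * a ^+ i.
  by apply: (mulgI (a ^+ i)); rewrite expgVn mulKVg mulgA dih_tX -mulgA mulVg mulg1.
by rewrite -!mulgA -!expgD addnA mul2n -addnn.
Qed.

Lemma dih_s_unique y : y \in A -> #[y] = 2 -> y = s.
Proof.
move=> Ay oy; have sA : <[s]> \subset A by rewrite cycle_subG mem_cycle.
have yA : <[y]> \subset A by rewrite cycle_subG.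
have /eqP eqys : <[y]> == <[s]>.
  by rewrite (eq_subG_cyclic (cycle_cyclic a)) // -!orderE oy dih_os.
have := cycle_id y; rewrite eqys cycle2g ?dih_os // => /set2P[y1|//].
by rewrite y1 order1 in oy.
Qed.

Lemma dih_notA y : y \in D -> y \notin A -> exists i, y = t * a ^+ i.
Proof.
move=> Dy notAy; have: y \in A :|: t *: A.
  suffices ->: A :|: t *: A = D by [].
  apply/eqP; rewrite eqEcard subUset cycle_subG Da /=; apply/andP; split.
    by apply/subsetP=> _ /lcosetP[b Ab ->]; rewrite groupM // (subsetP _ b Ab) ?cycle_subG.
  rewrite cardsU disjoint_setI0 ?cards0 ?subn0 ?card_lcoset ?dih_oD ?muln2 ?addnn //.
  rewrite -setI_eq0; apply/set0Pn=> -[b /setIP[Ab]]; rewrite mem_lcoset => Atb.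
  by case/negP: notAt; rewrite -groupV -(mulgK b t^-1) groupM ?groupV.
by case/setUP=> [Ay|/lcosetP[_ /cycleP[i ->] ->]]; [rewrite Ay in notAy | exists i].
Qed.

(** Conjugation by a rotation changes the exponent of a reflection [t * a ^+ i] by an even number,
    so the parity of [i] tells its class. *)
Lemma dih_cover y : y \in D -> [\/ y \in A, y \in t ^: A | y \in (t * a) ^: A].
Proof.
have [Ay _|notAy Dy] := boolP (y \in A); first exact: Or31.
have [i ->] := dih_notA Dy notAy; rewrite -(odd_double_half i) -mul2n addnC.
case: odd => /=; [apply: Or33 | apply: Or32]; apply/imsetP; exists (a ^+ i./2); rewrite ?mem_cycle //.
  by rewrite -(dih_tJ _ 1).
by rewrite -(dih_tJ _ 0) mulg1.
Qed.

Lemma dih_notA_inv y : y \in D -> y \notin A -> {in A, forall z, z ^ y = z^-1}.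
Proof.
move=> Dy notAy _ /cycleP[j ->]; have [i ->] := dih_notA Dy notAy.
rewrite conjgM conjXg at_inv expgVn; apply/conjg_fixP/commgP.
by apply: (centsP (cycle_abelian a)); rewrite ?groupV mem_cycle.
Qed.

Lemma dih_notA_order y : y \in D -> y \notin A -> #[y] = 2.
Proof.
move=> Dy notAy; apply: nt_prime_order => //; last by apply: contraNneq notAy => ->.
have [i ->] := dih_notA Dy notAy.
by rewrite expg2 mulgA -(mulgA t) dih_tX mulgA dih_t2 mul1g mulVg.
Qed.

Lemma dih_s_central : s \in 'Z(D).
Proof.
apply/centerP; split=> [|y Dy]; first exact: groupX.
have [Ay | notAy] := boolP (y \in A).
  by apply: (centsP (cycle_abelian a)); rewrite ?mem_cycle.
apply/commgP/conjg_fixP; rewrite dih_notA_inv ?mem_cycle //.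
by apply/eqP; rewrite eq_invg_mul -expg2 -dih_os expg_order.
Qed.

Lemma dih_t_ts : t * s \in t ^: A.
Proof.
(* The quarter turn is the witness: its square is [s]. *)
apply/imsetP; exists (a ^+ (#[a] %/ 4)); first exact: mem_cycle.
rewrite -{2}[t]mulg1 -(expg0 a) dih_tJ addn0 /half_turn.
have /dvdnP[k ->] := dih_dvd4.
by rewrite mulnK // -[4]/(2 * 2)%N mulnA mulnK // mulnC.
Qed.

End Dihedral.

(** * Counting involutions in the cosets of a subgroup *)

(** Summed over all cosets the bounds become an equality, so none of them is strict. *)
Lemma rcosets_average (gT : finGroupType) (G M : {group gT}) (T : {set gT}) k :
    M \subset G -> T \subset G -> (k * #|T|)%N = #|G| ->
    {in rcosets M G, forall C, k * #|T :&: C| <= #|M|} ->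
  {in rcosets M G, forall C : {set gT}, (k * #|T :&: C|)%N = #|M|}.
Proof.
move=> sMG sTG oT le_kM.
have oTC: (\sum_(C in rcosets M G) #|T :&: C|)%N = #|T|.
  have cardTI (C : {set gT}) : #|T :&: C| = (\sum_(x in C) if x \in T then 1 else 0)%N.
    by rewrite -sum1_card -big_mkcondr; apply: eq_bigl => x; rewrite inE andbC.
  rewrite -[in RHS](setIidPl sTG) cardTI (set_partition_big _ (rcosets_partition sMG)).
  by apply: eq_bigr => C _; apply: cardTI.
have /leqif_sum := fun C RC => leqif_eq (le_kM C RC).
case=> _; rewrite -big_distrr /= oTC oT sum_nat_const mulnC -(Lagrange sMG) eqxx.
by move/esym/forall_inP=> eqM C RC; apply/eqP/eqM.
Qed.

Lemma involutions_coset_sub (gT : finGroupType) (M : {group gT}) (T : {set gT}) u :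
    {in T, forall v, v * v = 1} -> u * u = 1 ->
  T :&: M :* u \subset (M :&: M :^ u) :* u.
Proof.
move=> T2 u2; apply/subsetP=> v /setIP[Tv /rcosetP[m Mm def_v]].
have v2 := T2 v Tv; rewrite def_v in v2 *.
rewrite mem_rcoset mulgK inE Mm /= mem_conjg.
have ->: m ^ u^-1 = m^-1; last by rewrite groupV.
apply/esym/eqP; rewrite eq_invg_mul conjgE invgK (_ : u^-1 = u) ?mulgA; last first.
  by apply/eqP; rewrite eq_invg_mul u2.
by move/eqP: v2; rewrite !mulgA.
Qed.

(** The number of fixed points of [u] on [X] has the parity of [#|X|], and 1 is one of them. *)
Lemma even_cent1_neq1 (gT : finGroupType) (X : {group gT}) u :
    2.-elt u -> u \in 'N(X) -> ~~ odd #|X| ->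
  exists2 y, y \in 'C_X[u] & y != 1.
Proof.
move=> pu nXu evX; apply/trivgPn; apply: contra evX => /eqP C1.
have nX : [acts <[u]>, on X | 'J] by rewrite astabsJ cycle_subG.
have := pgroup_fix_mod pu nX.
by rewrite afixJ cent_cycle C1 cards1 !modn2; case: odd.
Qed.

(** * Fusion and counting around a dihedral Sylow subgroup of order at least 8 *)

Section DihedralSylow.

Variables (gT : finGroupType) (H D : {group gT}) (a t : gT).
Hypotheses (sylD : 2.-Sylow(H) D) (Da : a \in D) (iDa : #|D : <[a]>| = 2) (Dt : t \in D).
Hypotheses (notAt : t \notin <[a]>) (ot : #[t] = 2) (at_inv : a ^ t = a^-1).
Hypotheses (leD : 8 <= #|D|) (oCt : #|'C_H[t]| = 4).

Local Notation s := (half_turn a).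
Local Notation A := <[a]>.
Local Notation M := 'C_H[s].
Local Notation T := (t ^: H).

Let sDH : D \subset H := pHall_sub sylD.
Let pD : 2.-group D := pHall_pgroup sylD.
Let Ht : t \in H := subsetP sDH t Dt.
Let Ha : a \in H := subsetP sDH a Da.
Let As : s \in A. Proof. exact: mem_cycle. Qed.
Let Hs : s \in H. Proof. exact: groupX. Qed.
Let sAD : A \subset D. Proof. by rewrite cycle_subG. Qed.
Let os : #[s] = 2 := dih_os pD Da iDa leD.

Let sDM : D \subset M.
Proof.
rewrite subsetI sDH; apply/subsetP=> y Dy; apply/cent1P.
by have /centerP[_ cs] := dih_s_central pD Da iDa Dt notAt at_inv leD; apply/commute_sym/cs.
Qed.

Let sylDM : 2.-Sylow(M) D.
Proof. by apply: pHall_subl sylD; rewrite ?subsetIl. Qed.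

Let cst : commute t s. Proof. by apply/cent1P; case/setIP: (subsetP sDM t Dt). Qed.
Let t2 : t * t = 1. Proof. by rewrite -expg2 -ot expg_order. Qed.

Lemma dihSyl_cent_t : 'C_H[t] = [set 1; t; s; t * s].
Proof.
have nt1 : t != 1 by rewrite -order_eq1 ot.
have ns1 : s != 1 by rewrite -order_eq1 os.
have nts : t != s by apply: contraNneq notAt => ->.
apply/esym/eqP; rewrite eqEcard oCt; apply/andP; split.
  have Ct : t \in 'C_H[t] by rewrite inE Ht cent1id.
  have Cs : s \in 'C_H[t] by rewrite inE Hs; apply/cent1P.
  by rewrite !subUset !sub1set group1 Ct Cs groupM.
rewrite -!setUA !cardsU1 !inE cards1 !negb_or ![1 == _]eq_sym nt1 ns1 nts.
have nts1 : t * s != 1 by rewrite -eq_invg_mul (eqP (_ : t^-1 == t)) // eq_invg_mul t2.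
have ntts : t != t * s by rewrite -{1}[t]mulg1 (inj_eq (mulgI t)) eq_sym.
have nsts : s != t * s by rewrite -{1}[s]mul1g (inj_eq (mulIg s)) eq_sym.
by rewrite ntts nsts nts1.
Qed.

Lemma dihSyl_cent_t_sub : 'C_H[t] \subset D.
Proof.
rewrite dihSyl_cent_t !subUset !sub1set group1 Dt (subsetP sAD s As) groupM //.
exact: (subsetP sAD).
Qed.

Lemma dihSyl_oCDt : #|'C_D[t]| = 4.
Proof.
rewrite -oCt; congr #|pred_of_set _|; apply/eqP; rewrite eqEsubset setSI //=.
by rewrite subsetI dihSyl_cent_t_sub subsetIr.
Qed.

Let t_ts : t * s \in t ^: D.
Proof. by apply: (subsetP (imsetS _ sAD)); apply: dih_t_ts pD _ _ _ _. Qed.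

Lemma dihSyl_notTs : s \notin T.
Proof.
apply/imsetP=> -[g Hg def_s].
have: #|D| <= #|M| by rewrite subset_leq_card.
rewrite def_s cent1J -{1}(conjGid Hg) -conjIg cardJg oCt.
by move/(leq_trans leD).
Qed.

Lemma dihSyl_T_sHF x : x \in s ^: H -> x \in T -> false.
Proof.
case/imsetP=> g Hg ->; rewrite memJ_norm ?(subsetP (class_norm _ _)) //.
by rewrite (negPf dihSyl_notTs).
Qed.

(** ['C_H[u]] is a conjugate of [[set 1; t; s; t * s]], where [t] and [t * s] lie in [T] and [s]
    does not; so [u] determines the one conjugate of [s] that commutes with it. *)
Lemma dihSyl_uniq u x y : u \in T -> x \in s ^: H -> y \in s ^: H ->
  commute x u -> commute y u -> x = y.
Proof.
suffices main g x1 : g \in H -> x1 \in s ^: H -> commute x1 (t ^ g) -> x1 = s ^ g.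
  by case/imsetP=> g Hg -> sx sy cx cy; rewrite (main g x) // (main g y).
move: x1 => {}x Hg sx cx; apply: (canRL (conjgKV g)).
have sx' : x ^ g^-1 \in s ^: H by rewrite memJ_norm ?groupV // (subsetP (class_norm _ _)).
have: x ^ g^-1 \in 'C_H[t].
  have Hx : x \in H by have [h Hh ->] := imsetP sx; apply: groupJ.
  by rewrite inE groupJ ?groupV //=; move/cent1P: cx; rewrite cent1J mem_conjg.
rewrite dihSyl_cent_t !inE -!orbA => /or4P[] /eqP def_x; rewrite def_x in sx' *.
- by case/imsetP: sx' => h _ /esym/eqP; rewrite conjg_eq1 -order_eq1 os.
- by case: (dihSyl_T_sHF sx' (class_refl _ _)).
- by [].
by case: (dihSyl_T_sHF sx' (subsetP (imsetS _ sDH) _ t_ts)).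
Qed.

(** If [t ^ g] commutes with [s], then it commutes with both [s] and [s ^ g], which are therefore
    equal. *)
Lemma dihSyl_TM : T :&: M = t ^: M.
Proof.
have Mt := subsetP sDM t Dt.
apply/eqP; rewrite eqEsubset andbC subsetI imsetS ?subsetIl //=; apply/andP; split.
  by apply/subsetP=> _ /imsetP[g Mg ->]; apply: groupJ.
apply/subsetP=> u /setIP[Tu /setIP[_ /cent1P cus]]; have [g Hg def_u] := imsetP Tu.
apply/imsetP; exists g => //; rewrite inE Hg; apply/cent1P/esym/commgP/conjg_fixP/esym.
apply: (@dihSyl_uniq u) => //; rewrite ?class_refl ?imset_f //.
by rewrite def_u /commute -!conjMg cst.
Qed.

Lemma dihSyl_oTM : (4 * #|T :&: M|)%N = #|M|.
Proof.
rewrite dihSyl_TM -index_cent1 -{1}oCt.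
have ->: 'C_H[t] = 'C_M[t]; last by rewrite Lagrange ?subsetIl.
apply/eqP; rewrite eqEsubset [_ \subset 'C_H[t]]setSI ?subsetIl // andbT.
by rewrite subsetI subsetIr (subset_trans dihSyl_cent_t_sub).
Qed.

Lemma dihSyl_oT : (4 * #|T|)%N = #|H|.
Proof. by rewrite -index_cent1 -oCt Lagrange ?subsetIl. Qed.

(** Since [s] is central in [M], no reflection is conjugate in [M] into [A], whose only involution
    is [s], and transfer applies. The goal is a normal subgroup of 2-power index avoiding both
    classes of reflections: it meets [D] inside the cyclic group [A]. *)
Lemma dihSyl_Hall_M : 2^'.-Hall(M) 'O_2^'(M).
Proof.
suffices [K [nsKM iK notKt notKta]] :
  exists K : {group gT}, [/\ K <| M, 2.-nat #|M : K|, t \notin K & t * a \notin K].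
- apply: (Hall_pcore_normal nsKM); first by rewrite pnatNK.
  apply: cyclic_Sylow2_Hall_pcore (Sylow_setI_normal nsKM sylDM) _.
  apply: cyclicS (cycle_cyclic a); apply/subsetP=> y /setIP[Ky Dy].
  have KJ x g : g \in A -> x ^ g \in K -> x \in K.
    by move=> Ag; rewrite memJ_norm // (subsetP (normal_norm nsKM)) // (subsetP sDM) ?(subsetP sAD).
  case: (dih_cover Da iDa Dt notAt at_inv Dy) => // /imsetP[g Ag def_y].
    by rewrite def_y in Ky; rewrite (KJ _ _ Ag Ky) in notKt.
  by rewrite def_y in Ky; rewrite (KJ _ _ Ag Ky) in notKta.
have Mt := subsetP sDM t Dt; have Mta : t * a \in M by rewrite groupM // (subsetP sDM).
have notAta : t * a \notin A by rewrite groupMr ?cycle_id.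
have ota : #[t * a] = 2.
  by apply: (dih_notA_order Da iDa Dt notAt ot at_inv) => //; apply: groupM.
have notMs g x : g \in M -> x ^ g = s -> x = s.
  move=> Mg /(canRL (conjgK g))->; apply/conjg_fixP/commgP/commuteV.
  by case/setIP: Mg => _ /cent1P/commute_sym.
have [|K1 [nsK1 iK1 notK1t]] := index2_normal_avoiding_involution sylDM sAD iDa Mt ot.
  move=> g Mg; apply/negP=> Atg; have := dih_s_unique pD Da iDa leD Atg.
  rewrite orderJ ot => /(_ erefl) /(notMs _ _ Mg) ts.
  by case/negP: notAt; rewrite ts.
have [K1ta | notK1ta] := boolP (t * a \in K1); last first.
  by exists K1; split; rewrite // iK1.
(* If [K1] contains [t * a], transfer is applied again to the maximal subgroup [D2] generated by [t]
   and the derived subgroup of [D]. A conjugate of [t * a] in [D2] would be [s] or conjugate to [t],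
   but [K1] contains [t * a] and not [t]. *)
have [iD' tD'] := cent4_class pD Dt dihSyl_oCDt leD.
have sD'A: D^`(1) \subset A.
  apply: der1_min; first exact/normal_norm/index2_normal.
  by apply/cyclic_abelian/prime_cyclic; rewrite card_quotient ?iDa // normal_norm ?index2_normal.
have notD't: t \notin D^`(1) by apply: contra notAt; apply: (subsetP sD'A).
pose D2 := (D^`(1) <*> <[t]>)%G.
have sD2D : D2 \subset D by rewrite join_subG der_sub cycle_subG.
have def_D2 : D2 :=: D^`(1) * <[t]>.
  by rewrite /= norm_joinEr // cycle_subG (subsetP (der_norm 1 D)).
have iD2 : #|D : D2| = 2.
  rewrite -divgS // def_D2 TI_cardMg; last first.
    by rewrite setIC prime_TIg ?cycle_subG // -orderE ot.
  by rewrite -(Lagrange (der_sub 1 D)) iD' -orderE ot divnMl.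
have [|K2 [nsK2 iK2 notK2ta]] := index2_normal_avoiding_involution sylDM sD2D iD2 Mta ota.
  move=> g Mg; apply/negP; rewrite def_D2 => /mulsgP[y y1 D'y].
  rewrite cycle2g // => /set2P[-> | ->] def_tag.
    rewrite mulg1 in def_tag.
    have := dih_s_unique pD Da iDa leD (subsetP sD'A y D'y); rewrite -def_tag orderJ ota.
    move/(_ erefl)/(notMs _ _ Mg) => tas; by rewrite tas As in notAta.
  have: y * t \in t ^: D by rewrite tD' mem_lcoset -conjgE memJ_norm ?(subsetP (der_norm 1 D)).
  rewrite -def_tag => /imsetP[h Dh def_h].
  case/negP: notK1t.
  have nK1 := subsetP (normal_norm nsK1).
  by rewrite -(memJ_norm _ (nK1 h (subsetP sDM h Dh))) -def_h memJ_norm ?nK1.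
exists (K1 :&: K2)%G; split; last 2 first.
- by rewrite inE negb_and notK1t.
- by rewrite inE negb_and notK2ta orbT.
- exact: normalI.
rewrite -(Lagrange_index (normal_sub nsK1) (subsetIl K1 K2)) pnatM iK1 /=.
have: #|K1 : K2| <= 2 by rewrite -iK2 subset_leq_card // imsetS // normal_sub.
by rewrite indexgI; case: #|_ : _| (indexg_gt0 K1 K2) => [|[|[|]]].
Qed.

Local Notation N := 'O_2^'(M).

Lemma dihSyl_M_conj_s g x : g \in M -> x ^ g = s -> x = s.
Proof.
move=> Mg /(canRL (conjgK g))->; apply/conjg_fixP/commgP/commuteV.
by case/setIP: Mg => _ /cent1P/commute_sym.
Qed.

Section Coset.

Variable u : gT.
Hypotheses (Tu : u \in T) (notMu : u \notin M).

Local Notation X := (M :&: M :^ u).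
Let Hu : u \in H. Proof. by have [g Hg ->] := imsetP Tu; apply: groupJ. Qed.
Let ou : #[u] = 2. Proof. by have [g Hg ->] := imsetP Tu; rewrite orderJ. Qed.
Let u2 : u * u = 1. Proof. by rewrite -expg2 -ou expg_order. Qed.
Let sXH : X \subset H. Proof. by rewrite subIset ?subsetIl. Qed.

Lemma coset_norm : u \in 'N(X).
Proof. by rewrite inE conjIg -conjsgM u2 conjsg1 setIC. Qed.

(** Such a [y] commutes with [s] and [s ^ u]; were it in [T], these would coincide and [u] would lie
    in [M]. *)
Lemma coset_T_free y : y \in X -> y \notin T.
Proof.
case/setIP=> /setIP[Hy /cent1P cys]; rewrite mem_conjg => /setIP[_ /cent1P cyus].
apply: contra notMu => Ty; rewrite inE Hu; apply/cent1P/esym/commgP/conjg_fixP/esym.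
apply: (dihSyl_uniq Ty); [exact: class_refl | exact: imset_f | exact: commute_sym |].
by rewrite /commute -{1 2}[y](conjgKV u) -!conjMg cyus.
Qed.

Lemma coset_sub : T :&: M :* u \subset X :* u.
Proof.
apply: involutions_coset_sub => // _ /imsetP[g Hg ->].
by rewrite -conjMg t2 conj1g.
Qed.

Lemma coset_cent : exists2 x, x \in H & u = t ^ x /\ 'C_X[u] \subset [set 1; s ^ x].
Proof.
have [x Hx def_u] := imsetP Tu; exists x => //; split=> //.
apply/subsetP=> y /setIP[Xy cuy]; rewrite !inE.
have: y ^ x^-1 \in 'C_H[t].
  apply/setIP; split; first by rewrite groupJ ?groupV // (subsetP sXH).
  by move: cuy; rewrite def_u cent1J mem_conjg.
have TJ z : z \in T -> z ^ x \in T by move=> Tz; rewrite memJ_norm ?(subsetP (class_norm _ _)).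
rewrite dihSyl_cent_t !inE -!orbA => /or4P[] /eqP/(canRL (conjgKV x)) def_y.
- by rewrite def_y conj1g eqxx.
- by case/negP: (coset_T_free Xy); rewrite def_y TJ ?class_refl.
- by rewrite def_y eqxx orbT.
by case/negP: (coset_T_free Xy); rewrite def_y TJ // (subsetP (imsetS _ sDH) _ t_ts).
Qed.

Lemma coset_even x : u = t ^ x -> 'C_X[u] \subset [set 1; s ^ x] -> ~~ odd #|X| -> s ^ x \in X.
Proof.
move=> def_u sC evX; have pu : 2.-elt u by rewrite /p_elt ou.
have [y Cy nty] := even_cent1_neq1 pu coset_norm evX.
by have /set2P[y1 | <-] := subsetP sC y Cy; [rewrite y1 eqxx in nty | case/setIP: Cy].
Qed.

(* The case where a Sylow 2-subgroup of [X] has order at least 4: otherwise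
   [u] would invert a cyclic Sylow 2-subgroup of [X], the involution of which
   would be conjugate in [M] to [s]. *)
Lemma coset_bound_ge4 : 4 <= #|X|`_2 -> 4 * #|T :&: M :* u| <= 2 * #|X|.
Proof.
move=> leX2; have [x Hx [def_u sCX]] := coset_cent.
have evX : ~~ odd #|X|.
  by apply: contraL leX2; rewrite odd_2'nat => /part_p'nat ->.
have Xsx := coset_even def_u sCX evX.
pose Y := (X <*> <[u]>)%G.
have notXu : u \notin X by rewrite inE (negPf notMu).
have nXu : <[u]> \subset 'N(X) by rewrite cycle_subG coset_norm.
have oY : #|Y| = (2 * #|X|)%N.
  by rewrite /= norm_joinEr // TI_cardMg ?[#|<[u]>|]ou 1?mulnC // setIC prime_TIg ?cycle_subG // [#|_|]ou.
have nsXY : X <| Y.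
  apply: index2_normal; first exact: joing_subl.
  by rewrite -divgS ?joing_subl // oY mulnK.
have Yu : u \in Y by rewrite mem_gen // inE cycle_id orbT.
have sYH : Y \subset H by rewrite join_subG sXH cycle_subG.
have def_Cu : 'C_H[u] = 'C_H[t] :^ x by rewrite conjIg conjGid // -cent1J -def_u.
have oCu z : z \in T -> #|'C_H[z]| = 4.
  by case/imsetP=> g Hg ->; rewrite -{1}(conjGid Hg) cent1J -conjIg cardJg.
have sCuY : 'C_H[u] \subset Y.
  have Ysx : s ^ x \in Y by rewrite (subsetP (joing_subl _ _)).
  apply/subsetP=> y; rewrite def_Cu mem_conjg dihSyl_cent_t !inE -!orbA.
  case/or4P=> /eqP/(canRL (conjgKV x))->; rewrite ?conj1g ?conjMg -?def_u //.
  exact: groupM.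
have pCu : 2.-group 'C_H[u] by rewrite /pgroup oCu.
have [R sylR sCuR] := Sylow_superset sCuY pCu.
have [sRY pR _] := and3P sylR.
have leR : 8 <= #|R|.
  rewrite (card_Hall sylR) oY partnM ?cardG_gt0 // (part_pnat_id (pnat_id _)) //.
  by rewrite (@leq_pmul2l 2 4).
have sRH := subset_trans sRY sYH.
have oCRT z : z \in T -> z \in R -> #|'C_R[z]| = 4.
  move=> Tz Rz; apply/eqP; rewrite eqn_leq card_cent1_2group // ?(leq_trans _ leR) //.
  by rewrite andbT -(oCu z Tz) subset_leq_card // setSI.
have Ru : u \in R by rewrite (subsetP sCuR) // inE Hu cent1id.
have [iR' uR'] := cent4_class pR Ru (oCRT u Tu Ru) leR.
have sylXR : 2.-Sylow(X) (X :&: R) := Sylow_setI_normal nsXY sylR.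
have oXR : #|R| = (2 * #|X :&: R|)%N.
  rewrite (card_Hall sylR) oY partnM ?cardG_gt0 // (part_pnat_id (pnat_id _)) //.
  by rewrite (card_Hall sylXR).
(* This suffices, as ['C_Y[u]] has order at least 4. A member not conjugate to [u] is moved into
   [R], where it leads to a contradiction. *)
have sub_uY : T :&: M :* u \subset u ^: Y.
  apply/subsetP=> z /[dup] /setIP[Tz _] /(subsetP coset_sub) Xuz.
  have Yz : z \in Y.
    have /rcosetP[m Xm ->] := Xuz; rewrite groupM //.
    by apply: subsetP Xm; apply: joing_subl.
  have sZY : <[z]> \subset Y by rewrite cycle_subG.
  have pz : 2.-group <[z]>.
    by rewrite /pgroup; case/imsetP: Tz => h Hh ->; rewrite -orderE orderJ ot.
  have [g Yg Rzg] := Sylow_Jsub sylR sZY pz.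
  rewrite -cycleJ cycle_subG in Rzg.
  suffices: z ^ g \in u ^: Y.
    by rewrite memJ_norm // (subsetP (class_norm _ _)).
  have Hg := subsetP sYH g Yg.
  have Tzg: z ^ g \in T by rewrite memJ_norm // (subsetP (class_norm _ _)).
  apply: (subsetP (imsetS _ sRY)); apply/negPn/negP=> not_uzg.
  have [_ zR'] := cent4_class pR Rzg (oCRT _ Tzg Rzg) leR.
  set v := z ^ g in Rzg Tzg not_uzg zR' *.
  have iXR : #|R : X :&: R| = 2 by rewrite -divgS ?subsetIr // oXR mulnK.
  have sR'X : R^`(1) \subset X :&: R.
    have nsXR : X :&: R <| R by apply: index2_normal; rewrite ?subsetIr.
    apply: der1_min (normal_norm nsXR) _.
    by apply/cyclic_abelian/prime_cyclic; rewrite card_quotient ?iXR // normal_norm.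
  have sclR w : w \in R -> w \notin X -> w *: R^`(1) \subset R :\: X.
    move=> Rw notXw; apply/subsetP=> _ /lcosetP[y R'y ->].
    have /setIP[Xy Ry] := subsetP sR'X y R'y.
    by rewrite inE groupMr // notXw groupM.
  have ti_uv : u *: R^`(1) :&: v *: R^`(1) = set0.
    apply/eqP/set0Pn=> -[y /setIP[]]; rewrite -uR' -zR' => /class_eqP uy /class_eqP vy.
    have : v \in u ^: R by rewrite -uy vy class_refl.
    exact/negP.
  (* The classes of [u] and [v] in [R] are two distinct cosets, each a quarter of [R], so they fill
     [R :\: X]. Hence [R :\: X] consists of involutions, and [u] inverts [X :&: R]. *)
  have def_RX : u *: R^`(1) :|: v *: R^`(1) = R :\: X.
    have notXv : v \notin X by apply: contraL Tzg; apply: coset_T_free.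
    apply/eqP; rewrite eqEcard subUset !sclR //=.
    rewrite cardsD setIC oXR mul2n -addnn addnK cardsU ti_uv cards0 subn0.
    rewrite !card_lcoset addnn -mul2n -(leq_pmul2l (isT : 0 < 2)) -oXR.
    by rewrite mulnA -{1}(Lagrange (der_sub 1 R)) iR' mulnC.
  have invR y : y \in X :&: R -> y ^ u = y^-1.
    case/setIP=> Xy Ry.
    have: y * u \in T.
      have: y * u \in R :\: X by rewrite inE groupMl // notXu groupM.
      rewrite -def_RX -uR' -zR' => /setUP[] /imsetP[h Rh ->];
        by rewrite memJ_norm // (subsetP (class_norm _ _)) // (subsetP sRH).
    case/imsetP=> h Hh yuE; apply/eqP; rewrite eq_sym eq_invg_mul conjgE.
    have ->: u^-1 = u by apply/eqP; rewrite eq_invg_mul u2.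
    by rewrite !mulgA -(mulgA (y * u)) yuE -conjMg t2 conj1g.
  have fixR y : y \in X :&: R -> #[y] = 2 -> y = s ^ x.
    move=> XRy oy; have /set2P[y1|//] : y \in [set 1; s ^ x].
      apply: (subsetP sCX); case/setIP: (XRy) => Xy _; rewrite inE Xy; apply/cent1P/commgP/conjg_fixP.
      by rewrite invR //; apply/eqP; rewrite eq_invg_mul -expg2 -oy expg_order.
    by rewrite y1 order1 in oy.
  have leXR : 4 <= #|X :&: R| by rewrite (card_Hall sylXR).
  have [y XRy oy] : exists2 y, y \in X :&: R & 2 < #[y].
    apply/exists_inP; apply: contraLR leXR; rewrite negb_exists_in -ltnNge => /forall_inP small.
    apply: leq_ltn_trans (_ : #|[set 1; s ^ x]| < 4); last by rewrite cards2; case: eqP.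
    apply/subset_leq_card/subsetP=> y XRy; rewrite !inE.
    have := small y XRy; case oy: #[y] (order_gt0 y) => [|[|[|]]] // _ _.
      by rewrite -order_eq1 oy.
    by rewrite [y]fixR ?eqxx ?orbT.
  have /setIP[Xy Ry] := XRy; have /setIP[My _] := Xy.
  have py : 2.-group <[y]> by rewrite (pgroupS _ pR) // cycle_subG.
  have syM : <[y]> \subset M by rewrite cycle_subG.
  have [m Mm] := Sylow_Jsub sylDM syM py; rewrite -cycleJ cycle_subG => Dym.
  (* Elements of [D] outside [A] have order 2, so [y] goes into [A], and the involution of [<[y]>]
     goes to [s]. That involution is also [s ^ x], so [s ^ x = s] and [u = t ^ x] centralises
     [s]. *)
  have Aym : y ^ m \in A.
    apply: contraLR oy => notAym; rewrite -(orderJ y m).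
    by rewrite (dih_notA_order Da iDa Dt notAt ot at_inv Dym).
  have [w yw ow] : {w | w \in <[y]> & #[w] = 2}.
    apply: Cauchy => //; have [|//] := pgroup_pdiv py.
    by apply: contraL oy; rewrite cycle_eq1 => /eqP->; rewrite order1.
  have XRw : w \in X :&: R by apply: subsetP yw; rewrite cycle_subG.
  have wm : w ^ m = s.
    apply: (dih_s_unique pD Da iDa leD); last by rewrite orderJ.
    by apply: (subsetP (_ : <[y]> :^ m \subset A)); rewrite ?memJ_conjg // -cycleJ cycle_subG.
  have sx_s : s ^ x = s by rewrite -(fixR w) // (dihSyl_M_conj_s Mm wm).
  case/negP: notMu; rewrite inE Hu; apply/cent1P.
  by rewrite def_u -sx_s /commute -!conjMg cst.
rewrite -oY -(Lagrange (subsetIl Y 'C[u])) index_cent1.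
apply: leq_mul; last exact: subset_leq_card.
by rewrite -(oCu u Tu) subset_leq_card // subsetI sCuY subsetIr.
Qed.

(** The 2-part of [#|X|] decides. If it is 1, then [4 * #|X| <= 4 * #|N| < #|M|]; if it is 2, then
    [4 * #|X| = 8 * #|N :&: X| <= #|N| * #|D|]; otherwise [X] is proper in [M] and [coset_bound_ge4]
    applies. Equality excludes the first case and puts [N] inside [X]. *)
Lemma coset_bound :
  4 * #|T :&: M :* u| <= #|M| /\
  ((4 * #|T :&: M :* u|)%N = #|M| ->
    [/\ N \subset X, ~~ odd #|X| & (2 * #|X|)%N = #|M| \/ #|D| = 8]).
Proof.
have sXM : X \subset M by apply: subsetIl.
have oM : #|M| = (#|N| * #|D|)%N.
  by rewrite (card_Hall sylDM) (card_Hall dihSyl_Hall_M) mulnC partnC.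
have hallNX : 2^'.-Hall(X) (N :&: X).
  by apply: setI_normal_Hall dihSyl_Hall_M _; rewrite ?pcore_normal.
have oX : #|X| = (#|N :&: X| * #|X|`_2)%N.
  by rewrite (card_Hall hallNX) mulnC partnC.
have leNX : #|N :&: X| <= #|N| by rewrite subset_leq_card ?subsetIl.
have leTX : #|T :&: M :* u| <= #|X|.
  by rewrite -(card_rcoset X u) subset_leq_card ?coset_sub.
have dvdX2 : #|X|`_2 %| #|X| by apply: dvdn_part.
have [X2_ge4 | X2_lt4] := leqP 4 #|X|`_2.
  have bound := coset_bound_ge4 X2_ge4.
  have lt1 : 2 <= #|M : X|.
    rewrite ltn_neqAle eq_sym indexg_eq1 indexg_gt0 andbT; apply/negP=> sMX.
    have Mt : t \in M by apply: (subsetP sDM).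
    by case/negP: (coset_T_free (subsetP sMX t Mt)); apply: class_refl.
  have le2X : 2 * #|X| <= #|M| by rewrite -(Lagrange sXM) mulnC leq_mul2l lt1 orbT.
  split=> [|eqM]; first exact: leq_trans le2X.
  have eq2X : (2 * #|X|)%N = #|M| by apply/eqP; rewrite eqn_leq le2X -eqM bound.
  split; [ | by apply: contraL X2_ge4; rewrite odd_2'nat => /part_p'nat -> | by left].
  have iX : #|M : X| = 2 by rewrite -divgS // -eq2X mulnK.
  have: #|N : X| <= 2 by rewrite -iX subset_leq_card // imsetS // pcore_sub.
  have : odd #|N : X|.
    by rewrite odd_2'nat (pnat_dvd (dvdn_indexg _ _)) // [_.-nat _]pcore_pgroup.
  by rewrite -indexg_eq1; case: #|_ : _| (indexg_gt0 N X) => [|[|[|]]].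
have X2_dvd : (#|X|`_2)%N = 1%N \/ (#|X|`_2)%N = 2.
  move: X2_lt4 (part_pnat 2 #|X|) (part_gt0 2 #|X|).
  by case: (#|X|`_2)%N => [|[|[|[|]]]] //; [left | right].
have N_gt0 : 0 < #|N| := cardG_gt0 _.
case: X2_dvd => X2; rewrite X2 ?muln1 in oX.
  have lt4 : 4 * #|T :&: M :* u| < #|M|.
    apply: leq_ltn_trans (_ : 4 * #|N| < _).
      by rewrite leq_mul2l /= (leq_trans leTX) // oX.
    by rewrite oM mulnC ltn_pmul2l // (leq_trans _ leD).
  by split; [exact: ltnW | move=> eqM; rewrite eqM ltnn in lt4].
have le8 : 4 * #|T :&: M :* u| <= #|N :&: X| * 8.
  by rewrite -[8]/(2 * 4)%N mulnA -oX mulnC leq_mul2r.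
have le8' : #|N :&: X| * 8 <= #|M| by rewrite oM leq_mul.
split=> [|eqM]; first exact: leq_trans le8'.
have eqM8 : (#|N :&: X| * 8)%N = #|M| by apply/eqP; rewrite eqn_leq le8' -eqM.
have eqNX : #|N :&: X| = #|N|.
  apply/eqP; rewrite eqn_leq leNX -(leq_pmul2r (isT : 0 < 8)) eqM8 oM.
  by rewrite leq_mul2l leD orbT.
split.
- by apply/setIidPl/eqP; rewrite eqEcard subsetIl eqNX leqnn.
- by rewrite oX oddM andbF.
by right; apply/eqP; rewrite eq_sym -(eqn_pmul2l N_gt0) -oM -eqM8 eqNX.
Qed.

End Coset.

(** The bound holds on all cosets and [T] is a quarter of [H], so it is attained everywhere; in
    particular every coset of [M] meets [T]. *)
Lemma dihSyl_coset_eq g : g \in H -> g \notin M ->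
  exists u, [/\ u \in T, u \in M :* g, u \notin M & (4 * #|T :&: M :* u|)%N = #|M|].
Proof.
move=> Hg notMg; have sTH : T \subset H by rewrite class_subG.
have sMH : M \subset H by apply: subsetIl.
have := rcosets_average sMH sTH dihSyl_oT.
have bnd: {in rcosets M H, forall C : {set gT}, 4 * #|T :&: C| <= #|M|}.
  move=> _ /rcosetsP[h Hh ->]; have [-> | [u]] := set_0Vmem (T :&: M :* h).
    by rewrite cards0.
  case/setIP=> Tu /rcoset_eqP <-; have [Mu | notMu] := boolP (u \in M).
    by rewrite rcoset_id // dihSyl_oTM.
  by case: (coset_bound Tu notMu).
move/(_ bnd (M :* g)) => eqM.
have Rg : M :* g \in rcosets M H by apply/rcosetsP; exists g.
have [T0 | [u /setIP[Tu Mgu]]] := set_0Vmem (T :&: M :* g).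
  by have := cardG_gt0 'C_H[s]; rewrite -(eqM Rg) T0 cards0.
exists u; split=> //.
  apply: contra notMg => Mu; have /rcosetP[m Mm def_u] := Mgu.
  by rewrite -(mulKg m g) -def_u groupM ?groupV.
by have /rcoset_eqP -> := Mgu; apply: eqM.
Qed.

Hypothesis trivO : 'O_2^'(H) = 1.

(** Every coset of [M] other than [M] contains a [u] with [N \subset M :^ u]; then [u^-1] conjugates
    [N] into [M], hence into its odd core [N]. So [N] is normal in [H]. *)
Lemma dihSyl_M_2group : 'O_2^'(M) = 1.
Proof.
apply/trivgP; rewrite -trivO pcore_max ?pcore_pgroup //.
apply/andP; split; first exact: subset_trans (pcore_sub _ _) (subsetIl _ _).
apply/subsetP=> g Hg; have [Mg | notMg] := boolP (g \in M).
  by apply: subsetP Mg; apply: gFnorm.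
have [u [Tu Mgu notMu eqM]] := dihSyl_coset_eq Hg notMg.
have [_ /(_ eqM)[sNX _ _]] := coset_bound Tu notMu.
have nNu : u \in 'N(N).
  rewrite -groupV inE (sub_Hall_pcore dihSyl_Hall_M); last first.
    by rewrite sub_conjgV (subset_trans sNX) ?subsetIr.
  by rewrite pgroupJ pcore_pgroup.
have /rcosetP[m Mm def_u] := Mgu.
by rewrite -(mulKg m g) -def_u groupM ?groupV // (subsetP (gFnorm _ _) m).
Qed.

Lemma dihSyl_M_eq_D : M = D.
Proof.
apply/esym/eqP; rewrite eqEcard sDM (card_Hall sylDM).
have := card_Hall dihSyl_Hall_M; rewrite /= dihSyl_M_2group cards1 => /esym/eqP.
by rewrite partn_eq1 // pnatNK => /part_pnat_id ->.
Qed.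

(* [X] has index 2 in [M] and in [M :^ u], hence contains their derived
   subgroups, and so both [s] and [s ^ u]; as they are central in [X], while
   an involution outside [A] inverts [A], this leaves only [#|D| = 8]. *)
Lemma dihSyl_oD u : u \in T -> u \notin M -> (4 * #|T :&: M :* u|)%N = #|M| -> #|D| = 8.
Proof.
move=> Tu notMu eqM; have [_ /(_ eqM)[_ _ [eq2X | //]]] := coset_bound Tu notMu.
pose X := (M :&: M :^ u)%G; rewrite -[M :&: M :^ u]/(gval X) in eq2X.
have D'a2 : a ^+ 2 \in D^`(1).
  by rewrite -groupV expg2 invMg -{2}at_inv mem_commg.
have [sXM sXMu] : X \subset M /\ X \subset M :^ u by rewrite /= subsetIl subsetIr.
have D'X (K : {group gT}) : X \subset K -> #|K| = #|M| -> K^`(1) \subset X.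
  move=> sXK oK; have iXK : #|K : X| = 2 by rewrite -divgS // oK -eq2X mulnK.
  apply: der1_min; first exact/normal_norm/index2_normal.
  by apply/cyclic_abelian/prime_cyclic; rewrite card_quotient ?iXK // normal_norm ?index2_normal.
have D'Xu : D^`(1) :^ u \subset X by rewrite -derJ D'X //= -?dihSyl_M_eq_D ?cardJg.
have {}D'X : D^`(1) \subset X by rewrite D'X //= -dihSyl_M_eq_D.
have D's : s \in D^`(1).
  have /dvdnP[k oa] := dih_dvd4 pD Da iDa leD.
  by rewrite /half_turn oa -[4]/(2 * 2)%N mulnA mulnK // mulnC expgM groupX.
have Dsu : s ^ u \in D by rewrite -dihSyl_M_eq_D (subsetP sXM) // (subsetP D'Xu) ?memJ_conjg.
have notAsu : s ^ u \notin A.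
  apply: contra notMu => Asu; rewrite inE.
  have Hu : u \in H by have [g Hg ->] := imsetP Tu; apply: groupJ.
  rewrite Hu; apply/cent1P/esym/commgP/conjg_fixP.
  by apply: (dih_s_unique pD Da iDa leD Asu); rewrite orderJ.
have a2V : a ^+ 2 = a ^- 2.
  rewrite -(dih_notA_inv Da iDa Dt notAt at_inv Dsu notAsu (mem_cycle a 2)).
  apply/esym/conjg_fixP/commgP.
  have := subsetP sXMu _ (subsetP D'X _ D'a2).
  by rewrite mem_conjg => /setIP[_]; rewrite -mem_conjg -cent1J => /cent1P.
have oa : #[a] %| 4.
  by rewrite order_dvdn -[4]/(2 + 2)%N expgD {2}a2V mulgV.
apply/eqP; rewrite eqn_leq leD andbT (dih_oD Da iDa) -[8]/(4 * 2)%N leq_mul2r /=.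
exact: dvdn_leq oa.
Qed.

(** Each coset of [M] other than [M] yields [u = t ^ x] with [s ^ x] in [D] and distinct from [s].
    This involution is not in [A] and not conjugate to [t], so it is conjugate to [t * a]. Thus [s]
    and [t * a] generate a four-group [E] whose involutions are the conjugates of [s], and
    [#|H| = 8 * 3]. *)
Lemma dihSyl_small : H :!=: D -> [/\ #|D| = 8, #|H| = 24 &
   exists E : {group gT}, [/\ E <| H, #|E| = 4, t \notin E, s \in E & E :\ 1 = s ^: H]].
Proof.
move=> neqHD; have [g0 Hg0 notMg0] : exists2 g, g \in H & g \notin M.
  apply/subsetPn; apply: contra neqHD => sHM.
  by rewrite eqEsubset sDH -dihSyl_M_eq_D sHM.
have [u0 [Tu0 _ notMu0 eqM0]] := dihSyl_coset_eq Hg0 notMg0.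
have oD := dihSyl_oD Tu0 notMu0 eqM0.
have key u : u \in T -> u \notin M -> (4 * #|T :&: M :* u|)%N = #|M| ->
    exists x, [/\ x \in H, u = t ^ x, s ^ x \in D & s ^ x != s].
  move=> Tu notMu eqM; have [_ /(_ eqM)[_ evX _]] := coset_bound Tu notMu.
  have [x Hx [def_u sCX]] := coset_cent Tu notMu; exists x; split=> //.
    by have /setIP[] := coset_even Tu def_u sCX evX; rewrite dihSyl_M_eq_D.
  apply: contra notMu => /eqP sx; rewrite inE def_u groupJ //; apply/cent1P.
  by rewrite -[X in commute _ X]sx /commute -!conjMg cst.
pose t' := t * a.
have notAt' : t' \notin A by rewrite groupMr ?cycle_id.
have Dt' : t' \in D by rewrite groupM.
have ot' : #[t'] = 2 := dih_notA_order Da iDa Dt notAt ot at_inv Dt' notAt'.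
have at'_inv : a ^ t' = a^-1.
  by apply: (dih_notA_inv Da iDa Dt notAt at_inv Dt' notAt'); apply: cycle_id.
have t's : t' * s \in t' ^: A := dih_t_ts pD Da iDa at'_inv leD.
have sDinv x : x \in H -> s ^ x \in D -> s ^ x != s -> s ^ x \in t' ^: A.
  move=> Hx Dsx nsx; case: (dih_cover Da iDa Dt notAt at_inv Dsx) => //.
    move/(dih_s_unique pD Da iDa leD) => sx.
    by rewrite sx ?orderJ ?eqxx in nsx.
  move=> tsx; have Tsx := subsetP (imsetS _ (subset_trans sAD sDH)) _ tsx.
  by case: (dihSyl_T_sHF (imset_f _ Hx) Tsx).
have Ht'A y : y \in t' ^: A -> y \in s ^: H.
  have [x0 [Hx0 def_u0 Dsx0 nsx0]] := key u0 Tu0 notMu0 eqM0.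
  case/imsetP=> b Ab ->; case/imsetP: (sDinv x0 Hx0 Dsx0 nsx0) => c Ac def_sx0.
  have sAH := subset_trans sAD sDH.
  rewrite -(conjgK c t') -def_sx0 -!conjgM imset_f // groupM // groupM ?groupV ?(subsetP sAH) //.
pose E := (<[s]> <*> <[t']>)%G.
have sED : E \subset D by rewrite join_subG !cycle_subG Dt' (subsetP sAD).
have cst' : commute s t'.
  by have /centerP[_ cs] := dih_s_central pD Da iDa Dt notAt at_inv leD; apply: cs.
have cEE : abelian E.
  by rewrite abelianY !cycle_abelian; apply/cents_cycle/esym.
have def_E : E :=: <[s]> * <[t']>.
  by rewrite /= norm_joinEl // cents_norm //; apply: cents_cycle.
have oE : #|E| = 4.
  rewrite def_E TI_cardMg -?orderE ?os ?ot' // setIC prime_TIg -?orderE ?ot' // cycle_subG.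
  by apply: contra notAt'; apply: subsetP; rewrite cycle_subG.
have E_cases y : y \in E -> y = 1 \/ y \in s ^: H.
  rewrite def_E => /mulsgP[s1 t1]; rewrite !cycle2g // => /set2P[] -> /set2P[] -> ->.
  - by left; rewrite mulg1.
  - by right; rewrite mul1g Ht'A ?class_refl.
  - by right; rewrite mulg1 class_refl.
  by right; rewrite cst' Ht'A.
have Es : s \in E by rewrite mem_gen // inE cycle_id.
have Et' : t' \in E by rewrite mem_gen // inE cycle_id orbT.
have nED : D \subset 'N(E).
  by apply/normal_norm/index2_normal; rewrite // -divgS // oD oE.
have nEH : H \subset 'N(E).
  apply/subsetP=> g Hg; have [Mg | notMg] := boolP (g \in M).
    by rewrite (subsetP nED) // -dihSyl_M_eq_D.
  have [u [Tu Mgu notMu eqM]] := dihSyl_coset_eq Hg notMg.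
  have [x [Hx def_u Dsx nsx]] := key u Tu notMu eqM.
  have Esx : s ^ x \in E.
    case/imsetP: (sDinv x Hx Dsx nsx) => b Ab ->.
    by rewrite memJ_norm // (subsetP nED) // (subsetP sAD).
  (* If [y ^ x] is in the abelian group [E], it commutes with [s ^ x], so [y] commutes with [s] and
     lies in [M = D]; conjugates of [s] in [D] are in [E]. *)
  have nEx : x^-1 \in 'N(E).
    rewrite inE; apply/subsetP=> y; rewrite mem_conjgV => Eyx.
    have Dy : y \in D.
      rewrite -dihSyl_M_eq_D; apply/setIP; split.
        by rewrite -(groupJr _ Hx) (subsetP sDH) ?(subsetP sED).
      by apply/cent1P/(conjg_inj x); rewrite !conjMg; apply: (centsP cEE).
    have [/eqP|/imsetP[h Hh def_yx]] := E_cases _ Eyx.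
      by rewrite conjg_eq1 => /eqP->.
    have def_y : y = s ^ (h * x^-1) by rewrite conjgM -def_yx conjgK.
    have [-> // | nys] := eqVneq y s; rewrite def_y in nys Dy *.
    have := sDinv _ (groupM Hh (groupVr Hx)) Dy nys; case/imsetP=> b Ab ->.
    by rewrite memJ_norm // (subsetP nED) // (subsetP sAD).
  have nEu : u \in 'N(E).
    by rewrite def_u; apply: groupJ; [apply: (subsetP nED) | rewrite -groupV].
  have /rcosetP[m Mm def_mg] := Mgu; rewrite -(mulKg m g) -def_mg groupM // groupV.
  by rewrite (subsetP nED) // -dihSyl_M_eq_D.
have nsEH : E <| H by rewrite /normal (subset_trans sED).
have defE1 : E :\ 1 = s ^: H.
  apply/setP=> y; rewrite !inE; apply/andP/idP=> [[nty /E_cases[y1|//]] | sy].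
    by rewrite y1 eqxx in nty.
  have [h Hh ->] := imsetP sy; rewrite memJ_norm ?(subsetP nEH) //.
  by rewrite conjg_eq1 -order_eq1 os.
split=> //; last first.
  exists E; split=> //; apply/negP=> /E_cases[t1 | st].
    by move: ot; rewrite t1 order1.
  by have := dihSyl_T_sHF st (class_refl _ _).
have sMH : M \subset H by apply: subsetIl.
rewrite -(Lagrange sMH) index_cent1 -defE1 /= dihSyl_M_eq_D oD.
have oE1 : #|E^#| = 3 by move: oE; rewrite (cardsD1 1 E) group1 => -[].
by rewrite [#|_^#|]oE1.
Qed.

End DihedralSylow.

(** * Recognition of the alternating group of degree 5 *)

(** Both groups are normal of index 2 in ['Sym_T] and ['Alt_T] is simple; a trivial intersection
    would give a product of 3600 elements inside a group of order 120. *)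
Lemma Alt5_unique (T : finType) (A : {group {perm T}}) :
  #|T| = 5 -> #|A| = 60 -> A :=: 'Alt_T.
Proof.
move=> oT oA; have oAlt : #|'Alt_T| = 60.
  by apply: double_inj; rewrite -mul2n card_Alt oT.
have oSym : #|'Sym_T| = 120 by rewrite card_Sym oT.
have sAS : A \subset 'Sym_T by apply: subsetT.
have nsAS : A <| 'Sym_T by apply: index2_normal; rewrite // -divgS // oSym oA.
have nsAAlt : 'Alt_T :&: A <| 'Alt_T by rewrite (normalGI (Alt_subset T)).
have /simpleP[_ /(_ _ nsAAlt)[]] := simple_Alt5_base oT.
  move=> tiA; have := TI_cardMg tiA; rewrite oA oAlt => eqc.
  have : #|'Alt_T * A| <= #|'Sym_T| by rewrite subset_leq_card ?subsetT.
  by rewrite eqc oSym.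
by move/setIidPl => sAltA; apply/esym/eqP; rewrite eqEcard sAltA oA oAlt.
Qed.

Section CosetPerm.

Variables (gT : finGroupType) (G M : {group gT}).

Let S := rcosets M G.
Let SM : gval M \in S. Proof. by apply/rcosetsP; exists 1; rewrite ?mulg1. Qed.

(** Elements outside [G] act trivially, so that [coset_fun g] is injective for every [g]; cosets are
    numbered by ordinals so that index 5 leads to [{perm 'I_5}]. *)
Let proj g := if g \in G then g else 1.

Let proj_in g : proj g \in G. Proof. by rewrite /proj; case: ifP. Qed.

Let SJ (C : {set gT}) g : C \in S -> g \in G -> C :* g \in S.
Proof.
case/rcosetsP=> h Hh -> Gg; apply/rcosetsP; exists (h * g); rewrite ?groupM //.
by rewrite rcosetM.
Qed.

Let coset_fun g (i : 'I_#|S|) := enum_rank_in SM (enum_val i :* proj g).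

Let coset_fun_inj g : injective (coset_fun g).
Proof.
move=> i j /(congr1 enum_val); rewrite !enum_rankK_in ?SJ ?enum_valP //.
by move/rcoset_inj/enum_val_inj.
Qed.

Definition coset_perm g := perm (@coset_fun_inj g).

Lemma coset_permM : {in G &, {morph coset_perm : g h / g * h}}.
Proof.
move=> g h Gg Gh; apply/permP=> i; rewrite permM !permE /coset_fun.
by rewrite enum_rankK_in ?SJ ?enum_valP // /proj groupM // Gg Gh rcosetM.
Qed.

Canonical coset_perm_morphism := Morphism coset_permM.

Lemma ker_coset_perm_sub : 'ker coset_perm \subset M.
Proof.
apply/subsetP=> g /morphpreP[Gg /set1P/permP/(_ (enum_rank_in SM M))].
rewrite permE perm1 /coset_fun => /(congr1 enum_val).
by rewrite !enum_rankK_in ?SJ // /proj Gg => <-; apply: rcoset_refl.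
Qed.

End CosetPerm.

Lemma isog_Alt5 (gT : finGroupType) (G M : {group gT}) :
    M \subset G -> #|G : M| = 5 -> #|G| = 60 ->
    (forall K : {group gT}, K <| G -> K \subset M -> K :=: 1) ->
  G \isog 'Alt_('I_5).
Proof.
move=> sMG iM oG core1.
have injf : 'injm (coset_perm_morphism G M).
  apply/subsetP=> x; rewrite (core1 ('ker (coset_perm_morphism G M))%G) //.
    exact: ker_normal.
  exact: ker_coset_perm_sub.
pose A := (coset_perm_morphism G M @* G)%G.
have isoG : G \isog A by apply: sub_isog.
have oA : #|A| = 60 by rewrite -(card_isog isoG).
have oI : #|'I_(#|rcosets M G|)| = 5 by rewrite card_ord.
have defA := Alt5_unique oI oA.
by move: isoG; rewrite defA -[#|rcosets M G|]/#|G : M| iM.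
Qed.

(* [n |-> n^-1 * n ^ v] is injective, hence onto, and [v] inverts its values. *)
Lemma fpf_square_central_inverts (gT : finGroupType) (N : {group gT}) v :
    v \in 'N(N) -> v ^+ 2 \in 'C(N) -> 'C_N[v] = 1 ->
  acts_by_inversion v N.
Proof.
move=> nNv cNv2 C1 n Nn.
pose f m := m^-1 * m ^ v.
have fN m : m \in N -> f m \in N by move=> Nm; rewrite groupM ?groupV ?memJ_norm.
have injf : {in N &, injective f}.
  move=> m1 m2 N1 N2; rewrite /f => eqf.
  have: m1 * m2^-1 \in 'C_N[v].
    rewrite inE groupM ?groupV //=; apply/cent1P/commgP/conjg_fixP.
    rewrite conjMg conjVg; apply: (mulgI m1^-1).
    by rewrite mulgA eqf mulgK mulKg.
  by rewrite C1 => /set1P/eqP; rewrite -eq_mulgV1 => /eqP.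
have /imsetP[m Nm ->] : n \in f @: N.
  suffices ->: f @: N = N by [].
  apply/eqP; rewrite eqEcard (card_in_imset injf) leqnn andbT.
  by apply/subsetP=> _ /imsetP[m Nm ->]; apply: fN.
rewrite /f invMg invgK conjMg conjVg -conjgM -expg2; congr (_^-1 * _).
by apply/conjg_fixP/commgP/esym; apply: (centP cNv2).
Qed.

Lemma acts_by_inversion_abelian (gT : finGroupType) (N : {group gT}) v :
  acts_by_inversion v N -> abelian N.
Proof.
move=> invN; apply/centsP=> x Nx y Ny; rewrite /commute.
by apply: invg_inj; rewrite -invN ?groupM // conjMg !invN // invMg.
Qed.

(** Here [c] is [#|'C_H(Y)|], [i] the number of involutions, [h = #|H|] and [m = #|H : M|]. As
    [h = 16 * c + 12], the number [c] divides 6, and it is an odd multiple of 3. *)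
Lemma card60_arith c i h m :
    (4 * c)%N = (i - 3)%N -> (4 * i)%N = h -> 3 <= i -> h = (12 * m)%N ->
    2 * c %| h -> 3 %| c -> odd c -> h = 60 /\ m = 5.
Proof.
move=> ci ih i3 hm dvd2c dvd3c oddc.
have hc : h = (2 * c * 8 + 12)%N by lia.
have : 2 * c %| 12 by move: dvd2c; rewrite hc dvdn_addr // dvdn_mulr.
rewrite -[12]/(2 * 6)%N dvdn_pmul2l // => dvdc6.
have c6 : c <= 6 by apply: dvdn_leq.
have c3 : c = 3 by move: c6 dvd3c oddc {ci hm dvd2c hc dvdc6}; case: c => [|[|[|[|[|[|[|]]]]]]].
by lia.
Qed.

(** * Sylow four-groups with a single class of involutions *)

Section FusedFourGroup.

Variables (gT : finGroupType) (H V : {group gT}) (t : gT).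
Hypotheses (sylV : 2.-Sylow(H) V) (oV : #|V| = 4) (Vt : t \in V) (ot : #[t] = 2).
Hypotheses (oCt : #|'C_H[t]| = 4) (fusV : {in V^#, forall s, s \in t ^: H}).

Local Notation I := (t ^: H).
Local Notation M := 'N_H(V).

Let sVH : V \subset H := pHall_sub sylV.
Let pV : 2.-group V := pHall_pgroup sylV.
Let Ht : t \in H := subsetP sVH t Vt.

Let oV1 : #|V^#| = 3.
Proof. by have := oV; rewrite (cardsD1 1 V) group1 add1n => -[]. Qed.

Lemma four_abelian : abelian V.
Proof. by apply: (p2group_abelian pV); rewrite oV (pfactorK 2). Qed.

Lemma four_cent s : s \in V^# -> 'C_H[s] = V.
Proof.
move=> V1s; have [_ Vs] := setD1P V1s; apply/esym/eqP; rewrite eqEcard.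
have [g Hg def_s] := imsetP (fusV V1s).
rewrite {2}def_s cent1J -{2}(conjGid Hg) -conjIg cardJg oCt oV leqnn andbT.
by rewrite subsetI sVH sub_cent1 (subsetP four_abelian).
Qed.

Lemma four_involutions u : u \in H -> #[u] = 2 -> u \in I.
Proof.
move=> Hu ou; have sUH : <[u]> \subset H by rewrite cycle_subG.
have pu : 2.-group <[u]> by rewrite /pgroup -orderE ou.
have [g Hg] := Sylow_Jsub sylV sUH pu; rewrite -cycleJ cycle_subG => Vug.
have /fusV : u ^ g \in V^# by rewrite !inE Vug andbT -order_eq1 orderJ ou.
by rewrite memJ_norm ?(subsetP (class_norm _ _)).
Qed.

Let sVM : V \subset M. Proof. by rewrite subsetI sVH normG. Qed.
Let sylVM : 2.-Sylow(M) V. Proof. by apply: pHall_subl sylV; rewrite ?subsetIl. Qed.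

Let nsVM : V <| M. Proof. by rewrite /normal sVM subsetIr. Qed.

Lemma four_IM : I :&: M = V^#.
Proof.
apply/setP=> u; apply/setIP/setD1P=> [[/imsetP[g Hg ->] Mu] | [ntu Vu]].
  split; first by rewrite conjg_eq1 -order_eq1 ot.
  by rewrite (mem_normal_Hall sylVM) // /p_elt orderJ ot.
by rewrite (subsetP sVM) // fusV // !inE ntu.
Qed.

Lemma four_conj_norm g : g \in H -> t ^ g \in V -> g \in M.
Proof.
move=> Hg Vtg; rewrite inE Hg /=; apply/normP.
have V1t : t \in V^# by rewrite !inE -order_eq1 ot.
have V1tg : t ^ g \in V^# by rewrite !inE -order_eq1 orderJ ot.
by rewrite -{1}(four_cent V1t) conjIg conjGid // -cent1J four_cent.
Qed.

(** Fusion of the elements of [V] takes place in [M], which therefore permutes the three involutions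
    of [V] transitively, with stabiliser [V]. *)
Lemma four_oM : #|M| = 12.
Proof.
have <-: (#|'C_M[t]| * #|t ^: M|)%N = #|M| by rewrite -index_cent1 Lagrange ?subsetIl.
have ->: 'C_M[t] = V.
  have V1t : t \in V^# by rewrite !inE -order_eq1 ot.
  apply/eqP; rewrite eqEsubset; apply/andP; split.
    by rewrite -{2}(four_cent V1t) setSI ?subsetIl.
  by rewrite subsetI sVM sub_cent1 (subsetP four_abelian).
have ->: t ^: M = V^#.
  apply/eqP; rewrite eqEsubset -four_IM subsetI imsetS ?subsetIl //=; apply/andP; split.
    apply/subsetP=> _ /imsetP[g Mg ->]; rewrite memJ_norm ?(subsetP sVM) //.
    by apply: (subsetP (normG _)).
  rewrite four_IM; apply/subsetP=> s V1s; have [g Hg def_s] := imsetP (fusV V1s).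
  have [_ Vs] := setD1P V1s; rewrite def_s imset_f // four_conj_norm // -def_s //.
by rewrite oV oV1.
Qed.

Lemma four_oI : (4 * #|I|)%N = #|H|.
Proof. by rewrite -index_cent1 -oCt Lagrange ?subsetIl. Qed.

Let I2 : {in I, forall u, u * u = 1}.
Proof.
by move=> _ /imsetP[g Hg ->]; rewrite -expg2 -conjXg -ot expg_order conj1g.
Qed.

Let oI u : u \in I -> #[u] = 2.
Proof. by case/imsetP=> g _ ->; rewrite orderJ. Qed.

Let sIH : I \subset H. Proof. by rewrite class_subG. Qed.

(** A common involution [w] lies in [V] together with [w ^ u^-1]; both have centraliser [V], so [u]
    would normalise [V]. *)
Lemma four_meet_odd u : u \in I -> u \notin M -> odd #|M :&: M :^ u|.
Proof.
move=> Iu notMu; rewrite -[odd _]negbK; apply: contra notMu => evX.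
have [w Xw ow] : {w | w \in M :&: M :^ u & #[w] = 2}.
  by apply: Cauchy; rewrite ?dvdn2.
have /setIP[Mw] := Xw; rewrite mem_conjg => Mwu.
have Vw : w \in V by rewrite (mem_normal_Hall sylVM) // /p_elt ow.
have Vwu : w ^ u^-1 \in V by rewrite (mem_normal_Hall sylVM) // /p_elt orderJ ow.
have Hu := subsetP sIH u Iu; rewrite inE Hu -groupV /=; apply/normP.
have V1w : w \in V^# by rewrite !inE -order_eq1 ow.
have V1wu : w ^ u^-1 \in V^# by rewrite !inE -order_eq1 orderJ ow.
by rewrite -{1}(four_cent V1w) conjIg conjGid ?groupV // -cent1J four_cent.
Qed.

Lemma four_meet_le3 u : u \in I -> u \notin M -> #|M :&: M :^ u| <= 3.
Proof.
move=> Iu notMu; have := four_meet_odd Iu notMu.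
have: #|M :&: M :^ u| %| 12 by rewrite -four_oM cardSg ?subsetIl.
move=> dvdX oddX; have: #|M :&: M :^ u| %| 3.
  by rewrite -(@Gauss_dvdr _ 4 3) // -[4]/(2 ^ 2)%N coprimeXr ?coprimen2.
exact: dvdn_leq.
Qed.

(** [M] has order 12 and three involutions; any other coset has at most [#|M :&: M :^ u| <= 3], so
    the average is attained. *)
Lemma four_coset_eq g : g \in H -> #|I :&: M :* g| = 3.
Proof.
have sMH : M \subset H by apply: subsetIl.
move=> Hg; apply/eqP; rewrite -(eqn_pmul2l (isT : 0 < 4)); apply/eqP.
have ->: (4 * 3)%N = #|M| by rewrite four_oM.
apply: (rcosets_average sMH sIH four_oI); last by apply/rcosetsP; exists g.
move=> _ /rcosetsP[h Hh ->]; have [-> | [u]] := set_0Vmem (I :&: M :* h).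
  by rewrite cards0.
case/setIP=> Iu /rcoset_eqP /= <-; rewrite [X in _ <= X]four_oM (@leq_mul2l 4 _ 3) /=.
have [Mu | notMu] := boolP (u \in M); first by rewrite rcoset_id // four_IM oV1.
apply: leq_trans (four_meet_le3 Iu notMu).
by rewrite -(card_rcoset (M :&: M :^ u) u) subset_leq_card // (@involutions_coset_sub _ M%G) ?I2.
Qed.

Lemma four_meet u : u \in I -> u \notin M -> #|M :&: M :^ u| = 3 /\ (M :&: M :^ u) :* u \subset I.
Proof.
move=> Iu notMu; have eq3 := four_coset_eq (subsetP sIH u Iu).
have sub : I :&: M :* u \subset (M :&: M :^ u) :* u.
  by rewrite (@involutions_coset_sub _ M%G) ?I2.
have /eqP eqX : I :&: M :* u == (M :&: M :^ u) :* u.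
  by rewrite eqEcard sub card_rcoset eq3 four_meet_le3.
by rewrite -eqX subsetIl -eq3 eqX card_rcoset.
Qed.

(** For [w] in [V] normalising [Y], the commutators of [w] with [Y] lie in [V :&: Y = 1], which puts
    [Y] inside ['C_H[w] = V] unless [w = 1]. So the normaliser has odd order dividing 12. *)
Lemma four_norm3 (Y : {group gT}) : Y \subset M -> #|Y| = 3 -> 'N_M(Y) = Y.
Proof.
move=> sYM oY; have sYN : Y \subset 'N_M(Y) by rewrite subsetI sYM normG.
have tiV : V :&: 'N_M(Y) = 1.
  apply/trivgP/subsetP=> w /setIP[Vw /setIP[_ nYw]]; rewrite inE.
  apply: contraLR (isT) => ntw.
  have tiVY : V :&: Y = 1 by rewrite coprime_TIg // oV oY.
  have cYw : Y \subset 'C_H[w].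
    rewrite subsetI (subset_trans sYM) ?subsetIl //=; apply/subsetP=> y Yy.
    have nVy : y \in 'N(V) by apply: subsetP (subsetP sYM y Yy); apply: normal_norm.
    apply/cent1P/commgP; rewrite -in_set1 -set1gE -tiVY; apply/setIP; split.
      by rewrite commgEr groupM // memJ_norm ?groupV.
    by rewrite commgEl groupM ?groupV // memJ_norm.
  have V1w : w \in V^# by rewrite !inE ntw.
  have : #|Y| %| #|V| by rewrite -(four_cent V1w) cardSg.
  by rewrite oV oY.
have odN : odd #|'N_M(Y)|.
  rewrite -[odd _]negbK; apply: contraL (isT) => evN.
  have [w Nw ow] : {w | w \in 'N_M(Y) & #[w] = 2} by apply: Cauchy; rewrite ?dvdn2.
  have : w \in V :&: 'N_M(Y).
    by rewrite inE Nw andbT (mem_normal_Hall sylVM) ?/p_elt ?ow //; case/setIP: Nw.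
  by rewrite tiV => /set1P w1; move: ow; rewrite w1 order1.
have dvdN : #|'N_M(Y)| %| 3.
  have : #|'N_M(Y)| %| 12 by rewrite -four_oM cardSg ?subsetIl.
  by rewrite -(@Gauss_dvdr _ 4 3) // -[4]/(2 ^ 2)%N coprimeXr ?coprimen2.
by apply/esym/eqP; rewrite eqEcard sYN oY dvdn_leq.
Qed.

(** [K] lies in [M :&: M :^ u], of order 3; a subgroup of order 3 is its own normaliser in [M],
    while [t] normalises [K]. *)
Lemma four_core_trivial (K : {group gT}) u :
  u \in I -> u \notin M -> K <| H -> K \subset M -> K :=: 1.
Proof.
move=> Iu notMu nsKH sKM; have [oX _] := four_meet Iu notMu.
have Hu := subsetP sIH u Iu.
have sKX : K \subset M :&: M :^ u.
  by rewrite subsetI sKM -(normP (subsetP (normal_norm nsKH) u Hu)) conjSg.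
have : #|K| %| 3 by rewrite -oX cardSg.
rewrite dvdn_divisors // inE => /orP[/eqP/card1_trivg //|]; rewrite inE => /eqP oK.
have /setP/(_ t) := four_norm3 sKM oK.
rewrite inE (subsetP sVM) //= (subsetP (normal_norm nsKH)) // => /esym Kt.
by have := order_dvdG Kt; rewrite ot oK.
Qed.

Hypothesis not_nVH : ~~ (H \subset 'N(V)).

Lemma four_exists : exists2 u, u \in I & u \notin M.
Proof.
have [g Hg notMg] : exists2 g, g \in H & g \notin M.
  have /subsetPn[g Hg nVg] := not_nVH; exists g => //.
  by rewrite inE Hg.
have [T0 | [u /setIP[Iu Mgu]]] := set_0Vmem (I :&: M :* g).
  by have := four_coset_eq Hg; rewrite T0 cards0.
exists u => //; apply: contra notMg => Mu; have /rcosetP[m Mm def_u] := Mgu.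
by rewrite -(mulKg m g) -def_u groupM ?groupV.
Qed.

(** The involutions [u] outside [M] are sorted by [M :&: M :^ u], one of the four Sylow 3-subgroups
    of [M]. The four parts are conjugate, hence equal in size, and the part of [Y] is a coset of
    ['C_H(Y)]. *)
Lemma four_card60 : #|H| = 60 /\ #|H : M| = 5.
Proof.
have sMH : M \subset H by apply: subsetIl.
have [u0 Iu0 notMu0] := four_exists.
pose Y := (M :&: M :^ u0)%G.
have [oY sYuI] := four_meet Iu0 notMu0.
pose W (Z : {group gT}) := [set u in I :\: M | M :&: M :^ u == Z].
have sYM : Y \subset M by apply: subsetIl.
have Hu0 := subsetP sIH u0 Iu0.
have Syl3 (Z : {group gT}) : Z \subset M -> #|Z| = 3 -> Z \in 'Syl_3(M).
  by move=> sZM oZ; rewrite inE pHallE sZM oZ [#|M|]four_oM p_part.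
have SylY : Y \in 'Syl_3(M) by apply: Syl3.
have oSyl : #|'Syl_3(M)| = 4.
  have sylY : 3.-Sylow(M) Y by rewrite inE in SylY.
  by rewrite (card_Syl sylY) four_norm3 // -divgS // [#|M|]four_oM oY.
have oWY Z : Z \in 'Syl_3(M) -> #|W Z| = #|W Y|.
  rewrite inE => sylZ; have sylY : 3.-Sylow(M) Y by rewrite inE in SylY.
  have [m Mm defZ] := Sylow_trans sylY sylZ.
  suffices ->: W Z = W Y :^ m by rewrite cardJg.
  have Hm := subsetP sMH m Mm.
  apply/setP=> u; rewrite mem_conjg ![_ \in W _]inE !in_setD -!mem_conjg.
  rewrite [M :^ m]conjGid // [I :^ m](normP (subsetP (class_norm _ _) m Hm)) defZ.
  rewrite -[M :&: M :^ u == _](inj_eq (@conjsg_inj _ m^-1)) conjsgK conjIg.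
  rewrite [M :^ m^-1]conjGid ?groupV // -conjsgM conjgE invgK.
  by rewrite [M :^ (m * _)]conjsgM [M :^ m]conjGid.
have oIM : (4 * #|W Y|)%N = (#|I| - 3)%N.
  have <-: #|I :\: M| = (#|I| - 3)%N by rewrite cardsD four_IM oV1.
  rewrite -[RHS]sum1_card (partition_big (fun u => M :&: M :^ u)%G (mem 'Syl_3(M))) /=; last first.
    by move=> u /setDP[Iu notMu]; apply: Syl3; rewrite ?subsetIl //; case: (four_meet Iu notMu).
  rewrite (eq_bigr (fun _ => #|W Y|)) => [|Z SylZ]; first by rewrite sum_nat_const oSyl.
  rewrite -(oWY Z SylZ) -sum1_card; apply: eq_bigl => u.
  by rewrite [u \in W Z]inE.
pose C := 'C_H(Y)%G.
have oCI w : w \in I -> #|'C_H[w]| = 4.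
  by case/imsetP=> h Hh ->; rewrite -{1}(conjGid Hh) cent1J -conjIg cardJg.
have sYH : Y \subset H := subset_trans sYM sMH.
have odC : odd #|C|.
  rewrite -[odd _]negbK; apply: contraL (isT) => evC.
  have [w Cw ow] : {w | w \in C & #[w] = 2} by apply: Cauchy; rewrite ?dvdn2.
  have [Hw cYw] := setIP Cw.
  have : #|Y| %| #|'C_H[w]| by rewrite cardSg // subsetI sYH sub_cent1.
  by rewrite oY oCI // four_involutions.
have nYu0 : u0 \in 'N(Y).
  by rewrite inE conjIg -conjsgM (I2 Iu0) conjsg1 setIC.
have nCu0 : u0 \in 'N(C).
  have: <[u0]> \subset 'N('C_H(Y)) by rewrite normsI ?norms_cent ?cycle_subG // (subsetP (normG H)).
  by rewrite cycle_subG.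
have invC : acts_by_inversion u0 C.
  apply: fpf_square_central_inverts => //; first by rewrite expg2 (I2 Iu0) group1.
  apply/trivgP; rewrite -(@coprime_TIg _ C 'C_H[u0]); last first.
    by rewrite oCI // coprime_sym (@coprimeXl 2 2) // coprime2n.
  by rewrite subsetI subsetIl /= setSI ?subsetIl.
have invY u : u \in W Y -> {in Y, forall y, y ^ u = y^-1}.
  rewrite inE in_setD => /andP[/andP[notMu Iu] /eqP defY] y Yy.
  have [_ sub] := four_meet Iu notMu.
  have Iyu : y * u \in I by rewrite (subsetP sub) // defY mem_rcoset mulgK.
  apply/eqP; rewrite eq_sym eq_invg_mul conjgE.
  have ->: u^-1 = u by apply/eqP; rewrite eq_invg_mul I2.
  by rewrite !mulgA -(mulgA (y * u)) I2.
have W0 : u0 \in W Y by rewrite inE in_setD notMu0 Iu0 eqxx.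
have oWC : #|W Y| = #|C|.
  (* Two involutions inverting [Y] differ by an element of [C]. Conversely [c * u0] is an involution
     because [u0] inverts [C], it is outside [M] because it normalises [Y], and so [Y] fills its
     intersection. *)
  suffices ->: W Y = C :* u0 by rewrite card_rcoset.
  apply/eqP; rewrite eqEsubset; apply/andP; split; apply/subsetP=> u.
    move=> Wu; rewrite mem_rcoset inE.
    have Hu : u \in H by move: Wu; rewrite inE in_setD => /andP[/andP[_ /(subsetP sIH)]].
    rewrite groupM ?groupV //=; apply/centP=> y Yy; apply/esym/commgP/conjg_fixP.
    have ->: u0^-1 = u0 by apply/eqP; rewrite eq_invg_mul I2.
    by rewrite conjgM invY // invY ?groupV // invgK.
  case/rcosetP=> c Cc ->; have [Hc cYc] := setIP Cc.
  have notCu0 : u0 \notin C.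
    by apply: contraL odC => Cu0; rewrite -dvdn2 -(oI Iu0) order_dvdG.
  have ocu : #[c * u0] = 2.
    apply: nt_prime_order => //; last first.
      by apply: contra notCu0; rewrite -eq_invg_mul => /eqP <-; rewrite groupV.
    have u0V : u0^-1 = u0 by apply/eqP; rewrite eq_invg_mul I2.
    have := invC c Cc; rewrite conjgE u0V => invc.
    by rewrite expg2 -mulgA invc mulgV.
  have Hcu : c * u0 \in H by rewrite groupM.
  have Icu := four_involutions Hcu ocu.
  have nYcu : c * u0 \in 'N(Y) by rewrite groupM // (subsetP (cent_sub Y)).
  have notMcu : c * u0 \notin M.
    apply/negP=> Mcu; have := four_norm3 sYM oY; move/setP/(_ (c * u0)).
    by rewrite inE Mcu nYcu => /esym /order_dvdG; rewrite ocu oY.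
  rewrite inE in_setD notMcu Icu /= eq_sym eqEcard oY.
  have [-> _] := four_meet Icu notMcu; rewrite andbT subsetI sYM /=.
  by rewrite -{1}(normP nYcu) conjSg.
have dvd2C : 2 * #|C| %| #|H|.
  have <-: #|C <*> <[u0]>| = (2 * #|C|)%N; last by rewrite cardSg // join_subG subsetIl cycle_subG.
  rewrite norm_joinEr ?cycle_subG // TI_cardMg; first by rewrite -[#|<[u0]>|]/#[u0] oI // mulnC.
  by rewrite coprime_TIg // -[#|<[u0]>|]/#[u0] oI // coprimen2.
have dvd3C : 3 %| #|C|.
  rewrite -oY cardSg // subsetI sYH; apply/cyclic_abelian/prime_cyclic.
  by rewrite oY.
have oH : #|H| = (12 * #|H : M|)%N by rewrite -(Lagrange sMH) [#|M|]four_oM.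
have oH_I : (4 * #|I|)%N = #|H| := four_oI.
have I_gt3 : 3 <= #|I|.
  by rewrite -oV1 -four_IM subset_leq_card ?subsetIl.
rewrite oWC in oIM.
exact: (card60_arith oIM oH_I I_gt3 oH dvd2C dvd3C odC).
Qed.

Lemma four_Alt5 : H \isog 'Alt_('I_5).
Proof.
have [oH iM] := four_card60; have [u Iu notMu] := four_exists.
apply: (@isog_Alt5 _ _ M%G); rewrite ?subsetIl // => K nsKH sKM.
exact: four_core_trivial Iu notMu nsKH sKM.
Qed.

End FusedFourGroup.

(** * Central extensions by a group of order 2 *)

Section Subdirect.

Variables (gT1 gT2 : finGroupType) (G1 : {group gT1}) (G2 : {group gT2}).
Variable C : {group gT1 * gT2}.
Hypotheses (fstC : [morphism of (@fst gT1 gT2)] @* C = G1).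
Hypotheses (sndC : [morphism of (@snd gT1 gT2)] @* C = G2).

(** [C] maps onto [G1] and is no larger, so it is the graph of a homomorphism from [G1] onto
    [G2]. *)
Lemma subdirect_homg : #|C| <= #|G1| -> G2 \homg G1.
Proof.
move=> leC; have isoC1 : G1 \isog C.
  by rewrite isogEcard -{1}fstC morphim_homg ?subsetT.
have homC2 : G2 \homg C by rewrite -sndC morphim_homg ?subsetT.
apply: homg_trans homC2 _; rewrite isog_sym in isoC1; exact: isog_hom isoC1.
Qed.

Lemma subdirect_isog : #|C| <= #|G1| -> #|C| <= #|G2| -> G1 \isog G2.
Proof.
move=> leC1 leC2; have isoC1 : G1 \isog C.
  by rewrite isogEcard -{1}fstC morphim_homg ?subsetT.
have isoC2 : G2 \isog C.
  by rewrite isogEcard -{1}sndC morphim_homg ?subsetT.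
by apply: isog_trans isoC1 _; rewrite isog_sym.
Qed.

End Subdirect.

(* The fibre product [F] of the two extensions, modulo the diagonal kernel,
   is an extension with elementary abelian Sylow 2-subgroups, so it splits;
   a complement lifts to the graph of an isomorphism. *)
Section CentralExtension.

Variables (gT1 gT2 rT : finGroupType) (G1 : {group gT1}) (G2 : {group gT2}) (A : {group rT}).
Variables (f1 : {morphism G1 >-> rT}) (f2 : {morphism G2 >-> rT}) (z1 : gT1) (z2 : gT2).
Hypotheses (f1A : f1 @* G1 = A) (f2A : f2 @* G2 = A).
Hypotheses (ker1 : 'ker f1 = <[z1]>) (ker2 : 'ker f2 = <[z2]>) (oz1 : #[z1] = 2) (oz2 : #[z2] = 2).
Hypothesis sq1 : {in G1, forall g, 2.-elt g -> g \notin 'ker f1 -> g ^+ 2 = z1}.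
Hypothesis sq2 : {in G2, forall g, 2.-elt g -> g \notin 'ker f2 -> g ^+ 2 = z2}.

Let gT := (gT1 * gT2)%type.
Definition fibre := [set u : gT | [&& u.1 \in G1, u.2 \in G2 & f1 u.1 == f2 u.2]].

Lemma fibre_group_set : group_set fibre.
Proof.
apply/group_setP; split=> [|u v]; rewrite !inE ?group1 ?morph1 ?eqxx //=.
case/and3P=> Gu1 Gu2 /eqP eu /and3P[Gv1 Gv2 /eqP ev].
by rewrite !groupM // !morphM // eu ev eqxx.
Qed.

Canonical fibre_group := Group fibre_group_set.
Local Notation F := fibre_group.

Let d : gT := (z1, z2).

Let Gz1 : z1 \in G1. Proof. by rewrite -cycle_subG -ker1 subsetIl. Qed.
Let Gz2 : z2 \in G2. Proof. by rewrite -cycle_subG -ker2 subsetIl. Qed.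
Let fz1 : f1 z1 = 1. Proof. by apply: mker; rewrite ker1 cycle_id. Qed.
Let fz2 : f2 z2 = 1. Proof. by apply: mker; rewrite ker2 cycle_id. Qed.

Let cz1 g : g \in G1 -> commute g z1.
Proof.
move=> Gg; apply/esym/commgP/conjg_fixP; have : z1 ^ g \in 'ker f1.
  by rewrite memJ_norm ?ker1 ?cycle_id // -ker1 (subsetP (ker_norm _)).
rewrite ker1 cycle2g // => /set2P[/eqP|//].
by rewrite conjg_eq1 -order_eq1 oz1.
Qed.

Let cz2 g : g \in G2 -> commute g z2.
Proof.
move=> Gg; apply/esym/commgP/conjg_fixP; have : z2 ^ g \in 'ker f2.
  by rewrite memJ_norm ?ker2 ?cycle_id // -ker2 (subsetP (ker_norm _)).
rewrite ker2 cycle2g // => /set2P[/eqP|//].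
by rewrite conjg_eq1 -order_eq1 oz2.
Qed.

Let Fd : d \in F. Proof. by rewrite inE /= Gz1 Gz2 fz1 fz2 eqxx. Qed.
Let od : #[d] = 2.
Proof.
apply: nt_prime_order => //.
  by rewrite /d -[_ ^+ 2]/(z1 ^+ 2, z2 ^+ 2) -{1}oz1 -{1}oz2 !expg_order.
by apply/eqP=> -[z11]; move: oz1; rewrite z11 order1.
Qed.

Let cFd : F \subset 'C[d].
Proof.
apply/subsetP=> u; rewrite inE => /and3P[Gu1 Gu2 _]; apply/cent1P.
by rewrite /commute [u]surjective_pairing; congr (_, _); [apply: cz1 | apply: cz2].
Qed.

Let nFd : F \subset 'N(<[d]>).
Proof. by apply: cents_norm; rewrite cent_cycle. Qed.

Let k : gT := (1, z2).
Let Fk : k \in F. Proof. by rewrite inE /= group1 Gz2 morph1 fz2 eqxx. Qed.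
Let ok : #[k] = 2.
Proof.
apply: nt_prime_order => //.
  by rewrite /k -[_ ^+ 2]/(1 ^+ 2, z2 ^+ 2) expg1n -{1}oz2 expg_order.
by apply/eqP=> -[z21]; move: oz2; rewrite z21 order1.
Qed.

Lemma fibre_ker u : u \in F -> u.1 = 1 -> u \in <[k]>.
Proof.
rewrite inE => /and3P[_ Gu2 /eqP]; rewrite [u]surjective_pairing /= => eqf u1.
have : u.2 \in 'ker f2 by apply/kerP; rewrite // -eqf u1 morph1.
by rewrite u1 ker2 !cycle2g // => /set2P[] ->; rewrite !inE eqxx ?orbT.
Qed.

Lemma fibre_card : #|F| = (2 * #|G1|)%N.
Proof.
have fstF : [morphism of (@fst gT1 gT2)] @* F = G1.
  apply/setP=> g1; apply/morphimP/idP=> [[u _ Fu ->] | Gg1].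
    by rewrite inE in Fu; case/and3P: Fu.
  have : f1 g1 \in f2 @* G2 by rewrite f2A -f1A mem_morphim.
  case/morphimP=> g2 _ Gg2 eqf; exists (g1, g2); rewrite ?inE //=.
  by rewrite Gg1 Gg2 eqf eqxx.
have := card_morphim [morphism of (@fst gT1 gT2)] F.
rewrite fstF setTI => oG1; rewrite -(LagrangeI F ('ker [morphism of (@fst gT1 gT2)])) -oG1.
suffices ->: F :&: 'ker [morphism of (@fst gT1 gT2)] = <[k]> by rewrite -orderE ok.
apply/eqP; rewrite eqEsubset cycle_subG inE Fk andbC /=; apply/andP; split.
  by rewrite !inE /=.
by apply/subsetP=> u /setIP[Fu /morphpreP[_ /set1P]]; apply: fibre_ker.
Qed.

Lemma central_extension2_isog : #|G1| = #|G2| -> G1 \isog G2.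
Proof.
move=> oG12.
pose Kb := (<[k]> / <[d]>)%G; pose E := (F / <[d]>)%G.
have nkd : <[k]> \subset 'N(<[d]>) by apply: subset_trans nFd; rewrite cycle_subG.
have sKE : Kb \subset E by rewrite quotientS // cycle_subG.
have cFk : F \subset 'C[k].
  apply/subsetP=> u; rewrite inE => /and3P[Gu1 Gu2 _]; apply/cent1P.
  rewrite /commute [u]surjective_pairing; congr (_, _); last exact: cz2.
  by rewrite /= mulg1 mul1g.
have nsKE : Kb <| E.
  by apply: quotient_normal; rewrite /normal cycle_subG Fk cents_norm // cent_cycle.
have notdk : k \notin <[d]>.
  rewrite cycle2g // !inE negb_or -order_eq1 ok /=.
  by apply/eqP=> -[z11]; move: oz1; rewrite -z11 order1.
have tidk : <[d]> :&: <[k]> = 1 by rewrite setIC prime_TIg ?cycle_subG // -orderE ok.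
have oKb : #|Kb| = 2 by rewrite -(card_isog (quotient_isog nkd tidk)) -orderE ok.
have [P sylP] := Sylow_exists 2 E.
have sKP : Kb \subset P.
  apply: subset_trans (pcore_sub_Hall sylP); apply: pcore_max => //.
  by rewrite /pgroup oKb.
(* A 2-element of [F] has both components in the kernels, and then square 1, or both outside, and
   then square [(z1, z2) = d]. *)
have abP : 2.-abelem P.
  apply: involutions_abelem => x Px.
  have [u nu Fu def_x] := morphimP (subsetP (pHall_sub sylP) x Px).
  have expE n : u ^+ n = (u.1 ^+ n, u.2 ^+ n).
    by elim: n => [|n IHn]; rewrite ?expg0 // !expgS IHn {1}[u]surjective_pairing.
  have pu : 2.-elt u.
    have px : 2.-elt x := mem_p_elt (pHall_pgroup sylP) Px.
    have dvdu : #[u] %| #[x] * 2.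
      have du : u ^+ #[x] \in <[d]>.
        by rewrite coset_idr ?groupX // morphX // -def_x expg_order.
      by rewrite order_dvdn expgM -order_dvdn -od order_dvdG.
    by apply: pnat_dvd dvdu _; rewrite pnatM [_.-nat _]px.
  have p1 : 2.-elt u.1.
    by apply: pnat_dvd pu; rewrite order_dvdn; have := expg_order u; rewrite expE => -[-> _].
  have p2 : 2.-elt u.2.
    by apply: pnat_dvd pu; rewrite order_dvdn; have := expg_order u; rewrite expE => -[_ ->].
  have /and3P[Gu1 Gu2 /eqP eqf]: [&& u.1 \in G1, u.2 \in G2 & f1 u.1 == f2 u.2].
    by rewrite inE in Fu.
  rewrite def_x -morphX //; apply: coset_id; rewrite expE.
  have [k1 | notk1] := boolP (u.1 \in 'ker f1).
    have k2 : u.2 \in 'ker f2 by apply/kerP; rewrite // -eqf mker.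
    rewrite ker1 in k1; rewrite ker2 in k2.
    have -> : u.1 ^+ 2 = 1 by apply/eqP; rewrite -order_dvdn -oz1 order_dvdG.
    have -> : u.2 ^+ 2 = 1 by apply/eqP; rewrite -order_dvdn -oz2 order_dvdG.
    exact: group1.
  have notk2 : u.2 \notin 'ker f2.
    by apply: contra notk1 => k2; apply/kerP; rewrite // eqf mker.
  by rewrite sq1 // sq2 // cycle_id.
have : [splits E, over Kb].
  rewrite (Gaschutz_split nsKE sKP (pHall_sub sylP)).
  - exact: abelem_splits abP sKP.
  - exact: abelem_abelian (abelemS sKP abP).
  by rewrite oKb; case/and3P: sylP => _ _; rewrite -odd_2'nat coprime2n.
case/splitsP=> Cb /complP[tiKC defE].
pose C := (coset <[d]> @*^-1 Cb)%G.
have sCbE : Cb \subset E by rewrite -defE mulG_subr.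
have sCF : C \subset F.
  by rewrite -(quotientGK (_ : <[d]> <| F)) ?morphpreS // /normal cycle_subG Fd.
have sdF : <[d]> \subset F by rewrite cycle_subG Fd.
have oC : #|C| = #|G1|.
  apply/eqP; rewrite -(eqn_pmul2l (isT : 0 < 2)) -fibre_card card_cosetpre.
  rewrite -(Lagrange sdF) -card_quotient // -[F / _]/(gval E) -defE TI_cardMg // oKb.
  by rewrite -orderE od.
have sdC : <[d]> \subset C by apply: sub_cosetpre.
(* The projections of [F] have kernels generated by [k = (1, z2)] and [d * k = (z1, 1)]; as [C]
   contains [d] and not [k], it meets both trivially. *)
have notCk : k \notin C.
  apply: contra notdk => /morphpreP[nk Cbk].
  apply: coset_idr => //; apply/set1P; rewrite -set1gE -tiKC inE Cbk andbT.
  by rewrite mem_quotient ?cycle_id.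
have cardC (rT' : finGroupType) (f : {morphism [set: gT] >-> rT'}) :
    {in C, forall u, f u = 1 -> u = 1} -> #|f @* C| = #|G1|.
  move=> inj; rewrite card_morphim setTI -oC -indexgI (_ : C :&: _ = 1) ?indexg1 //.
  apply/trivgP/subsetP=> u /setIP[Cu /morphpreP[_ /set1P]] /(inj u Cu) ->.
  exact: set11.
apply: (@subdirect_isog _ _ _ _ C); rewrite ?oC -?oG12 //; apply/eqP; rewrite eqEcard.
  rewrite cardC ?leqnn ?andbT.
    apply/subsetP=> _ /morphimP[u _ Cu ->].
    by have := subsetP sCF u Cu; rewrite inE => /and3P[].
  move=> u Cu /= u1; have := fibre_ker (subsetP sCF u Cu) u1.
  rewrite cycle2g // => /set2P[//|uk]; by rewrite uk (negPf notCk) in Cu.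
rewrite cardC -?oG12 ?leqnn ?andbT.
  apply/subsetP=> _ /morphimP[u _ Cu ->].
  by have := subsetP sCF u Cu; rewrite inE => /and3P[].
move=> u Cu /= u2; have := subsetP sCF u Cu; rewrite inE => /and3P[Gu1 _].
rewrite u2 morph1 => /eqP f1u; have : u.1 \in 'ker f1 by apply/kerP.
rewrite ker1 cycle2g // [u]surjective_pairing u2 => /set2P[/= -> // | /= u1].
case/negP: notCk; have -> : k = d * u.
  rewrite [u]surjective_pairing u1 u2; congr (_, _); rewrite /= ?mulg1 //.
  by rewrite -expg2 -oz1 expg_order.
by rewrite groupM // (subsetP sdC) ?cycle_id.
Qed.

End CentralExtension.

(* For [c = a * b] the two relations amount to [a ^+ 3 = b ^+ 3 = c ^+ 2 = a * b * c]. *)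
Section BinaryTetrahedral.

Variables (gT : finGroupType) (a b : gT).
Hypotheses (aba : a * b * a = b ^+ 2) (bab : b * a * b = a ^+ 2).

Local Notation z := (a ^+ 3).
Local Notation c := (a * b).
Local Notation d := (b * a).

Lemma bt_c2 : c ^+ 2 = z.
Proof. by rewrite expg2 expgS -bab !mulgA. Qed.

Lemma bt_b3 : b ^+ 3 = z.
Proof. by rewrite -bt_c2 expg2 expgSr -aba !mulgA. Qed.

Lemma bt_d2 : d ^+ 2 = z.
Proof. by rewrite -bt_b3 expg2 expgS -aba !mulgA. Qed.

Let az : commute a z. Proof. exact: commuteX. Qed.
Let bz : commute b z. Proof. by rewrite -bt_b3; apply: commuteX. Qed.

Let aba_l x : x * a * b * a = x * b * b.
Proof. by rewrite -!(mulgA x) aba. Qed.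
Let bab_l x : x * b * a * b = x * a * a.
Proof. by rewrite -!(mulgA x) bab. Qed.

Lemma bt_cd : c * d = d * (z * c).
Proof.
have cz : commute c z by apply/commute_sym/commuteM; apply/commute_sym.
by rewrite -cz !mulgA -aba_l -[in LHS](expg2 a) -bab -(aba_l (b * a)).
Qed.

Lemma bt_c_conj_d : c ^ d = z * c.
Proof. by rewrite conjgE bt_cd mulKg. Qed.

(** Conjugation by [d] fixes [z = c ^+ 2] and sends [c] to [z * c], hence [z] to [z ^+ 2 * z]. *)
Lemma bt_z2 : z ^+ 2 = 1.
Proof.
have cz : commute c z by apply/commute_sym/commuteM; apply/commute_sym.
have dz : commute d z by apply/commute_sym/commuteM; apply/commute_sym.
have : (c ^+ 2) ^ d = (z * c) ^+ 2 by rewrite conjXg bt_c_conj_d.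
rewrite bt_c2 expgMn; last exact: commute_sym.
rewrite bt_c2 (_ : z ^ d = z); last by apply/conjg_fixP/commgP/commute_sym.
by rewrite -{1}[z]mul1g => /mulIg.
Qed.

Lemma bt_c_conj_a : c ^ a = d.
Proof. by rewrite conjgE -!mulgA mulKg. Qed.

Lemma bt_d_conj_a : d ^ a = d * c.
Proof.
by apply: (mulgI a); rewrite -conjgC !mulgA aba expg2 bab_l.
Qed.

Hypothesis ntz : z != 1.

Lemma bt_oz : #[z] = 2.
Proof. exact: nt_prime_order bt_z2 ntz. Qed.

Definition bt_group := <<[set a; b]>>.

Lemma order_sqrt_involution x : x ^+ 2 = z -> #[x] = 4.
Proof.
move=> x2; have not2 : ~~ (#[x] %| 2) by rewrite order_dvdn x2.
have : #[x] %| 2 ^ 2 by rewrite order_dvdn expgM x2 bt_z2.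
case/(dvdn_pfactor _ _ (isT : prime 2)) => [[|[|[|]]]] // _ ox; by rewrite ox in not2.
Qed.

(** For [z != 1] this is the quaternion group of order 8; [a] sends [c] to [d] and [d] to
    [d * c]. *)
Let Q := (<[c]> <*> <[d]>)%G.

Let Kc : c \in bt_group. Proof. by rewrite groupM ?mem_gen ?set21 ?set22. Qed.
Let Kd : d \in bt_group. Proof. by rewrite groupM ?mem_gen ?set21 ?set22. Qed.
Let Ka : a \in bt_group. Proof. by rewrite mem_gen ?set21. Qed.

Let oc : #[c] = 4 := order_sqrt_involution bt_c2.
Let od : #[d] = 4 := order_sqrt_involution bt_d2.

Lemma bt_Q_def : Q :=: <[c]> * <[d]>.
Proof.
rewrite /= norm_joinEr // cycle_subG; apply/normP; rewrite -cycleJ bt_c_conj_d.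
have -> : z * c = c^-1.
  by apply/eqP; rewrite eq_sym eq_invg_mul -bt_c2 -expgSr -expgS -oc expg_order.
by rewrite cycleV.
Qed.

Lemma bt_Q_card : #|Q| = 8.
Proof.
have notcd : d \notin <[c]>.
  apply: contra ntz => cd; rewrite -(inj_eq (mulIg c)) -bt_c_conj_d mul1g.
  apply/eqP/conjg_fixP/commgP; apply: (centsP (cycle_abelian c)) => //; exact: cycle_id.
have zc : z \in <[c]> by rewrite -bt_c2 mem_cycle.
have zd : z \in <[d]> by rewrite -bt_d2 mem_cycle.
have oI : #|<[c]> :&: <[d]>| = 2.
  have ltI : #|<[c]> :&: <[d]>| < 4.
    rewrite -od proper_card // properEneq subsetIr andbT.
    by apply: contra notcd => /eqP/setIidPr; rewrite cycle_subG.
  have : 2 %| #|<[c]> :&: <[d]>|.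
    by rewrite -bt_oz order_dvdG // inE zc.
  by case: #|_| ltI (cardG_gt0 (<[c]> :&: <[d]>)%G) => [|[|[|[|]]]].
have /eqP := mul_cardG <[c]> <[d]>; rewrite -bt_Q_def oI -!orderE oc od.
by rewrite -[(4 * 4)%N]/(8 * 2)%N eqn_pmul2r // => /eqP <-.
Qed.

(** The group is [Q * <[a]>] with [a] of order 6 and an intersection of order 2. That the relations
    and [z != 1] determine the order is what allows comparing two such groups inside their
    product. *)
Lemma bt_card : #|bt_group| = 24.
Proof.
have nQa : <[a]> \subset 'N(Q).
  rewrite cycle_subG inE /= conjYg -!cycleJ bt_c_conj_a bt_d_conj_a join_subG !cycle_subG.
  have Qc : c \in Q by rewrite mem_gen // inE cycle_id.
  have Qd : d \in Q by rewrite mem_gen // inE cycle_id orbT.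
  by rewrite Qd groupM.
have defK : bt_group = Q * <[a]>.
  have Qac : c \in Q <*> <[a]> by rewrite mem_gen // inE mem_gen // inE cycle_id.
  have Qaa : a \in Q <*> <[a]> by rewrite mem_gen // inE cycle_id orbT.
  rewrite -norm_joinEr //; apply/eqP; rewrite eqEsubset; apply/andP; split.
    by rewrite gen_subG subUset !sub1set Qaa -(mulKg a b) groupM ?groupV.
  by rewrite /= !join_subG !cycle_subG Kc Kd Ka.
have oa : #[a] = 6.
  have : #[a] %| 6 by rewrite order_dvdn -[6]/(3 * 2)%N expgM bt_z2.
  have not3 : ~~ (#[a] %| 3) by rewrite order_dvdn.
  have not2 : ~~ (#[a] %| 2).
    (* If [a ^+ 2 = 1], then [a = z] commutes with [b], so [c = d], and [c ^ d = z * c] gives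
       [z = 1]. *)
    rewrite order_dvdn; apply: contra ntz => /eqP a2.
    have az_eq : z = a by rewrite expgS a2 mulg1.
    have dc : d = c by have := bz; rewrite az_eq.
    by rewrite -(inj_eq (mulIg c)) -bt_c_conj_d mul1g dc conjgE mulKg.
  have : #[a] <= 6 by apply: dvdn_leq; rewrite // order_dvdn -[6]/(3 * 2)%N expgM bt_z2.
  by case: #[a] not2 not3 => [|[|[|[|[|[|[|]]]]]]].
have oI : #|Q :&: <[a]>| = 2.
  have Qz : z \in Q by rewrite -bt_c2 groupX // mem_gen // inE cycle_id.
  have dvd2 : 2 %| #|Q :&: <[a]>| by rewrite -bt_oz order_dvdG // inE Qz mem_cycle.
  have dvdI : #|Q :&: <[a]>| %| 2.
    by rewrite -[2]/(gcdn 8 6) dvdn_gcd -bt_Q_card -oa cardSg ?subsetIl // cardSg ?subsetIr.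
  by apply/eqP; rewrite eqn_dvd dvdI.
have /eqP := mul_cardG Q <[a]>; rewrite -defK oI bt_Q_card -orderE oa.
by rewrite -[(8 * 6)%N]/(24 * 2)%N eqn_pmul2r // => /eqP <-.
Qed.

Variable g : gT.
Hypotheses (ag : a ^ g = b) (bg : b ^ g = a) (Kg2 : g ^+ 2 \in bt_group).

Lemma bt_ext_def : <<[set a; b; g]>> = bt_group <*> <[g]>.
Proof. by rewrite joing_idl joing_idr. Qed.

Lemma bt_ext_norm : g \in 'N(bt_group).
Proof.
rewrite inE -genJ gen_subG conjUg !conjg_set1 ag bg setUC.
exact: subset_gen.
Qed.

Lemma bt_ext_card : #|<<[set a; b; g]>>| = (24 * #[coset bt_group g])%N.
Proof.
have nKg : <[g]> \subset 'N(bt_group) by rewrite cycle_subG bt_ext_norm.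
have nKY : bt_group <*> <[g]> \subset 'N(bt_group) by rewrite join_subG normG.
rewrite bt_ext_def -(Lagrange (joing_subl bt_group <[g]>)) bt_card; congr (_ * _)%N.
by rewrite -card_quotient // quotientYidl // quotient_cycle // bt_ext_norm.
Qed.

Lemma bt_ext_card_le : #|<<[set a; b; g]>>| <= 48.
Proof.
rewrite bt_ext_card (@leq_mul2l 24 _ 2) /=; apply: dvdn_leq => //.
by rewrite order_dvdn -morphX ?bt_ext_norm //= coset_id.
Qed.

Lemma bt_ext_card_eq : g \notin bt_group -> #|<<[set a; b; g]>>| = 48.
Proof.
move=> notKg; apply/eqP; rewrite eqn_leq bt_ext_card_le bt_ext_card (@leq_mul2l 24 2) /=.
rewrite order_gt1; apply: contra notKg => /eqP kg.
exact: coset_idr bt_ext_norm kg.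
Qed.

End BinaryTetrahedral.

Section Homomorphisms.

Variables (gT1 gT2 : finGroupType) (a1 b1 g1 : gT1) (a2 b2 g2 : gT2) (e : nat).
Hypotheses (aba1 : a1 * b1 * a1 = b1 ^+ 2) (bab1 : b1 * a1 * b1 = a1 ^+ 2).
Hypotheses (aba2 : a2 * b2 * a2 = b2 ^+ 2) (bab2 : b2 * a2 * b2 = a2 ^+ 2).
Hypothesis ntz1 : a1 ^+ 3 != 1.

Let a : gT1 * gT2 := (a1, a2).
Let b : gT1 * gT2 := (b1, b2).
Let g : gT1 * gT2 := (g1, g2).

Let pairX (x : gT1) (y : gT2) n : (x, y) ^+ n = (x ^+ n, y ^+ n).
Proof. by elim: n => // n IHn; rewrite !expgS IHn. Qed.

Let aba : a * b * a = b ^+ 2.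
Proof. by rewrite pairX -aba1 -aba2. Qed.
Let bab : b * a * b = a ^+ 2.
Proof. by rewrite pairX -bab1 -bab2. Qed.
Let ntz : a ^+ 3 != 1.
Proof. by apply: contraNneq ntz1; rewrite pairX => -[->]. Qed.

Let imf (S : {set gT1 * gT2}) : [morphism of (@fst gT1 gT2)] @* <<S>> = <<(@fst gT1 gT2) @: S>>.
Proof. by rewrite morphim_gen ?subsetT // morphimEsub ?subsetT. Qed.
Let ims (S : {set gT1 * gT2}) : [morphism of (@snd gT1 gT2)] @* <<S>> = <<(@snd gT1 gT2) @: S>>.
Proof. by rewrite morphim_gen ?subsetT // morphimEsub ?subsetT. Qed.

(** The pairs satisfy the same relations and their [a ^+ 3] is not 1, so they too generate a group
    of order 24: the graph of a homomorphism. *)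
Lemma bt_homg : <<[set a2; b2]>> \homg <<[set a1; b1]>>.
Proof.
apply: (@subdirect_homg _ _ _ _ <<[set a; b]>>%G).
- by rewrite imf imsetU !imset_set1.
- by rewrite ims imsetU !imset_set1.
by rewrite (bt_card aba bab ntz) (bt_card aba1 bab1 ntz1).
Qed.

Hypotheses (ag1 : a1 ^ g1 = b1) (bg1 : b1 ^ g1 = a1) (gg1 : g1 ^+ 2 = a1 ^+ e).
Hypotheses (ag2 : a2 ^ g2 = b2) (bg2 : b2 ^ g2 = a2) (gg2 : g2 ^+ 2 = a2 ^+ e).
Hypothesis notKg1 : g1 \notin <<[set a1; b1]>>.

(** The exponent [e] in [g ^+ 2 = a ^+ e] covers two groups at once: 0 serves for GL(2,3) and 3 for
    [J]. *)
Lemma bt_ext_homg : <<[set a2; b2; g2]>> \homg <<[set a1; b1; g1]>>.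
Proof.
apply: (@subdirect_homg _ _ _ _ <<[set a; b; g]>>%G).
- by rewrite imf !imsetU !imset_set1.
- by rewrite ims !imsetU !imset_set1.
rewrite (bt_ext_card_eq aba1 bab1) // ?gg1 ?groupX ?mem_gen ?set21 //.
apply: (bt_ext_card_le aba bab) => //.
- exact: (congr2 pair ag1 ag2).
- exact: (congr2 pair bg1 bg2).
by rewrite pairX gg1 gg2 -pairX groupX // mem_gen ?set21.
Qed.

End Homomorphisms.

(** * The linear groups over the fields of 3 and 5 elements *)

Section Matrix2.

Variable F : finFieldType.
Import GRing.Theory.
Local Open Scope ring_scope.

Definition mx2 (x y w v : F) : 'M[F]_2 :=
  \matrix_(i, j) if i == 0 then (if j == 0 then x else y) else (if j == 0 then w else v).

Lemma mulmx2 x y w v x' y' w' v' :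
  mx2 x y w v *m mx2 x' y' w' v' =
  mx2 (x * x' + y * w') (x * y' + y * v') (w * x' + v * w') (w * y' + v * v').
Proof.
apply/matrixP=> i j; rewrite !mxE !big_ord_recl big_ord0 !mxE /= addr0.
by case: (i == 0); case: (j == 0).
Qed.

Lemma mx2_1 : mx2 1 0 0 1 = 1%:M.
Proof.
by apply/matrixP=> -[[|[|i]] //= Hi] [[|[|j]] //= Hj]; rewrite !mxE.
Qed.

Lemma det_mx2 x y w v : \det (mx2 x y w v) = x * v - y * w.
Proof.
rewrite (expand_det_row _ 0) !big_ord_recl big_ord0 addr0 !mxE /= /cofactor !det_mx11 !mxE /=.
by rewrite expr0 expr1 mul1r mulN1r mulrN.
Qed.

Lemma mx2_unit x y w v : x * v - y * w != 0 -> mx2 x y w v \is a GRing.unit.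
Proof. by rewrite -det_mx2 -unitfE -unitmxE. Qed.

Definition gl2 x y w v (nz : x * v - y * w != 0) : {'GL_2[F]} :=
  FinRing.unit 'M[F]_(2.-1.+1) (mx2_unit nz).

Lemma GL2_eq (u v : {'GL_2[F]}) : GLval u = GLval v -> u = v.
Proof. exact: val_inj. Qed.

Lemma GL_det_unit (u : {'GL_2[F]}) : \det (GLval u) \is a GRing.unit.
Proof. by rewrite unitfE GL_det. Qed.

Definition GL2_detu (u : {'GL_2[F]}) : {unit F} := FinRing.unit F (GL_det_unit u).

Lemma GL2_detuM : {in 'GL_2[F] &, {morph GL2_detu : u v / (u * v)%g}}.
Proof. by move=> u v _ _; apply: val_inj; rewrite /= det_mulmx. Qed.

Canonical GL2_detu_morphism := Morphism GL2_detuM.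

Lemma card_SL2 : (#|SL 2 F| * #|F|.-1)%N = #|'GL_2[F]|.
Proof.
have ker_det : ('ker GL2_detu = SL 2 F)%g.
  apply/setP=> u; rewrite !inE /=; apply/eqP/eqP=> [/(congr1 val)//|du].
  exact: val_inj.
have im_det : (GL2_detu @* 'GL_2[F] = [set: {unit F}])%g.
  apply/setP=> x; rewrite inE; apply/morphimP.
  have nzx : FinRing.uval x * 1 - 0 * 0 != 0.
    by rewrite mulr1 mul0r subr0 -unitfE; case: x.
  exists (gl2 nzx); rewrite ?inE //; apply: val_inj.
  by rewrite /= det_mx2 mulr1 mul0r subr0.
have := card_morphim GL2_detu_morphism 'GL_2[F].
rewrite im_det setTI [in RHS]ker_det card_finField_unit => ->.
by rewrite Lagrange ?subsetT.
Qed.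

End Matrix2.

Section F3.

Import GRing.Theory.

(** [a] and [b] are transvections times -1, with cube -1; [g] swaps the coordinates and has
    determinant -1. *)
Definition gl23_a : {'GL_2(3)} := @gl2 'F_3 2%R 1%R 0%R 2%R isT.
Definition gl23_b : {'GL_2(3)} := @gl2 'F_3 2%R 0%R 1%R 2%R isT.
Definition gl23_g : {'GL_2(3)} := @gl2 'F_3 0%R 1%R 1%R 0%R isT.

Local Notation a := gl23_a.
Local Notation b := gl23_b.
Local Notation g := gl23_g.

Lemma gl23_aba : a * b * a = b ^+ 2.
Proof.
apply: GL2_eq; rewrite expg2 !GL_MxE /= !mulmx2.
by congr mx2; apply/eqP.
Qed.

Lemma gl23_bab : b * a * b = a ^+ 2.
Proof.
apply: GL2_eq; rewrite expg2 !GL_MxE /= !mulmx2.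
by congr mx2; apply/eqP.
Qed.

Lemma gl23_ntz : a ^+ 3 != 1.
Proof.
apply/eqP=> /(congr1 GLval); rewrite !expgS expg0 mulg1 !GL_MxE /= !mulmx2.
by move/matrixP/(_ 0%R 0%R)/eqP; rewrite !mxE.
Qed.

Lemma gl23_ag : a ^ g = b.
Proof.
apply: (mulgI g); rewrite -conjgC; apply: GL2_eq; rewrite !GL_MxE /= !mulmx2.
by congr mx2; apply/eqP.
Qed.

Lemma gl23_g2 : g ^+ 2 = 1.
Proof.
apply: GL2_eq; rewrite expg2 !GL_MxE /= !mulmx2 -[RHS]mx2_1.
by congr mx2; apply/eqP.
Qed.

Lemma gl23_bg : b ^ g = a.
Proof. by rewrite -gl23_ag -conjgM -expg2 gl23_g2 conjg1. Qed.

Lemma gl23_card : #|'GL_2(3)| = 48.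
Proof. by rewrite card_GL_2 card_Fp. Qed.

Lemma sl23_card : #|SL 2 'F_3| = 24.
Proof.
have := card_SL2 'F_3; rewrite gl23_card card_Fp // => /eqP.
by rewrite -[48]/(24 * 2)%N eqn_pmul2r // => /eqP.
Qed.

Lemma sl23_sub : <<[set a; b]>> \subset SL 2 'F_3.
Proof.
by rewrite gen_subG; apply/subsetP=> u /set2P[] ->; rewrite inE /= det_mx2.
Qed.

Lemma sl23_def : SL 2 'F_3 = <<[set a; b]>>.
Proof.
apply/esym/eqP; rewrite eqEcard sl23_sub sl23_card.
by rewrite (bt_card gl23_aba gl23_bab gl23_ntz).
Qed.

Lemma gl23_notKg : g \notin <<[set a; b]>>.
Proof. by rewrite -sl23_def inE /= det_mx2. Qed.

Lemma gl23_def : 'GL_2(3) = <<[set a; b; g]>>.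
Proof.
apply/esym/eqP; rewrite eqEcard subsetT gl23_card.
rewrite (bt_ext_card_eq gl23_aba gl23_bab gl23_ntz gl23_ag gl23_bg) ?gl23_notKg //.
by rewrite gl23_g2.
Qed.

End F3.

Section F5.

Import GRing.Theory.

Local Notation S := (SL 2 'F_5).
(** [z] is the scalar -1, [i] and [j] generate a quaternion group, and [sl25_y1], [sl25_y2]
    conjugate [i] to [j] and to [i * j], fusing the involutions modulo [z]. *)
Definition sl25_z : {'GL_2(5)} := @gl2 'F_5 4%R 0%R 0%R 4%R isT.
Definition sl25_i : {'GL_2(5)} := @gl2 'F_5 2%R 0%R 0%R 3%R isT.
Definition sl25_j : {'GL_2(5)} := @gl2 'F_5 0%R 1%R 4%R 0%R isT.
Definition sl25_y1 : {'GL_2(5)} := @gl2 'F_5 1%R 3%R 4%R 3%R isT.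
Definition sl25_y2 : {'GL_2(5)} := @gl2 'F_5 1%R 1%R 2%R 3%R isT.
Local Notation z := sl25_z.
Local Notation i := sl25_i.
Local Notation j := sl25_j.

Lemma sl25_mem : [/\ z \in S, i \in S, j \in S, sl25_y1 \in S & sl25_y2 \in S].
Proof. by split; rewrite inE /= det_mx2. Qed.

Lemma sl25_i2 : i ^+ 2 = z.
Proof. by apply: GL2_eq; rewrite expg2 !GL_MxE /= !mulmx2; congr mx2; apply/eqP. Qed.

Lemma sl25_j2 : j ^+ 2 = z.
Proof. by apply: GL2_eq; rewrite expg2 !GL_MxE /= !mulmx2; congr mx2; apply/eqP. Qed.

Lemma sl25_z2 : z ^+ 2 = 1.
Proof.
by apply: GL2_eq; rewrite expg2 !GL_MxE /= !mulmx2 -[RHS]mx2_1; congr mx2; apply/eqP.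
Qed.

Lemma sl25_ji : j * i = z * (i * j).
Proof. by apply: GL2_eq; rewrite !GL_MxE /= !mulmx2; congr mx2; apply/eqP. Qed.

Lemma sl25_iy1 : i ^ sl25_y1 = j.
Proof.
by apply: (mulgI sl25_y1); rewrite -conjgC; apply: GL2_eq; rewrite !GL_MxE /= !mulmx2; congr mx2; apply/eqP.
Qed.

Lemma sl25_iy2 : i ^ sl25_y2 = i * j.
Proof.
by apply: (mulgI sl25_y2); rewrite -conjgC; apply: GL2_eq; rewrite !GL_MxE /= !mulmx2; congr mx2; apply/eqP.
Qed.

Lemma sl25_card : #|S| = 120.
Proof.
have := card_SL2 'F_5; rewrite card_GL_2 card_Fp // => /eqP.
by rewrite -[(_ * 6)%N]/(120 * 4)%N eqn_pmul2r // => /eqP.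
Qed.

Lemma sl25_eta u : u \in S -> exists x y w v : 'F_5,
  GLval u = mx2 x y w v /\ (x * v - y * w = 1)%R.
Proof.
rewrite inE => /eqP; set A := GLval u => dA.
have defA : A = mx2 (A 0 0)%R (A 0 1)%R (A 1 0)%R (A 1 1)%R.
  apply/matrixP=> -[[|[|k]] //= Hk] [[|[|l]] //= Hl]; rewrite mxE /=;
    congr (A _ _); exact: val_inj.
by exists (A 0 0)%R, (A 0 1)%R, (A 1 0)%R, (A 1 1)%R; rewrite -det_mx2 -defA.
Qed.

Lemma mx2_inj (F : finFieldType) (x y w v x' y' w' v' : F) :
  mx2 x y w v = mx2 x' y' w' v' -> [/\ x = x', y = y', w = w' & v = v'].
Proof.
move/matrixP=> eqm; have := (eqm 0 0, eqm 0 1, eqm 1 0, eqm 1 1)%R.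
by rewrite !mxE /= => -[[[-> ->] ->] ->].
Qed.

Lemma sl25_center_z : z \in 'Z(S).
Proof.
have [Sz _ _ _ _] := sl25_mem; apply/centerP; split=> // u Su.
have [x [y [w [v [def_u _]]]]] := sl25_eta Su.
apply: GL2_eq; rewrite !GL_MxE def_u /= !mulmx2.
by rewrite !(mul0r, mulr0, add0r, addr0) ![(_ * 4)%R]mulrC.
Qed.

Lemma sl25_oz : #[z] = 2.
Proof.
apply: nt_prime_order; rewrite ?sl25_z2 //; apply/eqP=> /(congr1 GLval).
by move/matrixP/(_ 0%R 0%R)/eqP; rewrite !mxE.
Qed.

Lemma sl25_cent_i : #|'C_S[i]| <= 4.
Proof.
have cE u : u \in 'C_S[i] -> exists x v, GLval u = mx2 x 0%R 0%R v /\ (x * v = 1)%R.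
  case/setIP=> Su /cent1P; have [x [y [w [v [def_u du]]]]] := sl25_eta Su.
  move/(congr1 GLval); rewrite !GL_MxE def_u /= !mulmx2 !(mul0r, mulr0, add0r, addr0).
  case/mx2_inj=> _ y32 w32 _; exists x, v.
  have y0 : y = 0%R by transitivity (y * 3 - 2 * y)%R; [ring | rewrite y32 subrr].
  have w0 : w = 0%R by transitivity (3 * w - w * 2)%R; [ring | rewrite w32 subrr].
  by rewrite y0 w0 in def_u du *; rewrite mul0r subr0 in du.
have injf : {in 'C_S[i] &, injective (fun u => GLval u 0 0)%R}.
  move=> u1 u2 /cE[x1 [v1 [def_u1 xv1]]] /cE[x2 [v2 [def_u2 xv2]]].
  rewrite def_u1 def_u2 !mxE /= => x12; apply: GL2_eq; rewrite def_u1 def_u2 x12.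
  by congr mx2; rewrite -[v1]mul1r -xv2 -x12 mulrAC xv1 mul1r.
rewrite -(card_in_imset injf) (@leq_trans #|predC1 (0%R : 'F_5)|) //; last first.
  by rewrite cardC1 card_Fp.
apply/subset_leq_card/subsetP=> _ /imsetP[u /cE[x [v [def_u xv]]] ->].
rewrite def_u mxE /= inE; apply: contraTneq (isT : (1 : 'F_5) != 0)%R => x0.
by rewrite -xv x0 mul0r eqxx.
Qed.

End F5.

(** * Central extensions of the alternating group of degree 5 *)

Section BinaryIcosahedral.

Variables (gT : finGroupType) (G : {group gT}) (z v : gT) (V : {group coset_of <[z]>}).
Hypotheses (Zz : z \in 'Z(G)) (oz : #[z] = 2) (Gv : v \in G) (Zv2 : v ^+ 2 \in 'Z(G)).

Local Notation H := (G / <[z]>)%G.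
Local Notation t := (coset <[z]> v).

Hypotheses (sylV : 2.-Sylow(H) V) (oV : #|V| = 4) (Vt : t \in V) (ot : #[t] = 2).
Hypotheses (oCt : #|'C_H[t]| = 4) (fusV : {in V^#, forall s, s \in t ^: H}).
Hypothesis not_nVH : ~~ (H \subset 'N(V)).

Let nsZG : <[z]> <| G.
Proof. by apply: sub_center_normal; rewrite cycle_subG. Qed.
Let nZG : G \subset 'N(<[z]>) := normal_norm nsZG.
Let domG : G \subset coset <[z]> @*^-1 H.
Proof. by rewrite quotientGK. Qed.

Lemma binary_icosahedral_card : #|G| = 120.
Proof.
have [oH _] := four_card60 sylV oV Vt ot oCt fusV not_nVH.
by rewrite -(Lagrange (normal_sub nsZG)) -card_quotient // oH -orderE oz.
Qed.

(** Modulo [<[z]>] every such [g] is conjugate to [v], so up to conjugation it is [v] times a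
    central element of square 1, and [v ^+ 2] is central. *)
Lemma binary_icosahedral_square g :
  g \in G -> 2.-elt g -> g \notin <[z]> -> g ^+ 2 = v ^+ 2.
Proof.
move=> Gg pg notZg; have nZg := subsetP nZG g Gg.
have ptb : 2.-group <[coset <[z]> g]> by rewrite -quotient_cycle // quotient_pgroup.
have stH : <[coset <[z]> g]> \subset H by rewrite cycle_subG mem_quotient.
have [_ /morphimP[h nZh Gh ->]] := Sylow_Jsub sylV stH ptb.
rewrite -cycleJ cycle_subG -morphJ // => Vgh.
have ntgh : coset <[z]> (g ^ h) != 1.
  apply: contra notZg => /eqP/coset_idr; rewrite groupJ // => /(_ isT).
  by rewrite memJ_norm.
have /imsetP[_ /morphimP[k nZk Gk ->]] : coset <[z]> (g ^ h) \in t ^: H.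
  by apply: fusV; rewrite !inE ntgh.
rewrite -morphJ ?(subsetP nZG v) // => eq_gv.
have v2J x : x \in G -> (v ^+ 2) ^ x = v ^+ 2.
  by move=> Gx; apply/conjg_fixP/commgP; case/centerP: Zv2 => _; apply.
have nZgh : g ^ h \in 'N(<[z]>) by rewrite groupJ.
have nZvk : v ^ k \in 'N(<[z]>) by rewrite groupJ // (subsetP nZG).
have : g ^ h * (v ^ k)^-1 \in <[z]>.
  by apply: coset_idr; rewrite ?groupM ?groupV // morphM ?morphV ?groupV //= eq_gv mulgV.
move=> Zc; set c := _ * _ in Zc.
have def_gh : g ^ h = c * v ^ k by rewrite mulgKV.
have c2 : c ^+ 2 = 1 by apply/eqP; rewrite -order_dvdn -oz order_dvdG.
have cc : commute c (v ^ k).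
  have /subsetP/(_ c Zc)/centerP[_] : <[z]> \subset 'Z(G) by rewrite cycle_subG.
  by apply; apply: groupJ.
apply: (conjg_inj h); rewrite v2J // conjXg def_gh expgMn // c2 mul1g -conjXg.
exact: v2J.
Qed.

Lemma binary_icosahedral_morphism :
  exists f : {morphism G >-> {perm 'I_5}}, f @* G = 'Alt_('I_5) /\ 'ker f = <[z]>.
Proof.
have /isogP[h injh hH] := four_Alt5 sylV oV Vt ot oCt fusV not_nVH.
exists (restrm_morphism domG [morphism of h \o coset <[z]>]); split.
  by rewrite morphim_restrm setIid morphim_comp.
rewrite ker_restrm ker_comp (trivgP injh) -kerE ker_coset.
by apply/setIidPr; apply: normal_sub.
Qed.

End BinaryIcosahedral.

Section Icosahedral.

Variables (gT : finGroupType) (S : {group gT}) (z i j y1 y2 : gT).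
Hypotheses (Zz : z \in 'Z(S)) (oz : #[z] = 2) (oS : #|S| = 120).
Hypotheses (Si : i \in S) (Sj : j \in S) (Sy1 : y1 \in S) (Sy2 : y2 \in S).
Hypotheses (i2 : i ^+ 2 = z) (j2 : j ^+ 2 = z) (ji : j * i = z * (i * j)).
Hypotheses (iy1 : i ^ y1 = j) (iy2 : i ^ y2 = i * j) (leCi : #|'C_S[i]| <= 4).

Let V := (<[coset <[z]> i]> <*> <[coset <[z]> j]>)%G.

Let notZ u : u ^+ 2 = z -> u \notin <[z]>.
Proof.
move=> u2; apply/negP; rewrite cycle2g // => /set2P[] uE; move: oz; rewrite -u2 uE.
  by rewrite expg1n order1.
by rewrite -{1}oz expg_order order1.
Qed.

(** Applied to SL(2,5), this supplies the hypotheses of the four-group analysis, so that its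
    quotient by -1 is identified with ['Alt_5] by the same argument as that of [G]. *)
Lemma icosahedral_four_group : [/\ 2.-Sylow(S / <[z]>) V, #|V| = 4, coset <[z]> i \in V,
  #[coset <[z]> i] = 2 & [/\ #|'C_(S / <[z]>)[coset <[z]> i]| = 4,
   {in V^#, forall s, s \in coset <[z]> i ^: (S / <[z]>)%G} &
   ~~ ((S / <[z]>)%G \subset 'N(V))]].
Proof.
have nsZS : <[z]> <| S by apply: sub_center_normal; rewrite cycle_subG Zz.
have nZS := subsetP (normal_norm nsZS).
have [ni nj ny1 ny2] : [/\ i \in 'N(<[z]>), j \in 'N(<[z]>), y1 \in 'N(<[z]>) & y2 \in 'N(<[z]>)].
  by split; apply: nZS.
have oH : #|S / <[z]>| = 60.
  rewrite card_quotient ?normal_norm // -divgS ?normal_sub // oS.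
  by rewrite -orderE oz.
set H := (S / <[z]>)%G in oH *; set t := coset <[z]> i; set s := coset <[z]> j.
have o2 u : u \in 'N(<[z]>) -> u ^+ 2 = z -> #[coset <[z]> u] = 2.
  move=> nu u2; apply: nt_prime_order => //.
    by rewrite -morphX //= u2 coset_id ?cycle_id.
  by apply: contra (notZ u2) => /eqP; apply: coset_idr.
have ot : #[t] = 2 by apply: o2 ni i2.
have os : #[s] = 2 by apply: o2 nj j2.
have tJy1 : t ^ coset <[z]> y1 = s by rewrite -morphJ // iy1.
have tJy2 : t ^ coset <[z]> y2 = t * s by rewrite -morphJ // iy2 morphM.
have cst : commute s t.
  have nz : z \in 'N(<[z]>) by rewrite (subsetP (normG _)) ?cycle_id.
  rewrite /commute -(morphM (coset_morphism <[z]>)) //= ji !morphM ?groupM //=.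
  by rewrite (coset_id (cycle_id z)) mul1g.
have [Hy1 Hy2] : coset <[z]> y1 \in H /\ coset <[z]> y2 \in H by rewrite !mem_quotient.
have [Ht Hs] : t \in H /\ s \in H by rewrite !mem_quotient.
have ts : t * s != 1 by rewrite -tJy2 conjg_eq1 -order_eq1 ot.
have notst : s \notin <[t]>.
  rewrite [<[t]>]cycle2g // !inE negb_or -order_eq1 os /=; apply: contra ts => /eqP->.
  by rewrite -expg2 -ot expg_order.
have defV : V :=: <[t]> * <[s]>.
  by rewrite /= norm_joinEr // cents_norm //; apply: cents_cycle.
have oV : #|V| = 4.
  rewrite defV TI_cardMg -?orderE ?ot ?os // setIC prime_TIg -?orderE ?os //.
  by rewrite cycle_subG.
have sVH : V \subset H by rewrite join_subG !cycle_subG Ht Hs.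
have sylV : 2.-Sylow(H) V by rewrite pHallE sVH oV oH p_part.
have Vt : t \in V by rewrite mem_gen // inE cycle_id.
have Vs : s \in V by rewrite mem_gen // inE cycle_id orbT.
have oCt : #|'C_H[t]| = 4.
  apply/eqP; rewrite eqn_leq; apply/andP; split.
    apply: leq_trans leCi; apply: card_cent1_quotient_le => //.
    by rewrite cycle_subG Zz.
  rewrite -oV subset_leq_card // subsetI sVH join_subG !cycle_subG cent1id.
  by apply/cent1P.
have fus : {in V^#, forall s, s \in t ^: H}.
  move=> x /setD1P[ntx]; rewrite defV => /mulsgP[x1 x2].
  rewrite [<[t]>]cycle2g // [<[s]>]cycle2g // => /set2P[] -> /set2P[] -> def_x; rewrite def_x in ntx *.
  - by rewrite mulg1 eqxx in ntx.
  - by rewrite mul1g -tJy1 imset_f.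
  - by rewrite mulg1 class_refl.
  by rewrite -tJy2 imset_f.
split=> //; split=> //; apply/negP=> nVH.
have := four_oM sylV oV Vt ot oCt fus; rewrite (setIidPl _) //.
by rewrite oH.
Qed.

End Icosahedral.

Section IsogSL25.

Variables (gT : finGroupType) (G : {group gT}) (z v : gT) (V : {group coset_of <[z]>}).
Hypotheses (Zz : z \in 'Z(G)) (oz : #[z] = 2) (Gv : v \in G) (v2 : v ^+ 2 = z).

Local Notation H := (G / <[z]>)%G.
Local Notation t := (coset <[z]> v).

Hypotheses (sylV : 2.-Sylow(H) V) (oV : #|V| = 4) (Vt : t \in V) (ot : #[t] = 2).
Hypotheses (oCt : #|'C_H[t]| = 4) (fusV : {in V^#, forall s, s \in t ^: H}).
Hypothesis not_nVH : ~~ (H \subset 'N(V)).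

Lemma isog_SL25 : G \isog SL 2 'F_5.
Proof.
have [f [fG kf]] := binary_icosahedral_morphism Zz sylV oV Vt ot oCt fusV not_nVH.
have oG := binary_icosahedral_card Zz oz sylV oV Vt ot oCt fusV not_nVH.
have Zv2 : v ^+ 2 \in 'Z(G) by rewrite v2.
have sqG := binary_icosahedral_square Zz oz Gv Zv2 sylV fusV.
have [Sz Si Sj Sy1 Sy2] := sl25_mem.
have [sylV' oV' Vt' ot' [oCt' fusV' not_nVH']] :=
  @icosahedral_four_group _ (SL_group 2 'F_5) _ _ _ _ _ sl25_center_z sl25_oz sl25_card Si Sj Sy1 Sy2
    sl25_i2 sl25_j2 sl25_ji sl25_iy1 sl25_iy2 sl25_cent_i.
have [f' [fG' kf']] :=
  binary_icosahedral_morphism (G := SL_group 2 'F_5) sl25_center_z sylV' oV' Vt' ot' oCt' fusV'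
    not_nVH'.
have Zi2 : sl25_i ^+ 2 \in 'Z(SL 2 'F_5) by rewrite sl25_i2 sl25_center_z.
have sqG' := binary_icosahedral_square (G := SL_group 2 'F_5) sl25_center_z sl25_oz Si Zi2 sylV' fusV'.
apply: (central_extension2_isog fG fG' kf kf' oz sl25_oz).
- by rewrite kf => g Gg pg Zg; rewrite sqG.
- by rewrite kf' => g Gg pg Zg; rewrite sqG' ?sl25_i2.
by rewrite oG sl25_card.
Qed.

End IsogSL25.

Lemma Hall_pcore_trivial_pgroup (p : nat) (gT : finGroupType) (G : {group gT}) :
  p^'.-Hall(G) 'O_p^'(G) -> 'O_p^'(G) = 1 -> p.-group G.
Proof.
move=> hallO O1; move: hallO; rewrite O1 => /and3P[_ _].
by rewrite indexg1 /pgroup (eq_pnat _ (negnK _)).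
Qed.

(** * Elements of order 3 in the group of order 24 *)

Section Octahedral.

Variables (gT : finGroupType) (H E : {group gT}) (s t : gT).
Hypotheses (nsEH : E <| H) (oE : #|E| = 4) (oH : #|H| = 24) (oCs : #|'C_H[s]| = 8).
Hypotheses (Es : s \in E) (fusE : E^# = s ^: H).
Hypotheses (Ht : t \in H) (ot : #[t] = 2) (notEt : t \notin E) (oCt : #|'C_H[t]| = 4).
Hypothesis cst : s ^ t = s.

Let sEH : E \subset H := normal_sub nsEH.
Let nEH : H \subset 'N(E) := normal_norm nsEH.

Let cEE : abelian E.
Proof. by apply: (@p2group_abelian _ 2); rewrite ?/pgroup oE. Qed.

Let cent3 a f : a \in H -> #[a] = 3 -> f \in E -> f != 1 -> f ^ a != f.
Proof.
move=> Ha oa Ef ntf; apply/eqP=> faf.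
have /imsetP[h Hh fE] : f \in s ^: H by rewrite -fusE !inE ntf.
have : 3 %| #|'C_H[f]|.
  by rewrite -oa order_dvdG // inE Ha; apply/cent1P/commute_sym/commgP/conjg_fixP.
have -> : 'C_H[f] = 'C_H[s] :^ h by rewrite fE conjIg conjGid // cent1J.
by rewrite cardJg oCs.
Qed.

(** Modulo [E], of index 6, [t] either inverts [a], as wanted, or centralises it. In the latter case
    [t] fixes [s ^ a]; but ['C_E[t] = <[s]>], and no element of order 3 fixes [s]. *)
Let prod3 a : a \in H -> #[a] = 3 -> a * a ^ t \in E.
Proof.
move=> Ha oa; have [nEa nEt] : a \in 'N(E) /\ t \in 'N(E) by split; apply: (subsetP nEH).
have notEa : a \notin E by apply/negP=> /order_dvdG; rewrite oa oE.
have oab : #[coset E a] = 3.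
  apply: nt_prime_order => //; first by rewrite -morphX //= -oa expg_order morph1.
  by apply: contra notEa => /eqP; apply: coset_idr.
have oHE : #|H / E| = 6 by rewrite card_quotient // -divgS // oH oE.
have sAH : <[coset E a]> \subset H / E by rewrite cycle_subG mem_quotient.
have nAt : coset E t \in 'N(<[coset E a]>).
  have nsA : <[coset E a]> <| H / E by rewrite index2_normal // -divgS // oHE -orderE oab.
  by rewrite (subsetP (normal_norm nsA)) ?mem_quotient.
have : coset E a ^ coset E t \in <[coset E a]> by rewrite memJ_norm ?cycle_id.
case/cyclePmin=> i; rewrite oab => lti atE.
apply: coset_idr; first by rewrite groupM ?groupJ.
rewrite morphM ?groupJ ?morphJ //= atE -expgS.
case: i lti atE => [|[|[|]]] // _ atE.
- by move/eqP: atE; rewrite expg0 conjg_eq1 -order_eq1 oab.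
- have Ee : a^-1 * a ^ t \in E.
    apply: coset_idr; first by rewrite groupM ?groupV ?groupJ.
    by rewrite morphM ?morphV ?groupV ?groupJ ?morphJ //= atE mulVg.
  have Esa : s ^ a \in E by rewrite memJ_norm.
  have sat : (s ^ a) ^ t = s ^ a.
    have -> : (s ^ a) ^ t = (s ^ a) ^ (a^-1 * a ^ t) by rewrite conjJg cst -conjgM mulKVg.
    by apply/conjg_fixP/commgP; apply: (centsP cEE).
  have nts : s != 1 by have := class_refl H s; rewrite -fusE => /setD1P[].
  have ltC : #|'C_E[t]| < 4.
    rewrite -oE proper_card // properEneq subsetIl andbT; apply/eqP => CE.
    have CHE : 'C_H[t] = E.
      by apply/eqP; rewrite eq_sym eqEcard oCt oE -{1}CE setSI.
    by case/negP: notEt; rewrite -CHE inE Ht cent1id.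
  have leC : #|'C_E[t]| <= 2.
    by have := cardSg (subsetIl E 'C[t]); rewrite oE; case: #|_| ltC => [|[|[|[|]]]].
  have sE : 'C_E[t] = <[s]>.
    apply/eqP; rewrite eq_sym eqEcard (leq_trans leC) -?orderE ?order_gt1 //.
    by rewrite cycle_subG inE Es; apply/andP; split=> //; apply/cent1P/commgP/conjg_fixP.
  have os : #[s] = 2 by apply/eqP; rewrite eqn_leq order_gt1 nts andbT orderE -sE.
  have : s ^ a \in <[s]> by rewrite -sE inE Esa; apply/cent1P/commgP/conjg_fixP.
  rewrite [<[s]>]cycle2g // => /set2P[/eqP | sa]; first by rewrite conjg_eq1 (negPf nts).
  by have := cent3 Ha oa Es nts; rewrite sa eqxx.
by rewrite -oab expg_order.
Qed.

Let not_tEa a : a \in H -> #[a] = 3 -> t \notin E <*> <[a]>.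
Proof.
move=> Ha oa; have nEa : <[a]> \subset 'N(E) by rewrite cycle_subG (subsetP nEH).
have oEa : #|E <*> <[a]>| = 12.
  rewrite norm_joinEr // TI_cardMg ?oE -?orderE ?oa //.
  by apply: coprime_TIg; rewrite oE -orderE oa.
have hallE : 2.-Hall(E <*> <[a]>) E.
  by rewrite /pHall joing_subl -divgS ?joing_subl // oEa oE /pgroup oE.
apply: contra notEt => tEa.
rewrite (mem_normal_Hall hallE) /p_elt ?ot //.
by rewrite /normal joing_subl join_subG normG.
Qed.

(** In the model [Sym_4], [t] is a transposition and [a] a 3-cycle not inverted by [t]. If [t]
    inverts [a], take [a ^ e] with [e] in [E] not commuting with [t]: were it inverted too, the
    nontrivial element [e * (e ^ t)^-1] of [E] would commute with [a]. *)
Lemma octahedral_order3 : exists a : gT,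
  [/\ a \in H, #[a] = 3, a * a ^ t \in E^# & t \notin E <*> <[a]>].
Proof.
have [a Ha oa] : {a | a \in H & #[a] = 3} by apply: Cauchy; rewrite ?oH.
have [aat1 | naat] := eqVneq (a * a ^ t) 1; last first.
  by exists a; split; rewrite ?not_tEa // !inE naat prod3.
have [e Ee not_cte] : exists2 e, e \in E & e \notin 'C[t].
  apply/subsetPn/negP => cEt.
  have CHE : 'C_H[t] = E by apply/eqP; rewrite eq_sym eqEcard oCt oE subsetI sEH cEt.
  by case/negP: notEt; rewrite -CHE inE Ht cent1id.
have [He Hae] : e \in H /\ a ^ e \in H by split; rewrite ?groupJ // (subsetP sEH).
have oae : #[a ^ e] = 3 by rewrite orderJ.
exists (a ^ e); split=> //; last exact: not_tEa.
apply/setD1P; split; last exact: prod3.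
apply/eqP => aat1'.
have nEt : t \in 'N(E) by apply: (subsetP nEH).
pose f := e * (e ^ t)^-1.
have Ef : f \in E by rewrite groupM ?groupV ?memJ_norm.
have ntf : f != 1.
  apply: contra not_cte; rewrite -eq_mulgV1 eq_sym => /eqP et.
  by apply/cent1P/commgP/conjg_fixP.
have oV : #[a^-1] = 3 by rewrite orderV.
case/negP: (cent3 (groupVr Ha) oV Ef ntf); apply/eqP.
have atE : a ^ t = a^-1 by apply/eqP; rewrite eq_sym eq_invg_mul aat1.
apply: (mulgI e^-1); apply: (mulIg (e ^ t)); rewrite [in RHS]/f mulKg mulVg -aat1'.
by rewrite conjJg atE !conjgE invgK /f !conjgE !mulgA.
Qed.

End Octahedral.

Lemma bt_relations (gT : finGroupType) (a b : gT) :
    a ^+ 3 = (a * b) ^+ 2 -> b ^+ 3 = (a * b) ^+ 2 ->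
  a * b * a = b ^+ 2 /\ b * a * b = a ^+ 2.
Proof.
move=> a3 b3; split; first by apply: (mulIg b); rewrite -mulgA -expg2 -b3 -expgSr.
by apply: (mulgI a); rewrite -expgS a3 expg2 !mulgA.
Qed.

(** * The quotient by the odd core *)

Section CoreFree.

Variables (gT : finGroupType) (L : {group gT}) (z v : gT).
Hypotheses (Zz : z \in 'Z(L)) (oz : #[z] = 2) (Lv : v \in L).
Hypotheses (oC : #|'C_L[v]| = 4) (notZv : v \notin <[z]>).
Hypotheses (O1 : 'O_2^'(L) = 1) (not2L : ~~ 2.-group L).

Local Notation H := (L / <[z]>)%G.
Local Notation t := (coset <[z]> v).

Let sZZ : <[z]> \subset 'Z(L). Proof. by rewrite cycle_subG. Qed.
Let nsZL : <[z]> <| L. Proof. exact: sub_center_normal. Qed.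
Let nZL : L \subset 'N(<[z]>) := normal_norm nsZL.
Let Lz : z \in L. Proof. by case/centerP: Zz. Qed.
Let czL x : x \in L -> commute z x. Proof. by case/centerP: Zz => _; apply. Qed.

Lemma cent4_square_central : v ^+ 2 \in <[z]>.
Proof.
have Cz : <[z]> \subset 'C_L[v].
  by rewrite cycle_subG inE Lz; apply/cent1P; rewrite /commute (czL Lv).
have oCb : #|'C_L[v] / <[z]>| = 2.
  rewrite card_quotient ?(subset_trans (subsetIl _ _) nZL) //.
  by rewrite -divgS // oC -orderE oz.
have Cv : v \in 'C_L[v] by rewrite inE Lv cent1id.
apply: coset_idr; first by rewrite groupX // (subsetP nZL).
rewrite morphX ?(subsetP nZL) //=; apply/eqP; rewrite -order_dvdn -oCb.
by rewrite order_dvdG // mem_quotient.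
Qed.

(** The preimage of this core has the cyclic Sylow subgroup [<[z]>], hence a normal odd complement,
    trivial because [L] has trivial odd core; so the preimage is a 2-group. *)
Lemma quotient_pcore_trivial : 'O_2^'(H) = 1.
Proof.
set O := coset <[z]> @*^-1 'O_2^'(H).
have nsO : O <| L.
  have -> : L :=: coset <[z]> @*^-1 H by rewrite quotientGK.
  by rewrite cosetpre_normal pcore_normal.
have sZO : <[z]> \subset O by rewrite sub_cosetpre.
have oO : #|O : <[z]>| = #|'O_2^'(H)|.
  rewrite -card_quotient ?cosetpreK //.
  exact: subset_trans (normal_sub nsO) nZL.
have sylZ : 2.-Sylow(O) <[z]>.
  by rewrite /pHall sZO /pgroup -orderE oz oO; apply: (pcore_pgroup 2^' H).
have O2O : 'O_2^'(O) = 1.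
  by apply/trivgP; rewrite -O1 pcore_max ?pcore_pgroup // (char_normal_trans (pcore_char _ _)).
have pO := Hall_pcore_trivial_pgroup (cyclic_Sylow2_Hall_pcore sylZ (cycle_cyclic z)) O2O.
have : 2.-group 'O_2^'(H) by rewrite -(cosetpreK 'O_2^'(H)) quotient_pgroup.
by move/pnat_1/(_ (pcore_pgroup _ _))/eqP; rewrite -trivg_card1 => /eqP.
Qed.

(** A Sylow subgroup of order 4 would make [L] a 2-group: it is cyclic, or else transfer applies
    because [v] has no conjugate in the central subgroup [<[z]>]. *)
Lemma core_free_Sylow2 : exists P : {group gT},
  [/\ 2.-Sylow(L) P, v \in P, #|'C_P[v]| = 4, 8 <= #|P| & 'Z(P) = <[z]>].
Proof.
have pC : 2.-group 'C_L[v] by rewrite /pgroup oC.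
have [P sylP sCP] := Sylow_superset (subsetIl _ _) pC.
have [sPL pP _] := and3P sylP.
have Pv : v \in P by rewrite (subsetP sCP) // inE Lv cent1id.
have Pz : z \in P.
  by rewrite (subsetP sCP) // inE Lz; apply/cent1P; rewrite /commute (czL Lv).
have oCP : #|'C_P[v]| = 4.
  by rewrite -oC; congr #|pred_of_set _|; apply/eqP; rewrite eqEsubset setSI // subsetI sCP subsetIr.
have leP : 8 <= #|P|.
  have dvd4 : 4 %| #|P| by rewrite -oC cardSg.
  have [n oP] := p_natP pP; rewrite oP in dvd4 *.
  case: n oP dvd4 => [|[|[|n]]] // oP _; last by rewrite !expnS !mulnA leq_pmulr ?expn_gt0.
  case/negP: not2L; apply: (@Hall_pcore_trivial_pgroup 2) => //.
  have [cycP | ncycP] := boolP (cyclic P); first exact: cyclic_Sylow2_Hall_pcore cycP.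
  apply: (@Sylow2_order4_Hall_pcore _ _ P <[z]>%G v) => //=.
  - by rewrite cycle_subG.
  - have : #[v] %| 2 ^ 2 by rewrite -oP order_dvdG.
    case/(dvdn_pfactor _ _ (isT : prime 2)) => [[|[|[|]]]] // _ ov.
      by case/negP: notZv; move/eqP: ov; rewrite order_eq1 => /eqP->.
    case/negP: ncycP; apply/cyclicP; exists v; apply/eqP.
    by rewrite eq_sym eqEcard cycle_subG Pv -orderE ov oP.
  move=> g Lg; rewrite -(memJ_norm _ (subsetP nZL _ (groupVr Lg))) conjgK //.
exists P; split=> //; have [oZ _] := cent4_center pP Pv oCP leP.
apply/eqP; rewrite eq_sym eqEcard oZ -orderE oz cycle_subG andbT.
by apply/centerP; split=> // y Py; apply: czL; apply: (subsetP sPL).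
Qed.

Let v2 : v ^+ 2 \in <[z]> := cent4_square_central.

Section Sylow.

Variable P : {group gT}.
Hypotheses (sylP : 2.-Sylow(L) P) (Pv : v \in P) (oCP : #|'C_P[v]| = 4).
Hypotheses (leP : 8 <= #|P|) (ZP : 'Z(P) = <[z]>).

Let sPL : P \subset L := pHall_sub sylP.
Let pP : 2.-group P := pHall_pgroup sylP.
Let D := (P / <[z]>)%G.

Let sylD : 2.-Sylow(H) D. Proof. exact: quotient_pHall (subset_trans sPL nZL) sylP. Qed.
Let Dt : t \in D. Proof. exact: mem_quotient. Qed.
Let Pz : z \in P. Proof. by have /setIP[] : z \in 'Z(P) by rewrite ZP cycle_id. Qed.

Let oD : #|P| = (2 * #|D|)%N.
Proof.
rewrite -(Lagrange (_ : <[z]> \subset P)) ?cycle_subG // -orderE oz /= card_quotient //.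
exact: subset_trans sPL nZL.
Qed.

Let leD : 4 <= #|D|. Proof. by move: leP; rewrite oD (@leq_mul2l 2 4). Qed.

Let ot : #[t] = 2.
Proof.
apply: nt_prime_order => //; first by rewrite -morphX ?(subsetP nZL) //= coset_id.
by apply: contra notZv => /eqP; apply: coset_idr; rewrite (subsetP nZL).
Qed.

Let oCt : #|'C_H[t]| = 4.
Proof.
apply/eqP; rewrite eqn_leq -{1}oC card_cent1_quotient_le //=.
apply: leq_trans (card_cent1_2group (pHall_pgroup sylD) leD Dt) _.
by rewrite subset_leq_card // setSI // (pHall_sub sylD).
Qed.

Let nZx x : x \in L -> x \in 'N(<[z]>). Proof. exact: (subsetP nZL). Qed.

Let not2H : ~~ 2.-group H.
Proof.
apply: contra not2L => pH; rewrite -(quotientGK nsZL).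
rewrite (_ : 2.-group (coset <[z]> @*^-1 H)) //.
by rewrite /pgroup card_cosetpre -orderE oz pnatM; apply: pH.
Qed.

Let cyc2 (y : gT) : y \in <[z]> -> y = 1 \/ y = z.
Proof. by rewrite [<[z]>]cycle2g // => /set2P[]; [left | right]. Qed.

Let card_D4 : #|P| = 8 -> #|D| = 4.
Proof. by move=> oP8; apply/eqP; rewrite -(eqn_pmul2l (isT : 0 < 2)) -oD oP8. Qed.

(** [D] is a four-group. An involution [s] of [D] not conjugate to [t] would, by transfer with [M =
    <[s]>], give [H] a normal odd complement and make it a 2-group. *)
Lemma core_free_Sylow8_fusion : #|P| = 8 -> {in D^#, forall s, s \in t ^: H}.
Proof.
move=> oP8 s /setD1P[nts Ds]; have oD4 := card_D4 oP8.
apply: contraR not2H => not_ts; apply: (@Hall_pcore_trivial_pgroup 2); last exact: quotient_pcore_trivial.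
have os : #[s] = 2.
  have : #[s] %| 2 ^ 2 by rewrite -[(2 ^ 2)%N]oD4 order_dvdG.
  case/(dvdn_pfactor _ _ (isT : prime 2)) => [[|[|[|]]]] // _ os.
    by move/eqP: os; rewrite order_eq1 (negPf nts).
  case/negP: (cent4_not_abelian Pv oCP leP); apply: cyclic_center_factor_abelian.
  rewrite ZP; apply/cyclicP; exists s; apply/eqP.
  by rewrite eq_sym eqEcard cycle_subG Ds -orderE os; apply: (eq_leq oD4).
apply: (Sylow2_order4_Hall_pcore sylD oD4 (M := <[s]>%G) (t := t)) => //=.
  by rewrite cycle_subG.
move=> g Hg; rewrite [<[s]>]cycle2g //; apply/set2P=> -[] tg.
  by move/eqP: ot; rewrite -(orderJ t g) tg order1.
by case/negP: not_ts; rewrite -tg memJ_class.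
Qed.

(** All elements of [P] outside [<[z]>] share the square [v ^+ 2]; were it 1, [P] would be
    elementary abelian. *)
Lemma core_free_Sylow8_square : #|P| = 8 -> {in P, forall y, y \notin <[z]> -> y ^+ 2 = z}.
Proof.
move=> oP8; have fusD := core_free_Sylow8_fusion oP8.
have Zv2 : v ^+ 2 \in 'Z(L) by rewrite (subsetP sZZ).
have sqP y : y \in P -> y \notin <[z]> -> y ^+ 2 = v ^+ 2.
  move=> Py; apply: (binary_icosahedral_square Zz oz Lv Zv2 sylD fusD).
    exact: (subsetP sPL).
  exact: mem_p_elt pP Py.
suffices v2z : v ^+ 2 = z by move=> y Py nZy; rewrite -v2z; apply: sqP.
have [v21 | //] := cyc2 v2; case/negP: (cent4_not_abelian Pv oCP leP).
apply: (@abelem_abelian _ 2); apply: involutions_abelem => y Py.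
have [/cyc2[]-> | notZy] := boolP (y \in <[z]>); [exact: expg1n | by rewrite -oz expg_order |].
by rewrite sqP.
Qed.

(* If the conjugates of [v] invert a group centralised by [z], then the left hand
   side centralises it and the right hand side inverts it. *)
Lemma core_free_Sylow8_product : #|P| = 8 -> exists g h c : gT,
  [/\ g \in L, h \in L, c \in <[z]> & v * v ^ g = c * v ^ h].
Proof.
move=> oP8; have fusD := core_free_Sylow8_fusion oP8.
have oD4 := card_D4 oP8.
have [s Ds nts] : exists2 s, s \in D & s \notin <[t]>.
  by apply/subsetPn/negP=> /subset_leq_card; rewrite -orderE ot oD4.
have nts1 : s != 1 by apply: contraNneq nts => ->.
have ntts : t * s != 1.
  by apply: contraNneq nts => /(canRL (mulKg _)) ->; rewrite mulg1 groupV cycle_id.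
(* [s] and [t * s] lift to conjugates of [v], so the product lifts up to a factor in [<[z]>]. *)
have /imsetP[_ /morphimP[g _ Lg ->] sE] : s \in t ^: H by apply: fusD; rewrite !inE nts1.
have /imsetP[_ /morphimP[h _ Lh ->] tsE] : t * s \in t ^: H.
  by apply: fusD; apply/setD1P; split; last exact: groupM.
exists g, h, (v * v ^ g * (v ^ h)^-1); split=> //; last by rewrite mulgKV.
have [Lvg Lvh] : v ^ g \in L /\ v ^ h \in L by split; apply: groupJ.
apply: coset_idr; first by rewrite nZx ?groupM ?groupV.
rewrite morphM ?morphV ?groupM ?groupV ?nZx //= morphM ?nZx //= !morphJ ?nZx //=.
by rewrite -sE tsE mulgV.
Qed.

(** If [D] is normal, [L] has order 24 and it remains to find [a], [b] with
    [a ^+ 3 = b ^+ 3 = (a * b) ^+ 2 = z]. So [b = a^-1 * c] with [c] in [P] outside [<[z]>]; a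
    factor [z] corrects each cube. *)
Lemma core_free_Sylow8_class : #|P| = 8 -> L \isog SL 2 'F_3 \/ L \isog SL 2 'F_5.
Proof.
move=> oP8; have fusD := core_free_Sylow8_fusion oP8.
have sqP := core_free_Sylow8_square oP8.
have oD4 := card_D4 oP8.
have v2z : v ^+ 2 = z by apply: sqP.
have [nDH | not_nDH] := boolP (H \subset 'N(D)); last first.
  by right; apply: (isog_SL25 Zz oz Lv v2z sylD oD4 Dt ot oCt fusD not_nDH).
left; have oH : #|H| = 12 by rewrite -(four_oM sylD oD4 Dt ot oCt fusD) (setIidPl nDH).
have oL : #|L| = 24 by rewrite -(Lagrange (normal_sub nsZL)) -orderE oz -card_quotient // [#|_|]oH.
(* A nontrivial cube in [D] has centraliser [D], and [h] commutes with its own cube. *)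
have cube h : h \in H -> h \notin D -> h ^+ 3 = 1.
  move=> Hh; apply: contraNeq => nth3.
  have Dh3 : h ^+ 3 \in D.
    apply: coset_idr; first by rewrite groupX // (subsetP nDH).
    rewrite morphX ?(subsetP nDH) //=; apply/eqP; rewrite -order_dvdn.
    have <- : #|H / D| = 3 by rewrite card_quotient // -divgS ?(pHall_sub sylD) // oH oD4.
    by rewrite order_dvdG // mem_quotient.
  rewrite -(four_cent sylD oD4 oCt fusD (s := h ^+ 3)); last by apply/setD1P.
  by apply/setIP; split=> //; apply/cent1P; rewrite /commute -expgS -expgSr.
have [a0 La0 oa0] : {a0 | a0 \in L & #[a0] = 3} by apply: Cauchy; rewrite ?oL.
have z2 : z ^+ 2 = 1 by rewrite -oz expg_order.
pose a := a0 * z; have La : a \in L by apply: groupM.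
have a3 : a ^+ 3 = z.
  by rewrite expgMn; [rewrite -oa0 expg_order mul1g oa0 expgS z2 mulg1 | apply/commute_sym/czL].
have oaH : #[coset <[z]> a0] = 3.
  apply: nt_prime_order => //; first by rewrite -morphX ?nZx //= -oa0 expg_order morph1.
  by apply/eqP => /coset_idr; rewrite nZx // => /(_ isT)/cyc2[] a0E; move: oa0; rewrite a0E ?order1 ?oz.
have acoset : coset <[z]> a = coset <[z]> a0.
  by rewrite morphM ?nZx //= (coset_id (cycle_id z)) mulg1.
have notDa : coset <[z]> a \notin D.
  by rewrite acoset; apply: contraL (isT : ~~ (3 %| 4)) => /order_dvdG; rewrite oaH [#|_|]oD4 negbK.
have lift_cube c : c \in P -> (a^-1 * c) ^+ 3 \in <[z]>.
  move=> Pc; have Lc := subsetP sPL c Pc; have Lac : a^-1 * c \in L by rewrite groupM ?groupV.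
  apply: coset_idr; first by rewrite nZx // groupX.
  rewrite morphX ?nZx //=; apply: cube; first exact: mem_quotient.
  rewrite morphM ?morphV ?nZx ?groupV //=.
  by rewrite groupMr ?mem_quotient // groupV.
have [c Pc [notZc b3]] : exists2 c, c \in P & c \notin <[z]> /\ (a^-1 * c) ^+ 3 = z.
  have [b3 | b3] := cyc2 (lift_cube v Pv); last by exists v.
  exists (v * z); first exact: groupM.
  rewrite groupMr ?cycle_id //; split=> //.
  rewrite mulgA expgMn; last by apply/commute_sym/czL; rewrite groupM ?groupV.
  by rewrite b3 mul1g expgS z2 mulg1.
have c2 := sqP c Pc notZc; set b := a^-1 * c in b3.
have cE : a * b = c by rewrite mulKVg.
have [aba bab] : a * b * a = b ^+ 2 /\ b * a * b = a ^+ 2.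
  by apply: bt_relations; rewrite cE c2.
have nta3 : a ^+ 3 != 1 by rewrite a3 -order_eq1 oz.
have defL : L :=: <<[set a; b]>>.
  apply/eqP; rewrite eq_sym eqEcard [#|<<_>>|](bt_card aba bab nta3) oL leqnn andbT.
  rewrite gen_subG subUset !sub1set La groupM ?groupV //.
  exact: (subsetP sPL).
have homL : L \homg SL 2 'F_3.
  by rewrite defL sl23_def; apply: bt_homg gl23_aba gl23_bab aba bab gl23_ntz.
by rewrite isogEcard homL oL; apply: (eq_leq sl23_card).
Qed.

(** [v] inverts [x] up to [<[z]>], so [D] is dihedral and [H] has order 24. The generators are a
    lift [a] of an element of order 3 and [b = a ^ v]; the crux is [(a * b) ^+ 2 = z]. *)
Lemma core_free_Sylow16_class : 16 <= #|P| -> exists a : gT,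
  [/\ a \in L, a * a ^ v * a = (a ^ v) ^+ 2, a ^ v * a * a ^ v = a ^+ 2, a ^+ 3 = z
    & [/\ (a ^ v) ^ v = a, v ^+ 2 = 1 \/ v ^+ 2 = z, v \notin <<[set a; a ^ v]>>
       & <<[set a; a ^ v; v]>> = L]].
Proof.
move=> leP16; have leD8 : 8 <= #|D| by move: leP16; rewrite oD (@leq_mul2l 2 8).
have z2 : z ^+ 2 = 1 by rewrite -oz expg_order.
have [x Px iX] := cent4_cyclic_index2 pP Pv oCP leP.
have sXP : <[x]> \subset P by rewrite cycle_subG.
have nsX : <[x]> <| P by rewrite index2_normal.
have oX : (#[x] * 2 = #|P|)%N by rewrite -iX Lagrange.
have leX : 8 <= #[x] by move: leP16; rewrite -oX (@leq_mul2r 2 8).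
have Xz : z \in <[x]>.
  rewrite -cycle_subG; apply: prime_meetG; first by rewrite -orderE oz.
  rewrite /= setIC -ZP meet_center_nil ?(pgroup_nil pP) //.
  by rewrite -cardG_gt1 -orderE (leq_trans _ leX).
have notXv : v \notin <[x]>.
  apply: contraL leX => Xv; rewrite -ltnNge ltnS (leq_trans _ (isT : 4 <= 7)) // -oCP.
  rewrite subset_leq_card // subsetI sXP sub_cent1.
  exact: subsetP (cycle_abelian x) v Xv.
have defK : 'C_<[x]>[v] = <[z]>.
  have sKC : 'C_<[x]>[v] \subset 'C_P[v] by apply: setSI.
  have ltK : #|'C_<[x]>[v]| < 4.
    rewrite -oCP proper_card // properEneq sKC andbT; apply: contraNneq notXv => KC.
    by have /setIP[] : v \in 'C_<[x]>[v]; rewrite // KC inE Pv cent1id.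
  have dvdK : #|'C_<[x]>[v]| %| 4 by rewrite -oCP cardSg.
  apply/eqP; rewrite eq_sym eqEcard subsetI cycle_subG Xz sub_cent1 /= -orderE oz.
  apply/andP; split; last by case: #|_| ltK dvdK => [|[|[|[|]]]].
  by rewrite cent_cycle; apply/cent1P; rewrite /commute (czL Lv).
have v2c y : y \in L -> y ^ (v ^+ 2) = y.
  by move=> Ly; apply/conjg_fixP/commgP; case/cyc2: v2 => ->; [apply: commute1 | apply/commute_sym/czL].
(* As [v ^+ 2] acts trivially, [v] exchanges [x] and [x ^ v], so it fixes their product. *)
have x_inv : x ^ v * x \in <[z]>.
  have Xxv : x ^ v \in <[x]> by rewrite memJ_norm ?cycle_id // (subsetP (normal_norm nsX)).
  rewrite -defK inE groupM ?cycle_id //=; apply/cent1P/commgP/conjg_fixP.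
  rewrite conjMg -conjgM -expg2 v2c ?(subsetP sPL) //.
  by apply: (centsP (cycle_abelian x)); rewrite ?cycle_id.
have nZ_x : x \in 'N(<[z]>) by rewrite nZx ?(subsetP sPL).
have nZ_v : v \in 'N(<[z]>) by rewrite nZx.
pose xb := coset <[z]> x.
have Dxb : xb \in D by apply: mem_quotient.
have sZX : <[z]> \subset <[x]> by rewrite cycle_subG.
have cycxb : <[x]> / <[z]> = <[xb]> by rewrite quotient_cycle.
have iDxb : #|D : <[xb]>| = 2.
  rewrite -cycxb -iX; apply: index_quotient_eq => //; last exact: subset_trans sPL nZL.
  exact: subset_trans (subsetIr _ _) sZX.
have xb_inv : xb ^ t = xb^-1.
  apply/eqP; rewrite eq_sym eq_invg_mul; apply/eqP.
  rewrite /xb -morphJ //= -morphM ?groupJ //=; apply: coset_id.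
  suffices -> : x * x ^ v = x ^ v * x by [].
  apply: (centsP (cycle_abelian x)); rewrite ?cycle_id //.
  by rewrite memJ_norm ?cycle_id // (subsetP (normal_norm nsX)).
have notxbt : t \notin <[xb]>.
  apply: contra notXv; rewrite -cycxb => Xt.
  have nsZX : <[z]> <| <[x]> by rewrite /normal sZX (subset_trans sXP) // (subset_trans sPL).
  have defX : coset <[z]> @*^-1 (<[x]> / <[z]>) = <[x]> by rewrite quotientGK.
  by rewrite -defX mem_morphpre.
have neHD : H :!=: D by apply: contraNneq not2H => ->; apply: pHall_pgroup sylD.
have H1 := quotient_pcore_trivial.
have [oD8 oH [E [nsE oE notEt Es fusE]]] :=
  dihSyl_small sylD Dxb iDxb Dt notxbt ot xb_inv leD8 oCt H1 neHD.
have CD := dihSyl_M_eq_D sylD Dxb iDxb Dt notxbt ot xb_inv leD8 oCt H1.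
have Ht : t \in H by apply: mem_quotient.
have st : half_turn xb ^ t = half_turn xb.
  have /setIP[_ /cent1P cts] : t \in 'C_H[half_turn xb] by rewrite CD.
  by apply/conjg_fixP/commgP/commute_sym.
have oCs : #|'C_H[half_turn xb]| = 8 by rewrite CD.
have [a0 [Ha0 oa0 Ea0 not_ta]] := octahedral_order3 nsE oE oH oCs Es fusE Ht ot notEt oCt st.
have oL : #|L| = 48 by rewrite -(Lagrange (normal_sub nsZL)) -orderE oz -card_quotient // [#|_|]oH.
have [a La [a0E a3]] : exists2 a, a \in L & coset <[z]> a = a0 /\ a ^+ 3 = z.
  have /morphimP[a1 nZa1 La1 a1E] := Ha0.
  have : a1 ^+ 3 \in <[z]>.
    apply: coset_idr; first by rewrite groupX.
    by rewrite morphX //= -a1E -oa0 expg_order.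
  case/cyc2=> a13; last by exists a1.
  exists (a1 * z); first exact: groupM.
  split; first by rewrite morphM ?nZx //= (coset_id (cycle_id z)) mulg1.
  by rewrite expgMn; [rewrite a13 mul1g expgS z2 mulg1 | apply/commute_sym/czL].
have Lav : a ^ v \in L by apply: groupJ.
have oxb : #[xb] = 4 by apply/eqP; rewrite -(@eqn_pmul2r 2) // -{1}iDxb Lagrange ?cycle_subG // [#|_|]oD8.
have x4 : x ^+ 4 = z.
  have : x ^+ 4 \in <[z]>.
    by apply: coset_idr; [rewrite groupX | rewrite morphX //= -oxb expg_order].
  case/cyc2=> // x41; case/negP: (isT : ~~ (8 <= 4)); apply: leq_trans leX _.
  by rewrite dvdn_leq // order_dvdn x41.
(* The image of [a * a ^ v] is conjugate to the half turn, whose lift [x ^+ 2] has square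
   [x ^+ 4 = z]; a factor in [<[z]>] does not change squares. *)
have c2 : (a * a ^ v) ^+ 2 = z.
  have : coset <[z]> (a * a ^ v) \in half_turn xb ^: H.
    by rewrite -fusE morphM ?morphJ ?nZx //= a0E.
  case/imsetP=> _ /morphimP[h nZh Lh ->].
  rewrite /half_turn oxb (_ : 4 %/ 2 = 2)%N // /xb -morphX //= -morphJ ?groupX //= => cE.
  pose q := (x ^+ 2) ^ h.
  have Lq : q \in L by rewrite groupJ // groupX // (subsetP sPL).
  have : a * a ^ v * q^-1 \in <[z]>.
    have [nZ1 nZ2] : a * a ^ v \in 'N(<[z]>) /\ q^-1 \in 'N(<[z]>).
      by split; apply: nZx; rewrite ?groupM ?groupV.
    apply: coset_idr; first exact: groupM.
    rewrite morphM //= cE morphV ?mulgV //; exact: nZx.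
  have q2 : q ^+ 2 = z.
    by rewrite -conjXg -expgM x4; apply/conjg_fixP/commgP/czL.
  case/cyc2=> /(canRL (mulgKV _)) ->; first by rewrite mul1g.
  by rewrite expgMn ?z2 ?mul1g //; apply: czL.
have b3 : (a ^ v) ^+ 3 = z by rewrite -conjXg a3; apply/conjg_fixP/commgP/czL.
have [aba bab] := bt_relations (etrans a3 (esym c2)) (etrans b3 (esym c2)).
have avv : (a ^ v) ^ v = a by rewrite -conjgM -expg2 v2c.
have nta3 : a ^+ 3 != 1 by rewrite a3 -order_eq1 oz.
have notKv : v \notin <<[set a; a ^ v]>>.
  apply: contra not_ta => Kv.
  have sKE : <<[set a; a ^ v]>> \subset coset <[z]> @*^-1 (E <*> <[a0]>).
    have Ga0 : a0 \in E <*> <[a0]> by rewrite mem_gen // inE cycle_id orbT.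
    rewrite gen_subG subUset !sub1set; apply/andP; split; apply/morphpreP.
      by split; [apply: nZx | rewrite /= a0E].
    split; first exact: nZx.
    rewrite /= morphJ ?nZx //= a0E -(mulKg a0 (a0 ^ t)) groupM ?groupV //.
    by rewrite mem_gen // inE; case/setD1P: Ea0 => _ ->.
  by have /morphpreP[] := subsetP sKE v Kv.
have Kv2 : v ^+ 2 \in <<[set a; a ^ v]>>.
  by case/cyc2: v2 => ->; rewrite ?group1 // -a3 groupX ?mem_gen ?set21.
exists a; split=> //; split=> //; first by case/cyc2: v2; [left | right].
apply/eqP; rewrite eqEcard gen_subG !subUset !sub1set La Lav Lv /= oL.
by rewrite (bt_ext_card_eq aba bab).
Qed.

End Sylow.
Lemma core_free_class :
  (L \isog SL 2 'F_3 \/ L \isog SL 2 'F_5)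
    /\ (exists g h c : gT, [/\ g \in L, h \in L, c \in <[z]> & v * v ^ g = c * v ^ h])
  \/ exists a : gT,
  [/\ a \in L, a * a ^ v * a = (a ^ v) ^+ 2, a ^ v * a * a ^ v = a ^+ 2, a ^+ 3 = z
    & [/\ (a ^ v) ^ v = a, v ^+ 2 = 1 \/ v ^+ 2 = z, v \notin <<[set a; a ^ v]>>
       & <<[set a; a ^ v; v]>> = L]].
Proof.
have [P [sylP Pv oCP leP ZP]] := core_free_Sylow2.
have [oP8 | leP16] : #|P| = 8 \/ 16 <= #|P|.
  have [n oP] := p_natP (pHall_pgroup sylP); rewrite oP in leP *.
  case: n leP {oP} => [|[|[|[|n]]]] // _; [by left | right].
  by rewrite !expnS !mulnA leq_pmulr ?expn_gt0.
  left; split; first exact: core_free_Sylow8_class oP8.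
  exact: core_free_Sylow8_product oP8.
by right; apply: core_free_Sylow16_class leP16.
Qed.

End CoreFree.

(** * Groups with an isolated edge *)

Lemma isolated_edge_cent1 (gT : finGroupType) (G : {group gT}) (v w : gT) :
  isolated_edge G v w ->
  [/\ v \in G, v \notin 'Z(G) & 'C_G[v] \subset 'Z(G) :|: [set v; w]].
Proof.
case/andP=> /and4P[/setDP[Gv notZv] _ _ _] /imsetP[x _ vwE]; split=> //.
apply/subsetP=> y /setIP[Gy /cent1P cyv]; rewrite inE.
have [//|notZy /=] := boolP (y \in 'Z(G)); have [->|neyv] := eqVneq y v; first by rewrite set21.
have : v \in [set v; w] by rewrite set21.
have Vy : y \in cgraph_vertices G by apply/setDP.
rewrite vwE => /setIdP[Vv xv]; apply/setIdP; split=> //.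
apply: connect_trans xv (connect1 _).
by rewrite /cgraph_edge Vv Vy eq_sym neyv; apply/eqP.
Qed.

(** ['C_G[v]] contains ['Z(G)] and the disjoint coset [v *: 'Z(G)], yet has at most two elements
    outside ['Z(G)]. *)
Lemma isolated_edge_cent4 (gT : finGroupType) (G : {group gT}) (v w : gT) :
    'Z(G) :!=: 1 -> isolated_edge G v w -> exists z : gT,
  [/\ 'Z(G) = <[z]>, #[z] = 2, v \in G, v \notin <[z]> & #|'C_G[v]| = 4].
Proof.
move=> ntZ /isolated_edge_cent1[Gv notZv sC].
have sZC : 'Z(G) \subset 'C_G[v].
  by rewrite subsetI center_sub (subset_trans (subsetIr _ _)) // -cent_set1 centS ?sub1set.
have sZvC : v *: 'Z(G) \subset 'C_G[v].
  have Cv : v \in 'C_G[v] by rewrite inE Gv cent1id.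
  by apply/subsetP=> _ /lcosetP[y Zy ->]; apply: groupM => //; apply: (subsetP sZC).
have dZ : [disjoint 'Z(G) & v *: 'Z(G)].
  rewrite disjoint_subset; apply/subsetP=> y Zy; rewrite inE mem_lcoset.
  by rewrite groupMr // groupV.
have leC : #|'C_G[v]| <= #|'Z(G)| + 2.
  apply: leq_trans (subset_leq_card sC) _; apply: leq_trans (leq_card_setU _ _) _.
  by rewrite leq_add2l cards2; case: eqP.
have leZC : #|'Z(G)| + #|'Z(G)| <= #|'C_G[v]|.
  rewrite -{2}(card_lcoset 'Z(G) v).
  by rewrite -cardsUI disjoint_setI0 // cards0 addn0 subset_leq_card // subUset sZC.
have lt1Z : 1 < #|'Z(G)| by rewrite cardG_gt1.
have oZ : #|'Z(G)| = 2.
  by apply/eqP; rewrite eqn_leq lt1Z andbT -(leq_add2l #|'Z(G)|) (leq_trans leZC).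
have /cyclicP[z defZ] : cyclic 'Z(G) by rewrite prime_cyclic ?oZ.
exists z; rewrite -defZ orderE -defZ; split=> //.
by apply/eqP; rewrite eqn_leq; rewrite oZ in leC leZC; rewrite leC.
Qed.

(** * The odd core and its complement *)

Lemma odd_card_sqrt (gT : finGroupType) (N : {group gT}) n :
  odd #|N| -> n \in N -> exists2 m, m \in N & m ^+ 2 = n.
Proof.
move=> oddN Nn; exists (n ^+ (#|N|.+1)./2); first exact: groupX.
rewrite -expgM muln2 halfK /= oddN subn0 expgS.
have /eqP-> : n ^+ #|N| == 1 by rewrite -order_dvdn order_dvdG.
by rewrite mulg1.
Qed.

Lemma inversion_fixed (gT : finGroupType) (N : {group gT}) n :
  odd #|N| -> n \in N -> n = n^-1 -> n = 1.
Proof.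
move=> oddN Nn nV; apply/eqP; rewrite -order_eq1 -dvdn1.
have := oddN; rewrite -coprime2n => /eqP <-.
by rewrite dvdn_gcd order_dvdG // order_dvdn expgS expg1 {1}nV mulVg eqxx.
Qed.

Section OddCore.

Variables (gT : finGroupType) (G : {group gT}) (z v : gT).
Hypotheses (defZ : 'Z(G) = <[z]>) (oz : #[z] = 2) (Gv : v \in G).
Hypotheses (notZv : v \notin <[z]>) (oC : #|'C_G[v]| = 4).

Local Notation N := 'O_2^'(G)%G.
Local Notation L := (G / N)%G.

Let Zz : z \in 'Z(G). Proof. by rewrite defZ cycle_id. Qed.
Let Gz : z \in G. Proof. by case/centerP: Zz. Qed.
Let nsNG : N <| G := pcore_normal _ _.
Let nNG : G \subset 'N(N) := normal_norm nsNG.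
Let sNG : N \subset G := normal_sub nsNG.
Let nNx x : x \in G -> x \in 'N(N). Proof. exact: (subsetP nNG). Qed.

Lemma odd_core_odd : odd #|N|.
Proof. by rewrite odd_2'nat; apply: pcore_pgroup. Qed.

Lemma odd_core_cent1 : 'C_N[v] = 1.
Proof.
have coN4 : coprime #|N| 4 by rewrite (@coprimeXr 2 _ 2) // coprimen2 odd_core_odd.
have : #|'C_N[v]| %| gcdn #|N| 4.
  by rewrite dvdn_gcd cardSg ?subsetIl // -oC cardSg // setSI.
by rewrite (eqP coN4) dvdn1 -trivg_card1 => /eqP.
Qed.

Lemma odd_core_cent_z : z \in 'C(N).
Proof. by apply/centP=> n Nn; case/centerP: Zz => _; apply; apply: (subsetP sNG). Qed.

Lemma odd_core_inverted : acts_by_inversion v N.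
Proof.
apply: fpf_square_central_inverts; [exact: nNx | | exact: odd_core_cent1].
have := cent4_square_central Zz oz Gv oC; apply: subsetP.
by rewrite cycle_subG odd_core_cent_z.
Qed.

(* As [N] is odd and inverted by [v], every element of [v *: N] is of the form
   [v ^ m] with [m \in N]. *)
Lemma odd_core_quotient_cent : 'C_L[coset N v] = 'C_G[v] / N.
Proof.
apply/eqP; rewrite eqEsubset; apply/andP; split; last first.
  by rewrite (subset_trans (quotientI _ _ _)) // setIS // quotient_cent1s ?nNx.
apply/subsetP=> _ /setIP[/morphimP[x nNx_ Gx ->] /cent1P cxv].
have Nn : v^-1 * v ^ x \in N.
  apply: coset_idr; first by rewrite groupM ?groupV ?groupJ ?nNx.
  rewrite morphM ?morphV ?morphJ ?groupV ?groupJ ?nNx //=.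
  suffices -> : coset N v ^ coset N x = coset N v by rewrite mulVg.
  by apply/conjg_fixP/commgP/commute_sym.
(* As [v] inverts [m], [v^-1 * v ^ m] is [m ^+ 2]; hence [v ^ m = v ^ x] and [x * m^-1] centralises
   [v]. *)
have [m Nm m2] := odd_card_sqrt odd_core_odd Nn.
have Gm := subsetP sNG m Nm.
have vm : v ^ m = v ^ x.
  apply: (mulgI v^-1); rewrite -m2 -commgEl commgEr.
  by rewrite odd_core_inverted ?groupV // invgK.
have Cy : x * m^-1 \in 'C_G[v].
  rewrite inE groupM ?groupV //=; apply/cent1P/commute_sym/commgP/conjg_fixP.
  by rewrite conjgM -vm conjgK.
rewrite /= (_ : coset N x = coset N (x * m^-1)) ?mem_quotient //.
by rewrite morphM ?groupV ?nNx //= [X in _ * X]coset_id ?groupV // mulg1.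
Qed.

Lemma odd_core_quotient_card : #|'C_L[coset N v]| = 4.
Proof.
rewrite odd_core_quotient_cent -oC; apply/esym/card_isog/quotient_isog.
  exact: subset_trans (subsetIl _ _) nNG.
by rewrite /= setIA (setIidPl sNG) odd_core_cent1.
Qed.

Lemma odd_core_center : coset N z \in 'Z(L).
Proof.
apply/centerP; split=> [|_ /morphimP[y nNy Gy ->]]; first exact: mem_quotient.
by rewrite /commute -!morphM ?nNx //=; case/centerP: Zz => _ ->.
Qed.

Lemma odd_core_notN x : x \in 'C_G[v] -> coset N x = 1 -> x = 1.
Proof.
case/setIP=> Gx cvx /coset_idr; rewrite nNx // => /(_ isT) Nx; apply/set1P.
by rewrite -[[set 1]]odd_core_cent1 inE Nx.
Qed.

Let Cz : z \in 'C_G[v].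
Proof. by rewrite inE Gz; apply/cent1P; case/centerP: Zz => _; apply. Qed.

Lemma odd_core_order : #[coset N z] = 2.
Proof.
apply: nt_prime_order => //; first by rewrite -morphX ?nNx //= -oz expg_order morph1.
by apply: contra_eq_neq oz => /(odd_core_notN Cz)->; rewrite order1.
Qed.

Lemma odd_core_notZ : coset N v \notin <[coset N z]>.
Proof.
rewrite -quotient_cycle ?nNx //; apply: contra notZv => /morphimP[y nNy Zy vy].
suffices -> : v = y by [].
have Cv : v \in 'C_G[v] by rewrite inE Gv cent1id.
have Cy : y \in 'C_G[v] by apply: (subsetP _ y Zy); rewrite cycle_subG.
apply/eqP; rewrite eq_mulgV1; apply/eqP; apply: odd_core_notN.
  by rewrite groupM ?groupV.
by rewrite morphM ?morphV ?groupV //= ?nNx // vy mulgV.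
Qed.

End OddCore.

(** [P0] acts trivially, so the induced group is elementary abelian of order dividing 4; it is not
    trivial, as [v] inverts a nontrivial group of odd order. *)
Lemma squares_induces (gT : finGroupType) (N P P0 : {group gT}) (v : gT) :
    N :!=: 1 -> odd #|N| -> P \subset 'N(N) -> v \in P -> acts_by_inversion v N ->
    P0 \subset P -> P0 \subset 'C(N) -> #|P : P0| %| 4 -> {in P, forall y, y ^+ 2 \in P0} ->
  induces_Z2_or_Z2xZ2 P N.
Proof.
move=> ntN oddN nNP Pv vN sP0 cP0 dvd4 sqP.
have abA : 2.-abelem (conj_aut N @* P).
  apply: involutions_abelem => _ /morphimP[y nNy Py ->].
  rewrite -morphX //; apply/set1P; rewrite -[[set 1]](morphim_ker (conj_aut N)) ker_conj_aut.
  by apply: mem_morphim; [apply: groupX | apply: (subsetP cP0); apply: sqP].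
have oA : #|conj_aut N @* P| %| 4.
  rewrite card_morphim ker_conj_aut (setIidPr nNP).
  apply: dvdn_trans dvd4; rewrite -(indexgI P 'C(N)).
  by apply: (indexgS P (K := (P :&: 'C(N))%G)); rewrite subsetI sP0.
have ntA : conj_aut N @* P != 1.
  apply: contra ntN => /eqP A1.
  have cPN : P \subset 'C(N) by rewrite -ker_conj_aut kerE -sub_morphim_pre // A1.
  apply/eqP/trivgP/subsetP=> n Nn; apply/set1P; apply: (inversion_fixed oddN) => //.
  by rewrite -vN //; apply/esym/conjg_fixP/commgP/commute_sym; apply: (centsP cPN).
have oZ2 : #|Zp 2| = 2 by rewrite card_Zp.
have Zp2x x : x \in Zp 2 -> x ^+ 2 = 1.
  by move=> Zx; apply/eqP; rewrite -order_dvdn -[X in _ %| X]oZ2 order_dvdG.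
have [oA2 | oA4] : #|conj_aut N @* P| = 2 \/ #|conj_aut N @* P| = 4.
  move: ntA oA; rewrite trivg_card1; case: #|_| => [|[|[|[|[|n]]]]] // _;
    by [left | right | move/dvdn_leq=> /(_ isT)].
- left; rewrite (isog_abelem_card _ abA) oA2 oZ2 eqxx andbT.
  exact: involutions_abelem.
right; rewrite (isog_abelem_card _ abA) oA4 cardsX oZ2 eqxx andbT.
apply: involutions_abelem => -[x y] /setXP[Zx Zy].
exact: (congr2 pair (Zp2x x Zx) (Zp2x y Zy)).
Qed.

Lemma group4_complement_type (gT : finGroupType) (P : {group gT}) :
  #|P| = 4 -> complement_type P.
Proof.
move=> oP; left; have [cycP | ncycP] := boolP (cyclic P).
  constructor 1; rewrite isog_cyclic_card // oP card_Zp // eqxx andbT.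
  by apply/cyclicP; exists Zp1; apply: Zp_cycle.
constructor 2.
have pP : 2.-group P by rewrite /pgroup oP.
have o2 x : x \in P -> x != 1 -> #[x] = 2.
  move=> Px ntx; have : #[x] %| 2 ^ 2 by rewrite -[(2 ^ 2)%N]oP order_dvdG.
  case/(dvdn_pfactor _ _ (isT : prime 2)) => [[|[|[|]]]] // _ ox.
    by move/eqP: ox; rewrite order_eq1 (negPf ntx).
  case/negP: ncycP; apply/cyclicP; exists x; apply/eqP.
  by rewrite eq_sym eqEcard cycle_subG Px -orderE ox oP.
have [x Px ntx] : exists2 x, x \in P & x != 1 by apply/trivgPn; rewrite -cardG_gt1 oP.
have [y Py nxy] : exists2 y, y \in P & y \notin <[x]>.
  by apply/subsetPn/negP=> /subset_leq_card; rewrite -orderE o2 // oP.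
have nty : y != 1 by apply: contraNneq nxy => ->.
have neyx : x != y by apply: contraNneq nxy => <-; apply: cycle_id.
suffices defP : P :=: <<[set x; y]>>.
  by have := involutions_gen_dihedral (o2 x Px ntx) (o2 y Py nty) neyx; rewrite /= -defP oP.
apply/eqP; rewrite eq_sym eqEcard gen_subG subUset !sub1set Px Py oP /=.
have sxG : <[x]> \subset <<[set x; y]>> by rewrite cycle_subG mem_gen ?set21.
have : 2 %| #|<<[set x; y]>>| by rewrite -(o2 x Px ntx) order_dvdG // mem_gen ?set21.
have : 2 < #|<<[set x; y]>>|.
  rewrite -(o2 x Px ntx) orderE proper_card // properE sxG.
  by apply: contra nxy => /subsetP; apply; rewrite mem_gen ?set22.
by case: #|_| => [|[|[|[|]]]].
Qed.

Lemma acts_by_inversion_conj (gT : finGroupType) (N : {group gT}) (v g : gT) :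
  g \in 'N(N) -> acts_by_inversion v N -> acts_by_inversion (v ^ g) N.
Proof.
move=> nNg vN n Nn; rewrite -{1}(conjgKV g n) -conjJg vN ?memJ_norm ?groupV //.
by rewrite conjVg conjgKV.
Qed.

Lemma acts_by_inversion_ratio (gT : finGroupType) (N : {group gT}) (u v : gT) :
  acts_by_inversion u N -> acts_by_inversion v N -> u^-1 * v \in 'C(N).
Proof.
move=> uN vN; apply/centP=> n Nn; apply/commute_sym/commgP/conjg_fixP.
rewrite conjgM (_ : n ^ u^-1 = n^-1) ?vN ?groupV ?invgK //.
by apply: (@conjg_inj _ u); rewrite conjgKV uN ?groupV ?invgK.
Qed.

Lemma quotient_order2_sqr (gT : finGroupType) (P Q : {group gT}) :
  P \subset 'N(Q) -> #|P / Q| = 2 -> {in P, forall y, y ^+ 2 \in Q}.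
Proof.
move=> nQP oPQ y Py; have nQy := subsetP nQP y Py.
apply: coset_idr; first exact: groupX.
rewrite morphX //=; apply/eqP; rewrite -order_dvdn -oPQ order_dvdG //.
exact: mem_quotient.
Qed.

(** For [#|P| >= 8] the derived subgroup of [P] centralises [N]: the class of [v] in [P] is a coset
    of it, so its elements are quotients of two elements inverting [N]. The factor group has order 4
    and is not cyclic. For [#|P| = 4], the subgroup [<[z]>] takes its place. *)
Lemma odd_core_complement (gT : finGroupType) (G : {group gT}) (z v : gT) :
    'Z(G) = <[z]> -> #[z] = 2 -> v \in G -> v \notin <[z]> -> #|'C_G[v]| = 4 ->
    2.-group (G / 'O_2^'(G)) ->
  exists P : {group gT}, [/\ 'O_2^'(G) ><| P = G, complement_type P
    & 'O_2^'(G) :!=: 1 -> induces_Z2_or_Z2xZ2 P 'O_2^'(G)].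
Proof.
move=> defZ oz Gv notZv oC pGN; set N := 'O_2^'(G)%G.
have nsNG : N <| G := pcore_normal _ _; have sNG := normal_sub nsNG.
have Zz : z \in 'Z(G) by rewrite defZ cycle_id.
have czG x : x \in G -> commute z x by case/centerP: Zz => _; apply.
have Gz : z \in G by case/centerP: Zz.
have oddN : odd #|N| := odd_core_odd G.
have vN := odd_core_inverted defZ oz Gv oC.
have pC : 2.-group 'C_G[v] by rewrite /pgroup oC.
have [P sylP sCP] := Sylow_superset (subsetIl _ _) pC.
have [sPG pP _] := and3P sylP; have nNP := subset_trans sPG (normal_norm nsNG).
have Pv : v \in P by rewrite (subsetP sCP) // inE Gv cent1id.
have Pz : z \in P.
  by rewrite (subsetP sCP) // inE Gz; apply/cent1P; rewrite /commute (czG v Gv).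
have oCP : #|'C_P[v]| = 4.
  by rewrite -oC; congr #|pred_of_set _|; apply/eqP; rewrite eqEsubset setSI // subsetI sCP subsetIr.
have coNP : coprime #|N| #|P|.
  by rewrite coprime_sym (pnat_coprime pP) // -odd_2'nat.
have defG : N ><| P = G.
  rewrite sdprodE ?coprime_TIg //; apply/eqP; rewrite eqEsubset mul_subG //.
  have PN : P / N = G / N := pHall_id (quotient_pHall nNP sylP) pGN.
  by rewrite -quotientSK ?normal_norm // PN subxx.
have oP4 : #|P| < 8 -> #|P| = 4.
  have : 4 %| #|P| by rewrite -oCP cardSg ?subsetIl.
  have [n ->] := p_natP pP; case: n => [|[|[|n]]] // _.
  by rewrite !expnS !mulnA ltnNge leq_pmulr ?expn_gt0.
exists P; split=> //.
  have [leP | ltP] := leqP 8 #|P|; first exact: cent4_complement_type oCP leP.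
  exact: group4_complement_type (oP4 ltP).
move=> ntN.
have [leP | ltP] := leqP 8 #|P|.
  have [iP' classv] := cent4_class pP Pv oCP leP.
  apply: (squares_induces (P0 := P^`(1)%G) ntN oddN nNP Pv vN); rewrite ?der_sub ?iP' //.
    apply/subsetP=> x P'x; have : v * x \in v ^: P by rewrite classv mem_lcoset mulKg.
    case/imsetP=> p Pp /(canRL (mulKg v)) ->.
    by apply: acts_by_inversion_ratio vN (acts_by_inversion_conj _ vN); apply: (subsetP nNP).
  move=> y Py; have nP'y := subsetP (der_norm 1 P) y Py.
  apply: coset_idr; first exact: groupX.
  rewrite morphX //=; apply/eqP; rewrite -order_dvdn.
  have oPP' : #|P / P^`(1)| = 4 by rewrite card_quotient ?der_norm.
  have : #[coset P^`(1) y] %| 2 ^ 2 by rewrite -[(2 ^ 2)%N]oPP' order_dvdG // mem_quotient.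
  case/(dvdn_pfactor _ _ (isT : prime 2)) => [[|[|[|]]]] // _ oy; rewrite ?oy //.
  case/negP: (cent4_not_abelian Pv oCP leP); apply/cyclic_abelian.
  apply: cyclic_nilpotent_quo_der1_cyclic (pgroup_nil pP) _; apply/cyclicP.
  exists (coset P^`(1) y); apply/eqP.
  by rewrite eq_sym eqEcard cycle_subG mem_quotient // -orderE oy oPP'.
have nZP : P \subset 'N(<[z]>).
  by rewrite cents_norm // (subset_trans sPG) // cent_cycle; apply/subsetP=> x /czG/commute_sym/cent1P.
have oPZ : #|P / <[z]>| = 2.
  by rewrite card_quotient // -divgS ?cycle_subG // oP4 // -orderE oz.
apply: (squares_induces (P0 := <[z]>%G) ntN oddN nNP Pv vN); rewrite ?cycle_subG //.
- exact: odd_core_cent_z defZ.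
- by rewrite -card_quotient // oPZ.
exact: quotient_order2_sqr.
Qed.

Lemma joing_cycle4 (gT : finGroupType) (a b c d : gT) :
  <[a]> <*> <[b]> <*> <[c]> <*> <[d]> = <<[set a; b; c; d]>>.
Proof.
apply/eqP; rewrite eqEsubset !join_subG !cycle_subG !subUset !sub1set.
apply/andP; split; first by rewrite !mem_gen // !inE eqxx ?orbT.
have sub (A B : {set gT}) x : x \in A -> x \in A <*> B by apply: (subsetP (joing_subl A B)).
have sub_r (A : {set gT}) x : x \in A <*> <[x]> by rewrite (subsetP (joing_subr A _)) ?cycle_id.
rewrite -!andbA; apply/and4P; split=> /=.
- by apply: (sub); apply: (sub); apply: (sub); apply: cycle_id.
- by apply: (sub); apply: (sub); apply: sub_r.
- by apply: (sub); apply: sub_r.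
exact: sub_r.
Qed.

Section BinaryOctahedral.

Variables (gT : finGroupType) (Q : {group gT}) (a b g : gT).
Hypotheses (aba : a * b * a = b ^+ 2) (bab : b * a * b = a ^+ 2) (nta3 : a ^+ 3 != 1).
Hypotheses (ag : a ^ g = b) (bg : b ^ g = a) (notKg : g \notin <<[set a; b]>>).
Hypothesis defQ : <<[set a; b; g]>> = Q.

(** As [a * b * c = c ^+ 2] forces [c = a * b], the presentation of [J] reduces to the relations of
    [Q], so every group satisfying it is an image of [Q]. *)
Lemma isog_J_bt : g ^+ 2 = a ^+ 3 -> isog_J Q /\ J_generators Q a b (a * b) g.
Proof.
move=> g2; have b3 := bt_b3 aba bab; have c2 := bt_c2 bab.
have genQ : <<[set a; b; a * b; g]>> = Q.
  apply/eqP; rewrite eqEsubset -defQ !gen_subG !subUset !sub1set.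
  by rewrite groupM ?mem_gen ?inE ?eqxx ?orbT.
have c2' : a * b * (a * b) = g ^+ 2 by rewrite g2 -c2 expg2.
have relQ : [/\ a ^+ 3 = g ^+ 2, b ^+ 3 = g ^+ 2, (a * b) ^+ 2 = g ^+ 2 & a * b * (a * b) = g ^+ 2].
  by rewrite g2 b3 c2 c2'.
split; last by split=> //; case: relQ.
apply: intro_isoGrp => [|rT H].
  apply/existsP; exists (a, b, a * b, g); case: relQ => r1 r2 r3 r4.
  rewrite /= !xpair_eqE r1 r2 r3 r4 ag !eqxx !andbT.
  by rewrite joing_cycle4 genQ.
case/existsP=> [[[[a2 b2] d2] g2']] /= /eqP[defH ra rb rd rabd rag].
have dE : d2 = a2 * b2 by apply: (mulIg d2); rewrite rabd -rd.
have [aba2 bab2] : a2 * b2 * a2 = b2 ^+ 2 /\ b2 * a2 * b2 = a2 ^+ 2.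
  by apply: bt_relations; rewrite -dE rd.
have bg2 : b2 ^ g2' = a2.
  by rewrite -rag -conjgM -expg2 -ra; apply/conjg_fixP/commgP/commuteX.
have := bt_ext_homg aba bab aba2 bab2 nta3 ag bg g2 rag bg2 (esym ra) notKg.
rewrite defQ -defH joing_cycle4; congr (_ \homg _).
apply/eqP; rewrite eqEsubset !gen_subG !subUset !sub1set dE.
by rewrite groupM ?mem_gen ?inE ?eqxx ?orbT.
Qed.

Lemma isog_GL23_bt : g ^+ 2 = 1 -> exists f : {morphism Q >-> {'GL_2(3)}},
  isom Q 'GL_2(3) f /\ f @*^-1 SL 2 'F_3 = <<[set a; b]>>.
Proof.
move=> g2.
have sKQ : <<[set a; b]>> \subset Q by rewrite -defQ genS // subsetUl.
have oQ : #|Q| = 48.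
  by rewrite -defQ (bt_ext_card_eq aba bab nta3 ag bg) // g2 group1.
have isoQ : Q \isog 'GL_2(3).
  have homQ : 'GL_2(3) \homg Q.
    rewrite gl23_def -defQ.
    apply: (@bt_ext_homg _ _ _ _ _ _ _ _ 0) aba bab gl23_aba gl23_bab nta3 ag bg _ gl23_ag gl23_bg
      gl23_g2 notKg.
    by rewrite expg0.
  by rewrite isog_sym isogEcard homQ oQ; apply: (eq_leq (esym gl23_card)).
have [f injf fQ] := isogP isoQ.
exists f; split; first by apply/isomP.
have [Qa Qb] : a \in Q /\ b \in Q.
  by split; apply: (subsetP sKQ); rewrite mem_gen ?set21 ?set22.
suffices sKS : f @* <<[set a; b]>> = SL 2 'F_3 by rewrite -sKS injmK.
apply/eqP; rewrite eqEcard card_injm // [#|<<_>>|](bt_card aba bab nta3) sl23_card leqnn andbT.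
rewrite morphim_gen ?subUset ?sub1set ?Qa // gen_subG morphimU !morphim_set1 // subUset !sub1set !inE.
(* The determinants [x], [y] of the images are nonzero in the field of 3 elements, with [x ^ 2 = y]
   and [y ^ 2 = x], so both are 1. *)
have det_eq x y : x \in Q -> y \in Q -> x * y * x = y ^+ 2 ->
  (\det (GLval (f x)) * \det (GLval (f y)) * \det (GLval (f x)) = \det (GLval (f y)) * \det (GLval (f y)))%R.
  move=> Qx Qy /(congr1 f); rewrite expg2 !morphM ?groupM // => /(congr1 (fun u => \det (GLval u))%R).
  by rewrite !GL_MxE !det_mulmx.
have := det_eq a b Qa Qb aba; have := det_eq b a Qb Qa bab.
have := GL_det (f a); have := GL_det (f b).
move: (\det _)%R (\det _)%R => x y.
by case: x => [[|[|[|x]]] ltx] //; case: y => [[|[|[|y]]] lty].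
Qed.

End BinaryOctahedral.

(** The left side of the equation fixes [N] elementwise and the right side inverts it. *)
Lemma inversion_product_trivial (gT : finGroupType) (N : {group gT}) (u v w c n : gT) :
    odd #|N| -> acts_by_inversion u N -> acts_by_inversion v N -> acts_by_inversion w N ->
    c \in 'C(N) -> n \in 'C(N) -> u * v = c * w * n -> N :=: 1.
Proof.
move=> oddN uN vN wN cN nN uvE; apply/trivgP/subsetP=> m Nm; apply/set1P.
apply: (inversion_fixed oddN) => //.
have cent_fix x : x \in 'C(N) -> {in N, forall k, k ^ x = k}.
  by move=> Cx k Nk; apply/conjg_fixP/commgP/commute_sym; apply: (centP Cx).
have muv : m ^ (u * v) = m by rewrite conjgM uN ?vN ?groupV ?invgK.
by rewrite -{1}muv uvE !conjgM (cent_fix c) // wN // (cent_fix n) ?groupV.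
Qed.

(* [e = a^-1 * a ^ v] lifts to a commutator [~ x, v], the quotient of two elements
   that invert [N], and [a] is a product of conjugates of [e] and [e^-1]. *)
Lemma bt_quotient_centralises (gT : finGroupType) (G N : {group gT}) (v : gT) (a : coset_of N) :
    N <| G -> abelian N -> v \in G -> acts_by_inversion v N -> a \in G / N ->
    a * a ^ coset N v * a = (a ^ coset N v) ^+ 2 -> a ^ coset N v * a * a ^ coset N v = a ^+ 2 ->
  coset N @*^-1 <<[set a; a ^ coset N v]>> \subset 'C(N).
Proof.
move=> nsNG cNN Gv vN La aba bab; have nNG := normal_norm nsNG; have sNG := normal_sub nsNG.
have sNC : N \subset 'C_G(N) by rewrite subsetI sNG.
have nsC : 'C_G(N) / N <| G / N by rewrite quotient_normal // norm_normalI ?norms_cent.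
have nNC : 'C_G(N) \subset 'N(N) := subset_trans (subsetIl _ _) nNG.
pose e := a^-1 * a ^ coset N v.
have Ce : e \in 'C_G(N) / N.
  have [x nNx Gx aE] := morphimP La; rewrite /e aE /= -morphJ ?(subsetP nNG v) //.
  rewrite -morphV // -morphM ?groupV ?groupJ ?(subsetP nNG v) //= mem_quotient //.
  rewrite inE groupM ?groupV ?groupJ //=.
  rewrite -commgEl commgEr conjVg.
  exact: acts_by_inversion_ratio (acts_by_inversion_conj nNx vN) vN.
have bE : a ^ coset N v = a * e by rewrite mulKVg.
(* With [b = a * e], the relation [a * b * a = b ^+ 2] is the braid relation
   [a * e * a = e * a * e]. *)
have aE : a = e * (e ^ a^-1) * e^-1.
  rewrite /e; move: (a ^ coset N v) aba => b; rewrite expg2 => aba'.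
  rewrite conjgE invgK invMg invgK !mulgA mulgK -(mulgA a^-1 b b) -aba' !mulgA.
  by rewrite mulVg mul1g mulgK mulgV mul1g.
have Ca : a \in 'C_G(N) / N.
  rewrite aE groupM ?groupV // groupM // memJ_norm //.
  by rewrite groupV (subsetP (normal_norm nsC)).
rewrite (subset_trans _ (subsetIr G 'C(N))) // -(quotientGK (_ : N <| 'C_G(N))).
  by rewrite morphpreS // gen_subG subUset !sub1set Ca bE groupM.
by rewrite /normal sNC.
Qed.

Theorem lemma3p17 (gT : finGroupType) (G : {group gT}) (v w : gT)
    (ntZ : 'Z(G) :!=: 1) (vw : isolated_edge G v w) :
  [\/ G \isog SL 2 'F_3 \/ G \isog SL 2 'F_5,
      exists N K : {group gT},
        [/\ [/\ N <| G, abelian N & odd #|N|],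
            quotient_GL23_preim_SL23 G N K \/ quotient_J_preim_SL23 G N K,
            K \subset 'C(N)
          & acts_by_inversion v N]
    | exists N H : {group gT},
        [/\ N ><| H = G, abelian N /\ odd #|N|, complement_type H,
            (* for N = 1 (for instance G = D_8) the induced group is trivial *)
            N :!=: 1 -> induces_Z2_or_Z2xZ2 H N
          & acts_by_inversion v N]].
Proof.
have [z [defZ oz Gv notZv oC]] := isolated_edge_cent4 ntZ vw.
set N := 'O_2^'(G)%G.
have nsNG : N <| G := pcore_normal _ _.
have nNG := normal_norm nsNG.
have oddN : odd #|N| := odd_core_odd G.
have vN : acts_by_inversion v N := odd_core_inverted defZ oz Gv oC.
have cNN : abelian N := acts_by_inversion_abelian vN.
have [pL | not_pL] := boolP (2.-group (G / N)).
  have [P [defG typP indP]] := odd_core_complement defZ oz Gv notZv oC pL.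
  by constructor 3; exists N, P.
have Lv : coset N v \in G / N by apply: mem_quotient.
have Zz := odd_core_center defZ.
have ozb := odd_core_order defZ oz Gv oC.
have oCb := odd_core_quotient_card defZ oz Gv oC.
have notZb := odd_core_notZ defZ Gv notZv oC.
have L1 : 'O_2^'(G / N) = 1 by apply: trivg_pcore_quotient.
have [[isoL [g0 [h0 [c0 []]]]] | [a [La aba bab a3 [bv v2 notKv defL]]]] :=
  core_free_class Zz ozb Lv oCb notZb L1 not_pL.
  case/morphimP=> g nNg Gg -> {g0} /morphimP[h nNh Gh ->] {h0} /cycleP[i ->] {c0} prodE.
  constructor 1; have Nz : z \in 'C(N) := odd_core_cent_z defZ.
  have Gz : z \in G by apply: (subsetP (center_sub G)); rewrite defZ cycle_id.
  (* The product relation of [G / N] holds in [G] up to this [n] in [N], which centralises [N]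
     because [N] is abelian. *)
  pose n := (z ^+ i * v ^ h)^-1 * (v * v ^ g).
  have nNv := subsetP nNG v Gv; have nNz := subsetP nNG z Gz.
  have Nn : n \in N.
    have nNvg : v ^ g \in 'N(N) by apply: groupJ.
    have nNvh : v ^ h \in 'N(N) by apply: groupJ.
    have nNzi : z ^+ i \in 'N(N) by apply: groupX.
    have nNzvh : z ^+ i * v ^ h \in 'N(N) by apply: groupM.
    have nNvvg : v * v ^ g \in 'N(N) by apply: groupM.
    apply: coset_idr; first by apply: groupM; rewrite ?groupV.
    have lift1 : coset N (v * v ^ g) = coset N v * coset N v ^ coset N g.
      by rewrite morphM // morphJ.
    have lift2 : coset N (z ^+ i * v ^ h) = coset N z ^+ i * coset N v ^ coset N h.
      by rewrite morphM // morphX // morphJ.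
    rewrite /n morphM ?groupV // morphV //= lift1 lift2.
    by apply/eqP; rewrite -eq_mulVg1; apply/eqP/esym.
  have N1 : N :=: 1.
    apply: (inversion_product_trivial (c := z ^+ i) (n := n) oddN vN).
    - exact: acts_by_inversion_conj nNg vN.
    - exact: acts_by_inversion_conj nNh vN.
    - by rewrite groupX.
    - exact: (subsetP cNN).
    by rewrite mulKVg.
  have isoG : G \isog G / N by rewrite N1; apply: quotient1_isog.
  by case: isoL => isoL; [left | right]; apply: isog_trans isoG isoL.
have ozb1 : a ^+ 3 != 1 by rewrite a3 -order_eq1 ozb.
constructor 2; exists N, (coset N @*^-1 <<[set a; a ^ coset N v]>>)%G.
have sKC := bt_quotient_centralises nsNG cNN Gv vN La aba bab.
split=> //.
(* The square of the image of [v] separates the two extensions: 1 gives GL(2,3), and [a ^+ 3] gives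
   [J]. *)
case: v2 => v2.
  left; have [f [isof fS]] := isog_GL23_bt aba bab ozb1 (erefl _) bv notKv defL v2.
  by exists f; rewrite fS.
right; rewrite -a3 in v2.
have [isoJ genJ] := isog_J_bt aba bab ozb1 (erefl _) bv notKv defL v2.
split=> //; exists a, (a ^ coset N v), (a * a ^ coset N v), (coset N v); split=> //.
suffices -> : <<[set a; a ^ coset N v; a * a ^ coset N v]>> = <<[set a; a ^ coset N v]>> by [].
apply/eqP; rewrite eqEsubset; apply/andP; split; last by rewrite genS // subsetUl.
rewrite gen_subG subUset subset_gen sub1set.
by rewrite groupM // mem_gen ?set21 ?set22.
Qed.
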